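(* Let $d\ge 1$ and let $X,X_1,X_2,\dots$ be i.i.d. random vectors in $\mathbb{R}^d$. Suppose that $X$ has a non-degenerate lattice distribution whose minimal subgroup is $L=H\mathbb{Z}^d$ with $h=|\det H|>0$, and that $\mathbf{b}\in\mathbb{R}^d$ satisfies $\mathbb{P}(X\in\mathbf{b}+H\mathbb{Z}^d)=1$. Suppose also that $\mathbb{E}[\|X\|^2]<\infty$ and that the covariance matrix $M=\mathbb{E}[(X-\boldsymbol{\mu})(X-\boldsymbol{\mu})^{\top}]$ is positive-definite, where $\boldsymbol{\mu}=\mathbb{E}X$. Let $S_n=\sum_{i=1}^nX_i$ and $G_n=\frac1n\sum_{i=1}^nS_i$ for $n\ge 1$. For $\mathbf{x}\in\mathbb{R}^d$ put $$p_n(\mathbf{x})=\mathbb{P}(n^{-1/2}G_n=\mathbf{x}),\qquad g(\mathbf{x})=\frac{\exp\{-\frac32\mathbf{x}^{\top}M^{-1}\mathbf{x}\}}{(2\pi)^{d/2}\sqrt{\det(M/3)}},$$ and $\mathcal{L}_n=\left\{n^{-3/2}\left(\tfrac12n(n+1)\mathbf{b}+H\mathbf{z}\right):\mathbf{z}\in\mathbb{Z}^d\right\}$. Then $$\lim_{n\to\infty}\ \sup_{\mathbf{x}\in\mathcal{L}_n}\left|\frac{n^{3d/2}}{h}\,p_n(\mathbf{x})-g\!\left(\mathbf{x}-\frac{n+1}{2n^{1/2}}\boldsymbol{\mu}\right)\right|=0.$$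
   Context: Vectors in $\mathbb{R}^d$ are column vectors and $\|\cdot\|$ is the Euclidean norm. Non-degenerate means not supported on any $(d-1)$-dimensional hyperplane. For $X$ with a non-degenerate lattice distribution, the minimal subgroup is the unique subgroup $L=H\mathbb{Z}^d$ of $\mathbb{R}^d$ ($H$ an invertible $d\times d$ real matrix) such that $\mathbb{P}(X\in\mathbf{b}+L)=1$ for some $\mathbf{b}\in\mathbb{R}^d$, and such that $L\subseteq L'$ whenever $\mathbb{P}(X\in\mathbf{x}+L')=1$ for some closed subgroup $L'$ of $\mathbb{R}^d$ and some $\mathbf{x}\in\mathbb{R}^d$. *)

(* Defs.v *)
From HB Require Import structures.
From mathcomp Require Import all_boot all_order all_algebra finmap.
From mathcomp Require Import all_classical all_reals all_analysis.

Set Implicit Arguments.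
Unset Strict Implicit.
Unset Printing Implicit Defensive.

Import Order.TTheory GRing.Theory Num.Theory.
Import numFieldNormedType.Exports.

Local Open Scope classical_set_scope.
Local Open Scope ring_scope.

(* The Borel sigma-algebra on matrices, generated by the open sets. *)
HB.instance Definition _ (R : realType) (m n : nat) :=
  @isMeasurable.Build (sigma_display (@open 'M[R]_(m, n))) 'M[R]_(m, n)
    <<s @open 'M[R]_(m, n) >>
    (@sigma_algebra0 _ setT (@open 'M[R]_(m, n)))
    (@sigma_algebraC _ (@open 'M[R]_(m, n)))
    (@sigma_algebra_bigcup _ setT (@open 'M[R]_(m, n))).

Section Vectors.
Context {R : realType} {d : nat}.

Definition dotv (x y : 'cV[R]_d) : R := (x^T *m y) 0 0.

(* The norm `|x| of the library is the sup norm. *)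
Definition enorm (x : 'cV[R]_d) : R := Num.sqrt (dotv x x).

Definition posdefmx (A : 'M[R]_d) : Prop :=
  A^T = A /\ forall x : 'cV[R]_d, x != 0 -> 0 < dotv x (A *m x).

Definition intv (z : 'cV[int]_d) : 'cV[R]_d := map_mx intr z.

Definition lattice (H : 'M[R]_d) : set 'cV[R]_d := range (fun z => H *m intv z).

Definition translate (b : 'cV[R]_d) (A : set 'cV[R]_d) : set 'cV[R]_d :=
  [set b + y | y in A].

Definition closed_subgroup (A : set 'cV[R]_d) : Prop :=
  [/\ closed A, A 0 & forall x y, A x -> A y -> A (x - y)].

Definition hyperplane (a : 'cV[R]_d) (c : R) : set 'cV[R]_d :=
  [set x | dotv a x = c].

End Vectors.

Section RandomVectors.
Context {dT : measure_display} {T : measurableType dT} {R : realType}.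
Context (P : probability T R).

(* Entrywise expectation; the entries are meant to be integrable. *)
Definition expectation_mx {m n : nat} (Y : T -> 'M[R]_(m, n)) : 'M[R]_(m, n) :=
  \matrix_(i, j) fine 'E_P[fun t => Y t i j].

Definition covariance_mx {d : nat} (Y : T -> 'cV[R]_d) : 'M[R]_d :=
  expectation_mx
    (fun t => (Y t - expectation_mx Y) *m (Y t - expectation_mx Y)^T).

(* The two sides are compared on measurable sets only: the value of P on a
   non-measurable set carries no meaning. *)
Definition same_law {dE : measure_display} {E : measurableType dE}
    (Y Z : T -> E) : Prop :=
  forall A : set E, measurable A -> P (Y @^-1` A) = P (Z @^-1` A).

Definition mutually_independent {dE : measure_display} {E : measurableType dE}
    (X : nat -> T -> E) : Prop :=
  forall (J : {fset nat}) (A : nat -> set E),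
    (forall j, j \in J -> measurable (A j)) ->
    P (\bigcap_(j in [set` J]) (X j @^-1` A j)) =
    (\prod_(j <- J) P (X j @^-1` A j))%E.

Definition iid {dE : measure_display} {E : measurableType dE}
    (X : nat -> T -> E) : Prop :=
  (forall i, same_law (X i) (X 0%N)) /\ mutually_independent X.

Context {d : nat}.

Definition supported_on (Y : T -> 'cV[R]_d) (A : set 'cV[R]_d) : Prop :=
  P (Y @^-1` A) = 1%E.

Definition non_degenerate (Y : T -> 'cV[R]_d) : Prop :=
  forall (a : 'cV[R]_d) (c : R), a != 0 -> ~ supported_on Y (hyperplane a c).

Definition lattice_distribution (Y : T -> 'cV[R]_d) : Prop :=
  exists (H : 'M[R]_d) (b : 'cV[R]_d),
    H \in unitmx /\ supported_on Y (translate b (lattice H)).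

Definition minimal_subgroup (Y : T -> 'cV[R]_d) (L : set 'cV[R]_d) : Prop :=
  [/\ exists2 H : 'M[R]_d, H \in unitmx & L = lattice H,
      exists b : 'cV[R]_d, supported_on Y (translate b L) &
      forall (L' : set 'cV[R]_d) (x : 'cV[R]_d),
        closed_subgroup L' -> supported_on Y (translate x L') -> L `<=` L'].

End RandomVectors.

Section CentreOfMass.
Context {T : Type} {R : realType} {d : nat}.

(* Partial sums and their averages start at index 1: the term X 0 is not used. *)
Definition walk (X : nat -> T -> 'cV[R]_d) (n : nat) (t : T) : 'cV[R]_d :=
  \sum_(1 <= i < n.+1) X i t.

Definition centre_of_mass (X : nat -> T -> 'cV[R]_d) (n : nat) (t : T) :
    'cV[R]_d :=
  n%:R^-1 *: \sum_(1 <= i < n.+1) walk X i t.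

End CentreOfMass.

Section LocalLimit.
Context {R : realType} {d : nat}.

Definition com_pmf {dT : measure_display} {T : measurableType dT}
    (P : probability T R) (X : nat -> T -> 'cV[R]_d) (n : nat)
    (x : 'cV[R]_d) : R :=
  fine (P [set t | n%:R `^ (- 2^-1) *: centre_of_mass X n t = x]).

(* Density of the centred normal law with covariance matrix M / 3. *)
Definition com_density (M : 'M[R]_d) (x : 'cV[R]_d) : R :=
  expR (- (3 / 2) * dotv x (invmx M *m x)) /
  ((2 * pi) `^ (d%:R / 2) * Num.sqrt (\det (3^-1 *: M))).

Definition com_lattice (b : 'cV[R]_d) (H : 'M[R]_d) (n : nat) :
    set 'cV[R]_d :=
  range (fun z => n%:R `^ (- (3 / 2)) *:
    ((2^-1 * n%:R * (n%:R + 1)) *: b + H *m intv z)).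

End LocalLimit.

(* Main.v *)
Require Import Defs.
From mathcomp Require Import all_boot all_order all_algebra finmap complex.
From mathcomp Require Import all_classical all_reals all_analysis measurable_realfun.
From mathcomp Require Import ring lra.

Set Implicit Arguments.
Unset Strict Implicit.
Unset Printing Implicit Defensive.

Import Order.TTheory GRing.Theory Num.Theory.
Import numFieldNormedType.Exports.

Local Open Scope classical_set_scope.
Local Open Scope ring_scope.

(** Since n G_n = sum_i (n + 1 - i) X_i, this is a local limit theorem for a
    sum with the weights n, n - 1, .., 1.  Write X_i = b + H Y_i with Y_i in Z^d;
    a point x of the lattice corresponds to an integer vector z, and p_n(x) is
    the probability that sum_i (n + 1 - i) Y_i = z.

    Fourier inversion writes this probability as an integral over the torus of
    exp(-i theta.z) prod_(j <= n) phi(j theta), where phi is the characteristic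
    function of Y.  Put theta = s t with s = n^(-3/2).  As s^2 (1 + 4 + .. + n^2)
    tends to 1/3, the centred integrand tends to exp(- t.V t / 2), where
    V = H^-1 M H^-T / 3 is reduced_cov, and the Fourier transform of this limit
    at the point attached to z is, up to the factor (2 pi)^d |det H|, the
    density g.  The difference between the two sides is thus at most a constant
    times the L1 distance between the two integrands (trunc_error), and z has
    disappeared: this is where the uniformity in x comes from.

    It remains to prove that the L1 distance tends to 0, by dominated
    convergence (iterint_gap_cvg).  The pointwise limit (prodpsi_cvg_gauss) follows
    from the second-order expansion of the characteristic function
    (charf_expansion) and a telescoping bound for products of n factors.  The
    domination is the heart of the proof.  Minimality of H Z^d says that the
    differences of atoms of Y generate Z^d (difference_sum_generate); hence
    |phi(theta)| <= exp(- c sum_k (1 - cos theta_k)) (phi_bound).  The product of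
    these bounds over j theta, j <= n, has the exponent
    - c sum_k sum_j (1 - cos (j theta_k)), and the closed form of the Dirichlet
    kernel bounds the inner sum from below by a multiple of n or of
    n^3 theta_k^2 (cos_deficit_ge).  The integrand is therefore at most a constant
    times prod_k 1 / (1 + t_k^2), uniformly in n (window_psi_dom), and no region
    of the torus needs a separate treatment.

    Three devices keep the analysis elementary.
    - The torus is replaced by the whole space weighted by a product of
      trapezoids.  The translates of the trapezoid by multiples of 2 pi sum to 1,
      so that it integrates the characters exp(i m x) exactly as a period does
      (trapezoid_fourier1), while the weighted integrand is continuous.
    - Z^d is enumerated, and the law of Y is truncated to the first K atoms, so
      that the inversion formula is a finite sum.  Here K grows so fast with n
      that the truncation error (prob_event_approx) remains negligible after the
      multiplication by n^(3d/2).
    - Integrals over R^d are iterated one-dimensional integrals (iterint) of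
      sequentially continuous functions bounded by a multiple of
      prod_k 1 / (1 + t_k^2); this class is stable under integration of one
      coordinate.  The Gaussian transform (iterint_gauss) is then an induction on d,
      in which integrating one coordinate replaces V by its Schur complement. *)

Import Normc.

(** * Cosine sums and the trapezoid *)

Section Trigonometry.
Context {R : realType}.
Implicit Types x y t : R.

Lemma cos_pi4_ge : 7 / 10 <= cos (pi / 4 : R).
Proof.
have p0 := @pi_gt0 R.
have c0 : 0 <= cos (pi / 4 : R) by apply: cos_ge0_pihalf; apply/andP; split; lra.
have := @cos_mulr2n R (pi / 4); rewrite (_ : pi / 4 *+ 2 = pi / 2); last by field.
by rewrite cos_pihalf mulr2n => E; nra.
Qed.

Lemma cos_ge_pi4 x : `|x| <= pi / 4 -> 7 / 10 <= cos x.
Proof.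
move=> xp; apply: le_trans cos_pi4_ge _; rewrite -(cos_norm x).
have p0 := @pi_gt0 R.
rewrite le_eqVlt; case: (ltgtP `|x| (pi / 4)) xp => // [xp _|-> _]; last by rewrite eqxx.
apply/orP; right; rewrite ltr_cos// in_itv/=; apply/andP; split => //; last lra.
by rewrite (le_trans (ltW xp)); lra.
by lra.
Qed.

(** Chord bound by cases: the slope of sine is at least 7/10 up to pi/4,
    and its value is at least 7/10 from pi/4 to 3 pi/4.  The constant
    9 / (10 pi) is chosen to keep the chord below both; the interval reaches 3 pi/4
    because the trapezoid lives on [-3 pi/2, 3 pi/2] and half angles are used. *)
Lemma sin_chord y : 0 <= y <= 3 * pi / 4 -> 9 / (10 * pi) * y <= sin y.
Proof.
move=> /andP[y0 y1]; have p2 := @pi_ge2 R.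
have [kp k0] : 9 / (10 * pi) * pi = 9 / 10 :> R /\ 0 <= 9 / (10 * pi) :> R.
  split; first by field; rewrite gt_eqF; lra.
  by rewrite divr_ge0// mulr_ge0//; lra.
set k := 9 / (10 * pi) in kp k0 *.
have [yp|yp] := leP y (pi / 4).
  move: y0; rewrite le_eqVlt => /orP[/eqP<-|y0]; first by rewrite mulr0 sin0.
  have [c /andP[]] : exists2 c : R, c \in `]0, y[ & sin y - sin 0 = cos c * (y - 0).
    apply: MVT => //.
      by apply: continuous_subspaceT; exact: continuous_sin.
  rewrite !bnd_simp => c0 cy; rewrite sin0 !subr0 => ->.
  rewrite ler_wpM2r ?(ltW y0)//.
  have : 7 / 10 <= cos c by apply: cos_ge_pi4; rewrite gtr0_norm//; lra.
  have : k <= 7 / 10 by nra.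
  lra.
have : 7 / 10 <= sin y.
  rewrite -cosBpihalf; apply: cos_ge_pi4.
  by rewrite ler_norml; apply/andP; split; lra.
have : k * y <= k * (3 * pi / 4) by rewrite ler_wpM2l.
nra.
Qed.

Lemma subr_cos x : 1 - cos x = 2 * sin (x / 2) ^+ 2.
Proof.
have E : x = (x / 2) *+ 2 by field.
by rewrite {1}E cos_mulr2n sin2cos2 mulr2n; ring.
Qed.

(** The function 1 - cos is, up to a factor 2, a squared distance on the
    circle, hence subadditive with a loss of a factor 2.  The iterate below turns
    bounds for generators of Z^d into bounds for the coordinates. *)
Lemma subr_cosD x y : 1 - cos (x + y) <= 2 * (1 - cos x) + 2 * (1 - cos y).
Proof.
rewrite cosD -subr_ge0.
have := cos2Dsin2 x; have := cos2Dsin2 y.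
have := sqr_ge0 (cos x + cos y - 2); have := sqr_ge0 (sin x - sin y).
rewrite !expr2; nra.
Qed.

Lemma subr_cos_sum (I : Type) (s : seq I) (f : I -> R) :
  1 - cos (\sum_(i <- s) f i) <= 2 ^+ size s * \sum_(i <- s) (1 - cos (f i)).
Proof.
elim: s => [|i s IH]; first by rewrite !big_nil cos0 subrr mulr0.
rewrite !big_cons /=; apply: (le_trans (subr_cosD _ _)); rewrite exprS.
have h0 : 0 <= \sum_(i <- s) (1 - cos (f i)).
  by apply: sumr_ge0 => j _; rewrite subr_ge0 cos_le1.
have h1 : 0 <= 1 - cos (f i) by rewrite subr_ge0 cos_le1.
have h2 : 1 <= 2 ^+ size s :> R by rewrite exprn_ege1// ler1n.
move: IH h0 h1 h2; set A := \sum_(i <- s) _; set B := 1 - cos (f i).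
set C := 2 ^+ _; nra.
Qed.

(** The telescoping form of the Dirichlet kernel, multiplied by its
    denominator so that no angle is excluded. *)
Lemma dirichlet n t : 2 * sin (t / 2) * \sum_(1 <= j < n.+1) cos (j%:R * t) =
  sin ((n%:R + 2^-1) * t) - sin (t / 2).
Proof.
elim: n => [|n IH]; first by rewrite big_geq// mulr0 add0r (mulrC _ t) subrr.
rewrite big_nat_recr//= mulrDr IH.
have -> : (n.+1%:R + 2^-1) * t = n.+1%:R * t + t / 2 by field.
have -> : (n%:R + 2^-1) * t = n.+1%:R * t - t / 2 by rewrite -natr1; field.
by rewrite sinB sinD; ring.
Qed.

Lemma sum_sqr_ge n : n%:R ^+ 3 / 3 <= \sum_(1 <= j < n.+1) j%:R ^+ 2 :> R.
Proof.
elim: n => [|n IH]; first by rewrite big_geq// expr0n mul0r.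
rewrite big_nat_recr//=; apply: le_trans (lerD IH (lexx _)).
by rewrite -natr1; have : 0 <= n%:R :> R by []; nra.
Qed.

(** The exponent of the decay of the product of the characteristic
    functions at the angles t, 2 t, .., n t. *)
Definition cos_deficit n t : R := \sum_(1 <= j < n.+1) (1 - cos (j%:R * t)).

Lemma cos_deficitN n t : cos_deficit n (- t) = cos_deficit n t.
Proof. by apply: eq_bigr => j _; rewrite mulrN cosN. Qed.

(** If n |t| is large, the Dirichlet kernel shows that the cosines
    average at most 3/4; otherwise all half angles j t / 2 stay in the range of
    the chord bound, and 1 - cos is of the order of j^2 t^2. *)
Lemma cos_deficit_ge n t : (0 < n)%N -> `|t| <= 3 * pi / 2 ->
  n%:R / 4 <= cos_deficit n t \/ (9 / (10 * pi)) ^+ 2 * n%:R ^+ 3 * t ^+ 2 / 6 <= cos_deficit n t.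
Proof.
wlog t0 : t / 0 <= t.
  move=> W n0 tp; have [t0|t0] := leP 0 t; first exact: W.
  by rewrite -cos_deficitN -(sqrrN t); apply: W => //; [lra|rewrite normrN].
rewrite ger0_norm// => n0 tp; have p2 := @pi_ge2 R.
have [kp k0] : 9 / (10 * pi) * pi = 9 / 10 :> R /\ 0 < 9 / (10 * pi) :> R.
  split; first by field; rewrite gt_eqF; lra.
  by rewrite divr_gt0// mulr_gt0//; lra.
set k := 9 / (10 * pi) in kp k0 *.
have n1 : 1 <= n%:R :> R by rewrite ler1n.
have [nt|nt] := leP (3 * pi / 2) (n%:R * t).
  left.
  have tpos : 0 < t.
    by rewrite lt_neqAle t0 andbT; apply/eqP => t00; move: nt; rewrite -t00 mulr0; lra.
  have sk : k * (t / 2) <= sin (t / 2) by apply: sin_chord; apply/andP; split; lra.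
  have -> : cos_deficit n t = n%:R - \sum_(1 <= j < n.+1) cos (j%:R * t).
    by rewrite /cos_deficit sumrB sumr_const_nat subn1.
  have := dirichlet n t; have := sin_le1 ((n%:R + 2^-1) * t).
  move: sk; set S := \sum_(_ <= _ < _) _; set s := sin (t / 2); set a := sin (_ * t).
  move=> sk a1 E.
  have kn : k * (n%:R * t) >= k * (3 * pi / 2) by rewrite ler_pM2l.
  have s0 : 0 < s by apply: lt_le_trans sk; rewrite mulr_gt0// divr_gt0.
  have kns : n%:R * s >= 27 / 40.
    have : n%:R * (k * (t / 2)) <= n%:R * s by rewrite ler_wpM2l.
    lra.
  have : S * s <= (3 / 4 * n%:R) * s by lra.
  by rewrite ler_pM2r// => ?; lra.
right.
apply: (@le_trans _ _ (\sum_(1 <= j < n.+1) k ^+ 2 * t ^+ 2 / 2 * j%:R ^+ 2)).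
  rewrite -mulr_sumr.
  have h : 0 <= k ^+ 2 * t ^+ 2 / 2 by rewrite divr_ge0// mulr_ge0// sqr_ge0.
  by have := ler_wpM2l h (sum_sqr_ge n); lra.
rewrite /cos_deficit !big_nat; apply: ler_sum => j /andP[j0 jn].
rewrite subr_cos.
have jn' : j%:R <= n%:R :> R by rewrite ler_nat.
have j0' : 0 <= j%:R :> R by [].
have jt : j%:R * t <= n%:R * t by rewrite ler_wpM2r.
have jt0 : 0 <= j%:R * t by rewrite mulr_ge0.
have h : k * (j%:R * t / 2) <= sin (j%:R * t / 2).
  by apply: sin_chord; apply/andP; split; lra.
have h0 : 0 <= k * (j%:R * t / 2) by rewrite mulr_ge0 ?(ltW k0)// divr_ge0.
have : (k * (j%:R * t / 2)) ^+ 2 <= sin (j%:R * t / 2) ^+ 2 by rewrite lerXn2r ?nnegrE// (le_trans h0).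
by rewrite !exprMn; lra.
Qed.

(** Equal to 1 on [-pi/2, pi/2], to 0 outside [-3 pi/2, 3 pi/2], and affine
    in between: the translates by multiples of 2 pi sum to 1. *)
Definition trapezoid x : R := Num.max 0 (Num.min 1 (3 / 2 - `|x| / pi)).

Lemma trapezoid_ge0 x : 0 <= trapezoid x. Proof. by rewrite le_max lexx. Qed.

Lemma trapezoid_le1 x : trapezoid x <= 1.
Proof. by rewrite ge_max ler01 ge_min lexx. Qed.

Lemma trapezoid_out x : 3 * pi / 2 <= `|x| -> trapezoid x = 0.
Proof.
move=> xp; apply/max_idPl; rewrite ge_min; apply/orP; right.
by rewrite subr_le0 ler_pdivlMr ?pi_gt0//; lra.
Qed.

Lemma trapezoid_in x : `|x| <= pi / 2 -> trapezoid x = 1.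
Proof.
move=> xp; rewrite /trapezoid (_ : Num.min _ _ = 1) ?max_r//.
by apply/min_idPl; rewrite lerBrDr -lerBrDl ler_pdivrMr ?pi_gt0//; lra.
Qed.

Lemma trapezoid_mid x : pi / 2 <= `|x| <= 3 * pi / 2 -> trapezoid x = 3 / 2 - `|x| / pi.
Proof.
move=> /andP[x1 x2]; have p0 := @pi_gt0 R.
rewrite /trapezoid (_ : Num.min _ _ = 3 / 2 - `|x| / pi).
  by apply/max_idPr; rewrite subr_ge0 ler_pdivrMr//; lra.
by apply/min_idPr; rewrite lerBlDr -lerBlDl ler_pdivlMr//; lra.
Qed.

Lemma continuous_trapezoid : continuous trapezoid.
Proof.
move=> x; rewrite /trapezoid.
apply: (@continuous_max _ _ (cst 0) (fun x => Num.min 1 (3 / 2 - `|x| / pi))) => //.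
  exact: cst_continuous.
apply: (@continuous_min _ _ (cst 1) (fun x => 3 / 2 - `|x| / pi)) => //.
  exact: cst_continuous.
apply: cvgB; first exact: cvg_cst.
by apply: cvgMl; exact: norm_continuous.
Qed.

Lemma expRN_le x : 0 <= x -> expR (- x) <= (1 + x)^-1.
Proof.
by move=> x0; rewrite expRN lef_pV2 ?posrE ?expR_gt0 ?expR_ge1Dx//; lra.
Qed.

Lemma expRN_le3 x : 0 <= x -> expR (- x) <= ((1 + x / 3) ^+ 3)^-1.
Proof.
move=> x0; have -> : - x = 3%:R * - (x / 3) by field.
rewrite expRM_natl -exprVn lerXn2r ?nnegrE ?expR_ge0//.
  by rewrite invr_ge0; lra.
by apply: expRN_le; lra.
Qed.

(** The uniform domination in one variable.  In the first case of the
    lower bound for the exponent, t^2 <= C n^3 on the support of the trapezoid,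
    and a cubic bound for the exponential beats n^3; in the second one,
    n^3 (s t)^2 = t^2 makes the exponent quadratic in t. *)
Lemma trapezoid_exp_le (c : R) : 0 < c -> exists2 C : R, 0 <= C &
  forall n s t, (0 < n)%N -> 0 <= s -> s ^+ 2 * n%:R ^+ 3 = 1 ->
    trapezoid (s * t) * expR (- (c * cos_deficit n (s * t))) <= C * (1 + t ^+ 2)^-1.
Proof.
move=> c0; pose k : R := 9 / (10 * pi); have p2 := @pi_ge2 R.
have k0 : 0 < k by rewrite divr_gt0// mulr_gt0//; lra.
pose P : R := (3 * pi / 2) ^+ 2.
pose C1 : R := (1 + P) * (12 / c) ^+ 3.
pose q : R := c * k ^+ 2 / 6.
have q0 : 0 < q by rewrite divr_gt0// mulr_gt0// exprn_gt0.
have P0 : 0 <= P by exact: sqr_ge0.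
have C10 : 0 <= C1 by rewrite mulr_ge0 ?exprn_ge0// ?divr_ge0 ?ltW//; lra.
have q10 : 0 <= q^-1 by rewrite invr_ge0 ltW.
exists (C1 + (1 + q^-1)) => [|n s t n0 s0 sn]; first lra.
have t0 : 0 < 1 + t ^+ 2 by rewrite ltr_wpDr ?sqr_ge0.
have [st|st] := leP (3 * pi / 2) `|s * t|.
  by rewrite trapezoid_out// mul0r mulr_ge0// ?invr_ge0 ?ltW//; lra.
apply: (@le_trans _ _ (expR (- (c * cos_deficit n (s * t))))).
  by rewrite ler_piMl ?expR_ge0// trapezoid_le1.
rewrite ler_pdivlMr//.
have n1 : 1 <= n%:R :> R by rewrite ler1n.
have E : n%:R ^+ 3 * (s * t) ^+ 2 = t ^+ 2 by rewrite exprMn mulrA (mulrC _ (s ^+ 2)) sn mul1r.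
have [h|h] := cos_deficit_ge n0 (ltW st).
  apply: (@le_trans _ _ C1); last lra.
  have h1 : expR (- (c * cos_deficit n (s * t))) <= ((1 + c * n%:R / 12) ^+ 3)^-1.
    apply: (@le_trans _ _ (expR (- (c * n%:R / 4)))).
      rewrite ler_expR lerN2 -mulrA; exact: (ler_wpM2l (ltW c0) h).
    have := @expRN_le3 (c * n%:R / 4); rewrite (_ : c * n%:R / 4 / 3 = c * n%:R / 12); last by field.
    by apply; rewrite divr_ge0// mulr_ge0// ltW.
  have b0 : 0 < 1 + c * n%:R / 12 by rewrite ltr_wpDr// divr_ge0// mulr_ge0// ltW.
  apply: (le_trans (ler_wpM2r (ltW t0) h1)).
  rewrite mulrC ler_pdivrMr ?exprn_gt0//.
  apply: (@le_trans _ _ ((1 + P) * n%:R ^+ 3)).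
    have : t ^+ 2 <= P * n%:R ^+ 3.
      rewrite -E mulrC ler_wpM2r ?exprn_ge0// -(real_normK (num_real (s * t))).
      by rewrite lerXn2r ?nnegrE// ?(le_trans _ (ltW st)) // ltW.
    have : 1 <= n%:R ^+ 3 :> R by rewrite exprn_ege1.
    lra.
  rewrite /C1 -(mulrA (1 + P)) -exprMn; apply: ler_wpM2l; first lra.
  rewrite lerXn2r ?nnegrE//; first by rewrite mulr_ge0 ?divr_ge0 ?ltW.
  rewrite mulrDr mulr1 (_ : 12 / c * (c * n%:R / 12) = n%:R).
    by rewrite lerDr divr_ge0 ?ltW.
  by field; rewrite gt_eqF.
apply: (@le_trans _ _ (1 + q^-1)); last lra.
have qt0 : 0 <= q * t ^+ 2 by rewrite mulr_ge0 ?sqr_ge0 ?ltW.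
have h1 : expR (- (c * cos_deficit n (s * t))) <= (1 + q * t ^+ 2)^-1.
  apply: (@le_trans _ _ (expR (- (q * t ^+ 2)))); last exact: expRN_le.
  rewrite ler_expR lerN2; apply: le_trans (ler_wpM2l (ltW c0) h).
  by rewrite -(mulrA (k ^+ 2)) E /q -/k; lra.
apply: (le_trans (ler_wpM2r (ltW t0) h1)).
rewrite mulrC ler_pdivrMr ?ltr_wpDr//.
have : q^-1 * (q * t ^+ 2) = t ^+ 2 by rewrite mulrA mulVf ?mul1r// gt_eqF.
by move: qt0; set a := q * t ^+ 2 => a0 Ea; rewrite mulrDl mul1r mulrDr mulr1 Ea; lra.
Qed.

End Trigonometry.

(** * Iterated integrals of functions dominated by Cauchy densities *)

Section iterint.
Context {R : realType}.
Notation leb := (@lebesgue_measure R).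

(** The dominating function; its products are integrable and survive the
    integration of a coordinate. *)
Definition cauchy (x : R) : R := (1 + x ^+ 2)^-1.

Lemma cauchy_gt0 x : 0 < cauchy x.
Proof. by rewrite invr_gt0 ltr_wpDr ?sqr_ge0. Qed.

Lemma cauchy_ge0 x : 0 <= cauchy x. Proof. exact/ltW/cauchy_gt0. Qed.

Lemma cauchy_le1 x : cauchy x <= 1.
Proof. by rewrite invf_le1 ?lerDl ?sqr_ge0// ltr_wpDr ?sqr_ge0. Qed.

Lemma continuous_cauchy : continuous cauchy.
Proof.
move=> x; apply: cvgV; first by rewrite gt_eqF// ltr_wpDr ?sqr_ge0.
by apply: cvgD; [exact: cvg_cst|exact: exprn_continuous].
Qed.

Lemma integral_cauchy : (\int[leb]_x (cauchy x)%:E = pi%:E)%E.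
Proof.
rewrite ge0_symfun_integralT //=; last 3 first.
- exact: cauchy_ge0.
- exact: continuous_cauchy.
- by move=> x; rewrite /= /cauchy sqrrN.
rewrite (_ : [set x | _] = `[0, +oo[%classic); last first.
  by apply/seteqP; split => x/=; rewrite in_itv/= andbT.
rewrite (@ge0_continuous_FTC2y R cauchy atan 0 (pi / 2)).
- by rewrite atan0 -EFinB -EFinM subr0 mulrCA divff// mulr1.
- by move=> x _; exact: cauchy_ge0.
- exact/continuous_subspaceT/continuous_cauchy.
- exact: cvgy_atan.
- by move=> x _; have [] := is_derive1_atan x.
- by apply: cvg_at_right_filter; exact: continuous_atan.
- by move=> x _; rewrite derive1E (@derive_val _ _ _ _ _ _ _ (is_derive1_atan x)).
Qed.

Lemma integrable_cauchy : leb.-integrable setT (EFin \o cauchy).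
Proof.
apply/integrableP; split.
  by apply/measurable_EFinP; exact: (continuous_measurable_fun continuous_cauchy).
under eq_integral do rewrite gee0_abs ?lee_fin ?cauchy_ge0//.
by rewrite integral_cauchy ltry.
Qed.

Lemma integrable_cauchyZ C : leb.-integrable setT (EFin \o (fun x => C * cauchy x)).
Proof.
exact: (integrableZl measurableT C integrable_cauchy).
Qed.

Lemma Rintegral_cauchyZ C : \int[leb]_x (C * cauchy x) = C * pi.
Proof.
by rewrite RintegralZl//; [rewrite /Rintegral integral_cauchy|exact: integrable_cauchy].
Qed.

Lemma integrable_dom (f : R -> R) C : continuous f ->
  (forall x, `|f x| <= C * cauchy x) -> leb.-integrable setT (EFin \o f).
Proof.
move=> cf fC; apply: le_integrable (integrable_cauchyZ C) => //.
  by apply/measurable_EFinP; exact: (continuous_measurable_fun cf).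
by move=> x _ /=; rewrite lee_fin (le_trans (fC x))// ler_norm.
Qed.

Lemma Rintegral_dominated_cvg (dT : measure_display) (T : measurableType dT)
    (mu : {measure set T -> \bar R}) (f_ : nat -> T -> R) (f g : T -> R) :
    (forall n, measurable_fun setT (f_ n)) ->
    (forall x, f_ n x @[n --> \oo] --> f x) ->
    mu.-integrable setT (EFin \o g) ->
    (forall n x, `|f_ n x| <= g x) ->
  \int[mu]_x f_ n x @[n --> \oo] --> \int[mu]_x f x.
Proof.
move=> mf ff ig fg; apply: fine_cvg.
have mf' n : measurable_fun [set: T] (EFin \o f_ n) by apply/measurable_EFinP.
have fE x : (f_ n x)%:E @[n --> \oo] --> (f x)%:E by apply: cvg_EFin; [exact: nearW|exact: ff].
have mf0 : measurable_fun [set: T] (EFin \o f).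
  by apply: (emeasurable_fun_cvg (fun n => EFin \o f_ n)) => //= x _; exact: fE.
have [i1 _ i3] : [/\ mu.-integrable setT (EFin \o f), _ & _] :=
  @dominated_convergence _ _ _ mu setT measurableT (fun n => EFin \o f_ n) _ _ mf' mf0
  (aeW mu (fun x (_ : setT x) => fE x)) ig
  (aeW mu (fun x n (_ : setT x) => fg n x)).
rewrite fineK; first exact: i3.
by apply: integrable_fin_num => //.
Qed.

Lemma Rintegral_cvg (f_ : nat -> R -> R) (f : R -> R) C :
    (forall n, continuous (f_ n)) ->
    (forall n x, `|f_ n x| <= C * cauchy x) ->
    (forall x, f_ n x @[n --> \oo] --> f x) ->
  \int[leb]_x f_ n x @[n --> \oo] --> \int[leb]_x f x.
Proof.
move=> cf fC ff.
apply: (@Rintegral_dominated_cvg _ (measurableTypeR R) leb f_ f _ _ ff (integrable_cauchyZ C) fC).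
by move=> n; exact: (continuous_measurable_fun (cf n)).
Qed.

Definition consv d (x : R) (v : 'cV[R]_d) : 'cV[R]_d.+1 :=
  (col_mx x%:M v : 'cV[R]_(1 + d)).

Lemma consv0 d x (v : 'cV[R]_d) : consv x v ord0 0 = x.
Proof.
transitivity ((col_mx x%:M v : 'cV_(1 + d)) (lshift d (ord0 : 'I_1)) 0).
  by congr (fun_of_matrix _ _ _); exact/val_inj.
by rewrite col_mxEu mxE eqxx mulr1n.
Qed.

Lemma consvS d x (v : 'cV[R]_d) k : consv x v (lift ord0 k) 0 = v k 0.
Proof.
transitivity ((col_mx x%:M v : 'cV_(1 + d)) (rshift 1 k) 0).
  by congr (fun_of_matrix _ _ _); exact/val_inj.
by rewrite col_mxEd.
Qed.

(** The integral over R^d, one coordinate after the other, first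
    coordinate innermost. *)
Fixpoint iterint d : ('cV[R]_d -> R) -> R :=
  match d return ('cV[R]_d -> R) -> R with
  | 0 => fun u => u 0
  | d'.+1 => fun u => iterint (fun v => \int[leb]_x u (consv x v))
  end.

Definition coord_cvg d (v_ : nat -> 'cV[R]_d) (v : 'cV[R]_d) :=
  forall k, v_ n k 0 @[n --> \oo] --> v k 0.

(** Coordinatewise sequential continuity is exactly what dominated
    convergence propagates from a function to its partial integrals. *)
Definition seqcont d (u : 'cV[R]_d -> R) := forall v_ v,
  coord_cvg v_ v -> u (v_ n) @[n --> \oo] --> u v.

Definition cauchy_dom d (C : R) (u : 'cV[R]_d -> R) :=
  forall t, `|u t| <= C * \prod_k cauchy (t k 0).

(** The class of integrands: stable under integration of one coordinate, it
    makes every inner integral of an iterated integral converge absolutely. *)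
Definition admissible d (u : 'cV[R]_d -> R) := seqcont u /\ exists2 C, 0 <= C & cauchy_dom C u.

Lemma prodc_le1 d (v : 'cV[R]_d) : \prod_k cauchy (v k 0) <= 1.
Proof. by apply: prodr_ile1 => k _; rewrite cauchy_ge0 cauchy_le1. Qed.

Lemma prodc_consv d x (v : 'cV[R]_d) :
  \prod_k cauchy (consv x v k 0) = cauchy x * \prod_k cauchy (v k 0).
Proof. by rewrite big_ord_recl consv0; congr (_ * _); apply: eq_bigr => k _; rewrite consvS. Qed.

Lemma seq_continuous (f : R -> R) :
  (forall x_ x, x_ n @[n --> \oo] --> x -> f (x_ n) @[n --> \oo] --> f x) -> continuous f.
Proof. by move=> h x; apply/(@cvg_nbhsP _ R^o) => u ux; exact: h. Qed.

Lemma seqcont_slice d (u : 'cV[R]_d.+1 -> R) v : seqcont u ->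
  continuous (fun x => u (consv x v)).
Proof.
move=> cu; apply: seq_continuous => x_ x xx; apply: cu => k.
case: (unliftP ord0 k) => [j ->|->].
  by under eq_fun do rewrite consvS; rewrite consvS; exact: cvg_cst.
by under eq_fun do rewrite consv0; rewrite consv0.
Qed.

Lemma cauchy_dom_slice d C (u : 'cV[R]_d.+1 -> R) v : cauchy_dom C u ->
  forall x, `|u (consv x v)| <= (C * \prod_k cauchy (v k 0)) * cauchy x.
Proof.
by move=> uC x; rewrite (le_trans (uC _))// prodc_consv mulrAC mulrA.
Qed.

Lemma cauchy_dom_slice1 d C (u : 'cV[R]_d.+1 -> R) v : 0 <= C -> cauchy_dom C u ->
  forall x, `|u (consv x v)| <= C * cauchy x.
Proof.
move=> C0 uC x; rewrite (le_trans (cauchy_dom_slice v uC x))//.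
by rewrite ler_wpM2r ?cauchy_ge0// ler_piMr// prodc_le1.
Qed.

Lemma seqcont_step d C (u : 'cV[R]_d.+1 -> R) : 0 <= C -> seqcont u -> cauchy_dom C u ->
  seqcont (fun v => \int[leb]_x u (consv x v)).
Proof.
move=> C0 cu uC v_ v vv; apply: (@Rintegral_cvg _ _ C).
- by move=> n; exact: seqcont_slice.
- by move=> n x; exact: cauchy_dom_slice1.
- move=> x; apply: cu => k; case: (unliftP ord0 k) => [j ->|->].
    by under eq_fun do rewrite consvS; rewrite consvS; exact: vv.
  by under eq_fun do rewrite consv0; rewrite consv0; exact: cvg_cst.
Qed.

Lemma cauchy_dom_step d C (u : 'cV[R]_d.+1 -> R) : seqcont u -> cauchy_dom C u ->
  cauchy_dom (C * pi) (fun v => \int[leb]_x u (consv x v)).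
Proof.
move=> cu uC v.
have cs := seqcont_slice (v := v) cu.
rewrite (le_trans (le_normr_Rintegral _ (integrable_dom cs (cauchy_dom_slice v uC))))//.
rewrite mulrAC -Rintegral_cauchyZ; apply: le_Rintegral => //.
- apply: (@integrable_dom _ (C * \prod_k cauchy (v k 0))).
    by move=> x; apply: cvg_norm; exact: cs.
  by move=> x; rewrite normr_id; exact: cauchy_dom_slice.
- exact: integrable_cauchyZ.
- by move=> x _; exact: cauchy_dom_slice.
Qed.

Lemma admissible_slice d (u : 'cV[R]_d.+1 -> R) v : admissible u ->
  leb.-integrable setT (EFin \o (fun x => u (consv x v))).
Proof.
by case=> cu [C C0 uC]; exact: (integrable_dom (seqcont_slice (v := v) cu) (cauchy_dom_slice v uC)).
Qed.

Lemma admissible_step d (u : 'cV[R]_d.+1 -> R) : admissible u ->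
  admissible (fun v => \int[leb]_x u (consv x v)).
Proof.
case=> cu [C C0 uC]; split; first exact: (seqcont_step C0).
by exists (C * pi); [rewrite mulr_ge0// pi_ge0|exact: cauchy_dom_step].
Qed.

Lemma eq_iterint d (u w : 'cV[R]_d -> R) : u =1 w -> iterint u = iterint w.
Proof. by move=> /funext ->. Qed.

(** Dominated convergence for iterated integrals, by induction on the
    dimension: each step costs a factor pi, the integral of the dominating
    function. *)
Lemma iterint_cvg d (u_ : nat -> 'cV[R]_d -> R) u C : 0 <= C ->
  (forall n, seqcont (u_ n)) -> (forall n, cauchy_dom C (u_ n)) ->
  (forall t, u_ n t @[n --> \oo] --> u t) -> iterint (u_ n) @[n --> \oo] --> iterint u.
Proof.
elim: d u_ u C => [|d IH] u_ u C C0 cu uC uu /=; first exact: uu.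
apply: (IH _ _ (C * pi)).
- by rewrite mulr_ge0// pi_ge0.
- by move=> n; exact: (seqcont_step C0).
- by move=> n; exact: cauchy_dom_step.
- move=> v; apply: (@Rintegral_cvg _ _ C).
  + by move=> n; exact: seqcont_slice.
  + by move=> n x; exact: cauchy_dom_slice1.
  + by move=> x; exact: uu.
Qed.

Lemma admissible_lin d (u w : 'cV[R]_d -> R) a b : admissible u -> admissible w ->
  admissible (fun t => a * u t + b * w t).
Proof.
case=> cu [C C0 uC] [cw [D D0 wD]]; split.
  by move=> v_ v vv; apply: cvgD; apply: cvgMr; [exact: cu|exact: cw].
exists (`|a| * C + `|b| * D); first by rewrite addr_ge0// mulr_ge0.
move=> t; rewrite (le_trans (ler_normD _ _))// !normrM mulrDl -!mulrA.
by apply: lerD; rewrite ler_wpM2l.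
Qed.

Lemma iterint_lin d (u w : 'cV[R]_d -> R) a b : admissible u -> admissible w ->
  iterint (fun t => a * u t + b * w t) = a * iterint u + b * iterint w.
Proof.
elim: d u w => [//|d IH] u w au aw /=.
rewrite -IH; [|exact: admissible_step..].
apply: eq_iterint => v.
have iu := admissible_slice v au; have iw := admissible_slice v aw.
rewrite RintegralD//; first by rewrite !RintegralZl.
- exact: (integrableZl measurableT a iu).
- exact: (integrableZl measurableT b iw).
Qed.

Lemma le_iterint d (u w : 'cV[R]_d -> R) : admissible u -> admissible w -> (forall t, u t <= w t) ->
  iterint u <= iterint w.
Proof.
elim: d u w => [|d IH] u w au aw uw /=; first exact: uw.
apply: IH; [exact: admissible_step..|] => v.
by apply: le_Rintegral => //; exact: admissible_slice.
Qed.

Lemma ler_dist_iterint d (u w z : 'cV[R]_d -> R) : admissible u -> admissible w -> admissible z ->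
  (forall t, `|u t - w t| <= z t) -> `|iterint u - iterint w| <= iterint z.
Proof.
move=> au aw az uwz.
have -> : iterint u - iterint w = iterint (fun t => 1 * u t + (-1) * w t).
  by rewrite iterint_lin// mul1r mulN1r.
rewrite ler_norml; apply/andP; split.
  rewrite (_ : - iterint z = iterint (fun t => (-1) * z t + 0 * z t)); last first.
    by rewrite iterint_lin// mulN1r mul0r addr0.
  apply: le_iterint => [||t]; [exact: admissible_lin..|].
  by have := uwz t; rewrite ler_norml => /andP[+ _]; lra.
apply: le_iterint => [||t]; [exact: admissible_lin|exact: az|].
by have := uwz t; rewrite ler_norml => /andP[_ +]; lra.
Qed.

Lemma admissible0 d : admissible (fun _ : 'cV[R]_d => 0).
Proof.
split; first by move=> ? ? _; exact: cvg_cst.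
by exists 0 => // t; rewrite normr0 mul0r.
Qed.

Lemma iterint0 d : iterint (fun _ : 'cV[R]_d => 0) = 0.
Proof.
have := iterint_lin 0 0 (admissible0 d) (admissible0 d); rewrite !mul0r addr0 => E.
by rewrite -[RHS]E; apply: eq_iterint => t; rewrite ?(mul0r, addr0).
Qed.

Lemma iterint_sum d (I : Type) (r : seq I) (a : I -> R) (u : I -> 'cV[R]_d -> R) :
  (forall i, admissible (u i)) ->
  admissible (fun t => \sum_(i <- r) a i * u i t) /\
  iterint (fun t => \sum_(i <- r) a i * u i t) = \sum_(i <- r) a i * iterint (u i).
Proof.
move=> au; elim: r => [|i r [IH1 IH2]].
  rewrite big_nil; under eq_fun do rewrite big_nil.
  by split; [exact: admissible0|exact: iterint0].
have E : (fun t => \sum_(j <- i :: r) a j * u j t) =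
   (fun t => a i * u i t + 1 * \sum_(j <- r) a j * u j t).
  by apply/funext => t; rewrite big_cons mul1r.
rewrite E big_cons; split; first exact: admissible_lin.
by rewrite iterint_lin// IH2 mul1r.
Qed.

End iterint.

(** * The one-dimensional Gaussian transform *)

Section OneDim.
Context {R : realType}.
Notation leb := (@lebesgue_measure R).

Lemma is_derive_FTC (F f : R -> R) (a b : R) : a <= b ->
  (forall x : R, is_derive x 1 F (f x)) -> continuous f ->
  \int[leb]_(x in `[a, b]) f x = F b - F a.
Proof.
rewrite le_eqVlt => /orP[/eqP<-|ab] dF cf.
  by rewrite set_itv1 Rintegral_set1 subrr.
have cF : continuous F.
  by move=> x; apply/differentiable_continuous/derivable1_diffP; have [] := dF x.
rewrite /Rintegral (@continuous_FTC2 R f F a b)//.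
- exact: continuous_subspaceT.
- split; first by move=> x _; have [] := dF x.
  + by apply: cvg_at_right_filter; exact: cF.
  + by apply: cvg_at_left_filter; exact: cF.
- by move=> x _; rewrite derive1E; exact: (@derive_val _ _ _ _ _ _ _ (dF x)).
Qed.

(** Integration by parts on the line in its barest form: a
    primitive that vanishes at both ends makes the integral of its derivative
    zero. *)
Lemma integral_derive_eq0 (F f : R -> R) (C D : R) :
  (forall x : R, is_derive x 1 F (f x)) -> continuous f ->
  (forall x, `|F x| <= C * cauchy x) -> (forall x, `|f x| <= D * cauchy x) ->
  \int[leb]_x f x = 0.
Proof.
move=> dF cf FC fD.
have c0 : cauchy (n%:R : R) @[n --> \oo] --> (0 : R).
  apply/cvgrPdist_le => e e0; near=> n.
  rewrite sub0r normrN ger0_norm ?cauchy_ge0//.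
  have n0 : e^-1 <= n%:R :> R by near: n; exact: nbhs_infty_ger.
  have n1 : 0 < n%:R :> R by apply: lt_le_trans n0; rewrite invr_gt0.
  rewrite /cauchy -[leRHS]invrK lef_pV2 ?posrE ?invr_gt0// ?ltr_wpDr ?sqr_ge0//.
  rewrite (le_trans n0)//; have := sqr_ge0 (n%:R - 1 : R); lra.
have FN s : s ^+ 2 = 1 -> F (s * n%:R) @[n --> \oo] --> (0 : R).
  move=> s2; apply: norm_cvg0; apply: (@squeeze_cvgr _ _ _ _ (cst 0) (fun n => C * cauchy (n%:R : R))).
  - by near=> n; rewrite normr_ge0/= (le_trans (FC _))// /cauchy exprMn s2 mul1r.
  - exact: cvg_cst.
  - by rewrite -[X in _ --> X](mulr0 C); apply: cvgMr.
pose fn (n : nat) := f \_ `[- n%:R, n%:R].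
have H1 : \int[leb]_x fn n x @[n --> \oo] --> (0 : R).
  have -> : (fun n => \int[leb]_x fn n x) = (fun n => F (1 * n%:R) - F ((-1) * n%:R)).
    apply/funext => n; rewrite /fn -Rintegral_mkcond mul1r mulN1r.
    by apply: is_derive_FTC => //; rewrite lerNl (le_trans _ (ler0n _ _))// oppr_le0.
  rewrite -[X in _ --> X](subrr 0); apply: cvgB; apply: FN; first by rewrite expr1n.
  by rewrite sqrrN expr1n.
apply: (cvg_unique _ _ H1) => //.
apply: fine_cvg; rewrite fineK; last first.
  by apply: integrable_fin_num => //; exact: (integrable_dom cf fD).
apply: (@dominated_cvg _ _ _ leb setT measurableT (fun n => EFin \o fn n) _
  (fun x => (D * cauchy x)%:E)).
- move=> n; apply/measurable_EFinP.
  have mI : measurable (`[- n%:R, n%:R] : set (measurableTypeR R)) by [].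
  apply: (iffLR (measurable_restrictT (f : measurableTypeR R -> R) mI)).
  apply: (@measurable_funS _ _ (measurableTypeR R) _ setT) => //.
  exact: (continuous_measurable_fun cf).
- move=> x _; apply: cvg_EFin; first exact: nearW.
  apply: cvg_near_cst; near=> n => /=.
  rewrite /fn patchE ifT// inE/= in_itv/= -ler_norml.
  by near: n; exact: nbhs_infty_ger.
- by [].
- exact: integrable_cauchyZ.
- move=> n x _; rewrite lee_fin /fn patchE; case: ifP => _ //.
  by rewrite normr0 (le_trans _ (fD x)).
Unshelve. all: by end_near. Qed.

(** The rules below compose derivatives of explicit functions and leave the
    result in the form in which it is produced; this one brings it to the
    expected form. *)
Lemma der_eq (f : R -> R) (x a b : R) : is_derive x 1 f a -> a = b -> is_derive x 1 f b.
Proof. by move=> df <-. Qed.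

Lemma der_cst (c x : R) : is_derive x 1 (fun _ : R => c) 0.
Proof. exact: (is_derive_cst c). Qed.

Lemma der_id (x : R) : is_derive x 1 (fun y : R => y) 1.
Proof. exact: is_derive_id. Qed.

Lemma der_add (f g : R -> R) (x a b : R) : is_derive x 1 f a -> is_derive x 1 g b ->
  is_derive x 1 (fun y => f y + g y) (a + b).
Proof. by move=> df dg; exact: is_deriveD. Qed.

Lemma der_mul (f g : R -> R) (x a b : R) : is_derive x 1 f a -> is_derive x 1 g b ->
  is_derive x 1 (fun y => f y * g y) (f x * b + g x * a).
Proof. by move=> df dg; exact: is_deriveM. Qed.

Lemma der_scale (c x : R) (g : R -> R) b : is_derive x 1 g b ->
  is_derive x 1 (fun y => c * g y) (c * b).
Proof. by move=> dg; apply: (der_eq (der_mul (der_cst c x) dg)); rewrite mulr0 addr0. Qed.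

Lemma der_exp (g : R -> R) (x b : R) : is_derive x 1 g b ->
  is_derive x 1 (fun y => expR (g y)) (expR (g x) * b).
Proof. by move=> dg; exact: (is_derive1_comp (is_derive_expR _) dg). Qed.

Lemma der_sin (g : R -> R) (x b : R) : is_derive x 1 g b ->
  is_derive x 1 (fun y => sin (g y)) (cos (g x) * b).
Proof. by move=> dg; exact: (is_derive1_comp (is_derive_sin _) dg). Qed.

Lemma der_cos (g : R -> R) (x b : R) : is_derive x 1 g b ->
  is_derive x 1 (fun y => cos (g y)) (- sin (g x) * b).
Proof. by move=> dg; exact: (is_derive1_comp (is_derive_cos _) dg). Qed.

Lemma der_continuous (f df : R -> R) : (forall x : R, is_derive x 1 f (df x)) -> continuous f.
Proof.
by move=> h x; apply/differentiable_continuous/derivable1_diffP; have [] := h x.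
Qed.

Lemma der_sqr (g : R -> R) (x b : R) : is_derive x 1 g b ->
  is_derive x 1 (fun y => g y ^+ 2) (2 * g x * b).
Proof. by move=> dg; apply: (der_eq (der_mul dg dg)); ring. Qed.

Section Gauss.
Variables (a del : R).
Hypothesis a0 : 0 < a.

(** A Gaussian centred at - del: completing the square in one coordinate of
    a quadratic form produces such a shift. *)
Definition gauss1 x := expR (- (a / 2) * (x + del) ^+ 2).

Lemma is_derive_gauss1 (x : R) : is_derive x 1 gauss1 (- a * (x + del) * gauss1 x).
Proof.
apply: (der_eq (der_exp (der_scale _ (der_sqr (der_add (der_id x) (der_cst del x)))))).
by rewrite /gauss1; field.
Qed.

Lemma continuous_gauss1 : continuous gauss1.
Proof. exact: (der_continuous is_derive_gauss1). Qed.

(** The factor 1 + |x + del| provides for differentiating under the integral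
    sign the transform of the Gaussian. *)
Lemma gauss1_le : exists2 C : R, 0 <= C & forall x, (1 + `|x + del|) * gauss1 x <= C * cauchy x.
Proof.
pose m := Num.min 1 (a / 4).
have m0 : 0 < m by rewrite lt_min ltr01 divr_gt0.
(* The Gaussian is at most (1 + m y^2)^-2 with y = x + del, and 1 + x^2 is at
   most 2 (1 + 2 del^2) (1 + y^2). *)
exists (4 * (1 + 2 * del ^+ 2) / m ^+ 2) => [|x].
  by rewrite divr_ge0 ?sqr_ge0//; have := sqr_ge0 del; lra.
have d0 := sqr_ge0 del.
have g1 : gauss1 x <= (m ^+ 2)^-1 * ((1 + (x + del) ^+ 2) ^+ 2)^-1.
  rewrite /gauss1; set y := x + del; have y0 := sqr_ge0 y.
  rewrite (_ : - (a / 2) * y ^+ 2 = 2%:R * - (a / 4 * y ^+ 2)); last by field.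
  rewrite expRM_natl -!exprVn -exprMn lerXn2r ?nnegrE ?expR_ge0//.
    by rewrite mulr_ge0// invr_ge0; lra.
  have ay : 0 <= a / 4 * y ^+ 2 by rewrite mulr_ge0// divr_ge0// ltW.
  apply: (le_trans (expRN_le ay)).
  rewrite -invfM lef_pV2 ?posrE; last 2 first.
  - by rewrite ltr_wpDr.
  - by rewrite mulr_gt0//; lra.
  have m1 : m <= 1 by rewrite ge_min lexx.
  have m2 : m <= a / 4 by rewrite ge_min lexx orbT.
  by have := ler_wpM2r y0 m2; lra.
set y := x + del in g1 *; have y0 := sqr_ge0 y.
have h1 : 1 + `|y| <= 2 * (1 + y ^+ 2).
  rewrite -(real_normK (num_real y)); have := sqr_ge0 (`|y| - 1); nra.
have h2 : 1 + x ^+ 2 <= (1 + 2 * del ^+ 2) * (2 * (1 + y ^+ 2)).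
  have -> : x = y - del by rewrite /y addrK.
  have := sqr_ge0 (y + del); have := mulr_ge0 d0 y0; rewrite !expr2; nra.
rewrite /cauchy ler_pdivlMr ?ltr_wpDr ?sqr_ge0//.
have Y0 : 0 < 1 + y ^+ 2 by lra.
have X0 : 0 <= 1 + x ^+ 2 by have := sqr_ge0 x; lra.
rewrite mulrAC.
have h3 : (1 + `|y|) * (1 + x ^+ 2) <= 4 * (1 + 2 * del ^+ 2) * (1 + y ^+ 2) ^+ 2.
  apply: (le_trans (ler_pM _ X0 h1 h2)); first by rewrite addr_ge0.
  by rewrite expr2; lra.
apply: (le_trans (ler_pM _ (expR_ge0 _) h3 g1)); first by rewrite mulr_ge0// addr_ge0.
rewrite mulrACA -[leRHS]mulr1 ler_wpM2l ?divr_ge0 ?sqr_ge0 ?mulr_ge0//; [lra|].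
by rewrite divff// expf_neq0// gt_eqF.
Qed.

Lemma integrable_gauss1 : leb.-integrable setT (EFin \o gauss1).
Proof.
have [C _ hC] := gauss1_le; apply: (integrable_dom continuous_gauss1 (C := C)) => x.
rewrite ger0_norm ?expR_ge0//; apply: le_trans (hC x).
by rewrite ler_peMl ?expR_ge0// lerDl.
Qed.

Lemma integral_gauss1 : \int[leb]_x gauss1 x = Num.sqrt (2 * pi / a).
Proof.
have p0 := @pi_gt0 R.
pose sg := Num.sqrt a^-1.
have sg2 : sg ^+ 2 = a^-1 by rewrite sqr_sqrtr// invr_ge0 ltW.
have sg0 : sg != 0 by rewrite gt_eqF// sqrtr_gt0 invr_gt0.
have s0 : 0 < Num.sqrt (2 * pi / a) by rewrite sqrtr_gt0 divr_gt0// mulr_gt0.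
have E x : (Num.sqrt (2 * pi / a))^-1 * gauss1 x = normal_pdf (- del) sg x.
  rewrite normal_pdfE//; congr ((Num.sqrt _)^-1 * expR _).
    by rewrite sg2 mulr2n; field; rewrite gt_eqF.
  by rewrite sg2 mulr2n opprK; field; rewrite gt_eqF.
have : \int[leb]_x ((Num.sqrt (2 * pi / a))^-1 * gauss1 x) = 1.
  by rewrite /Rintegral; under eq_integral do rewrite E; rewrite integral_normal_pdf.
rewrite RintegralZl//; last exact: integrable_gauss1.
by move=> h; apply: (mulfI (invr_neq0 (lt0r_neq0 s0))); rewrite h mulVf ?gt_eqF.
Qed.

(** As a function of s the transform H satisfies H' = - (s / a) H:
    differentiate under the integral sign, then integrate by parts, since
    (x + del) gauss1 is - 1 / a times the derivative of gauss1.  The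
    value at 0 is the normalisation of the normal density. *)
Lemma gauss1_fourier (c s : R) :
  \int[leb]_x (gauss1 x * cos (c + s * (x + del))) =
  Num.sqrt (2 * pi / a) * expR (- s ^+ 2 / (2 * a)) * cos c.
Proof.
have [C C0 hC] := gauss1_le.
have gC x : gauss1 x <= C * cauchy x.
  by apply: le_trans (hC x); rewrite ler_peMl ?expR_ge0// lerDl.
have xgC x : `|x + del| * gauss1 x <= C * cauchy x.
  by apply: le_trans (hC x); rewrite ler_wpM2r ?expR_ge0// lerDr.
pose f (s x : R) := gauss1 x * cos (c + s * (x + del)).
have dphase (s0 x : R) : is_derive s0 1 (fun s => c + s * (x + del)) (x + del).
  apply: (der_eq (der_add (der_cst c s0) (der_mul (der_id s0) (der_cst (x + del) s0)))).
  by rewrite mulr0 mulr1 !add0r.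
have dfs (s0 x : R) : is_derive s0 1 (fun s => f s x) (- ((x + del) * gauss1 x * sin (c + s0 * (x + del)))).
  by apply: (der_eq (der_scale (gauss1 x) (der_cos (dphase s0 x)))); ring.
have dpx (s0 x : R) : is_derive x 1 (fun x => c + s0 * (x + del)) s0.
  apply: (der_eq (der_add (der_cst c x) (der_scale s0 (der_add (der_id x) (der_cst del x))))).
  by rewrite addr0 mulr1 add0r.
have cpx s0 : continuous (fun x => c + s0 * (x + del)) by exact: (der_continuous (dpx s0)).
have cgsin s0 : continuous (fun x => gauss1 x * sin (c + s0 * (x + del))).
  move=> x; apply: cvgM; first exact: continuous_gauss1.
  by apply: continuous_comp; [exact: cpx|exact: continuous_sin].
have cfs s0 : continuous (f s0).
  move=> x; apply: cvgM; first exact: continuous_gauss1.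
  by apply: continuous_comp; [exact: cpx|exact: continuous_cos].
have fC s0 x : `|f s0 x| <= C * cauchy x.
  rewrite /f normrM (ger0_norm (expR_ge0 _)); apply: le_trans (gC x).
  by rewrite ler_piMr ?expR_ge0// cos_max.
have intf s0 : leb.-integrable setT (EFin \o f s0) by exact: (integrable_dom (cfs s0) (fC s0)).
have cxgs s0 : continuous (fun x => (x + del) * gauss1 x * sin (c + s0 * (x + del))).
  under eq_fun do rewrite -mulrA; move=> x.
  by apply: cvgM; [apply: cvgD; [exact: cvg_id|exact: cvg_cst]|exact: cgsin].
have intd s0 : leb.-integrable setT (EFin \o (fun x => (x + del) * gauss1 x * sin (c + s0 * (x + del)))).
  apply: (@integrable_dom _ _ C (cxgs s0)) => x.
  rewrite !normrM (ger0_norm (expR_ge0 _)); apply: le_trans (xgC x).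
  by rewrite ler_piMr ?mulr_ge0 ?expR_ge0// sin_max.
pose H (s : R) := \int[leb]_x f s x.
have p1E s0 x : partial1of2 f s0 x = - ((x + del) * gauss1 x * sin (c + s0 * (x + del))).
  by rewrite /partial1of2 derive1E; exact: (@derive_val _ _ _ _ _ _ _ (dfs s0 x)).
have dH (s0 : R) : is_derive s0 1 H (- (s0 / a) * H s0).
  have I0 : `]s0 - 1, s0 + 1[%classic s0.
    by rewrite /= in_itv/=; apply/andP; split; lra.
  have iG := integrable_cauchyZ C.
  have pG x y : `]s0 - 1, s0 + 1[%classic x -> setT y -> `|partial1of2 f x y| <= C * cauchy y.
    move=> _ _; rewrite p1E normrN !normrM (ger0_norm (expR_ge0 _)); apply: le_trans (xgC y).
    by rewrite ler_piMr ?mulr_ge0 ?expR_ge0// sin_max.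
  have pos y : 0 <= C * cauchy y by rewrite mulr_ge0 ?cauchy_ge0.
  have der x y : `]s0 - 1, s0 + 1[%classic x -> setT y -> derivable (f ^~ y) x 1.
    by move=> _ _; have [] := dfs x y.
  have D1 := @derivable_under_integral R _ _ leb f setT measurableT s0 (s0 - 1) (s0 + 1) I0
     (fun x _ => intf x) der (fun y => C * cauchy y) pos iG pG.
  have D2 := @differentiation_under_integral R _ _ leb f setT measurableT s0 (s0 - 1) (s0 + 1) I0
     (fun x _ => intf x) der (fun y => C * cauchy y) pos iG pG.
  apply: DeriveDef => //; rewrite -derive1E D2.
  under eq_Rintegral do rewrite p1E.
  have Z : \int[leb]_x (- a * ((x + del) * gauss1 x * sin (c + s0 * (x + del))) + s0 * f s0 x) = 0.
    have dF (x : R) : is_derive x 1 (fun x => gauss1 x * sin (c + s0 * (x + del)))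
       (- a * ((x + del) * gauss1 x * sin (c + s0 * (x + del))) + s0 * f s0 x).
      by apply: (der_eq (der_mul (is_derive_gauss1 x) (der_sin (dpx s0 x)))); rewrite /f; ring.
    apply: (@integral_derive_eq0 _ _ C (a * C + `|s0| * C) dF).
    - by move=> x; apply: cvgD; apply: cvgMr; [exact: cxgs|exact: cfs].
    - move=> x; rewrite normrM (ger0_norm (expR_ge0 _)); apply: le_trans (gC x).
      by rewrite ler_piMr ?expR_ge0// sin_max.
    - move=> x; rewrite (le_trans (ler_normD _ _))// [leRHS]mulrDl; apply: lerD.
        rewrite normrM normrN (gtr0_norm a0) -[leRHS]mulrA ler_pM2l// !normrM (ger0_norm (expR_ge0 _)).
        apply: le_trans (xgC x); by rewrite ler_piMr ?mulr_ge0 ?expR_ge0// sin_max.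
      by rewrite normrM -[leRHS]mulrA ler_wpM2l.
  rewrite RintegralD// in Z; last 2 first.
  - exact: (integrableZl measurableT (- a) (intd s0)).
  - exact: (integrableZl measurableT s0 (intf s0)).
  rewrite !RintegralZl// in Z.
  under eq_Rintegral do rewrite -mulN1r.
  rewrite RintegralZl// /H; move: Z; set A := Rintegral _ _ _; set B := Rintegral _ _ _ => Z.
  by apply: (mulfI (lt0r_neq0 a0)); rewrite (_ : a * (- (s0 / a) * B) = - (s0 * B)); [lra|field; rewrite gt_eqF].
(* Multiplied by exp(s^2 / (2 a)) the transform is constant. *)
have K0 (s0 : R) : is_derive s0 1 (fun s => H s * expR (s ^+ 2 * (2 * a)^-1)) 0.
  apply: (der_eq (der_mul (dH s0) (der_exp (der_mul (der_sqr (der_id s0)) (der_cst (2 * a)^-1 s0))))).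
  by field; rewrite gt_eqF.
have := is_derive_0_is_cst s 0 K0.
rewrite expr0n mul0r expR0 mulr1 => E.
have -> : \int[leb]_x (gauss1 x * cos (c + s * (x + del))) = H s by [].
have H0 : H 0 = Num.sqrt (2 * pi / a) * cos c.
  rewrite -integral_gauss1 -RintegralZr//; last exact: integrable_gauss1.
  by apply: eq_Rintegral => x _; rewrite /f mul0r addr0.
rewrite mulrAC -H0 -E mulNr expRN mulfK// gt_eqF// expR_gt0//.
Qed.

End Gauss.

End OneDim.

(** * Fourier coefficients of the trapezoid *)

Section Fourier.
Context {R : realType}.
Notation leb := (@lebesgue_measure R).

Lemma trapezoid_dom (s : R) : 0 < s -> forall x,
  trapezoid (s * x) <= (1 + (3 * pi / 2 / s) ^+ 2) * cauchy x.
Proof.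
move=> s0 x; have p0 := @pi_gt0 R.
have [h|h] := leP (3 * pi / 2) `|s * x|.
  by rewrite trapezoid_out// mulr_ge0 ?cauchy_ge0// addr_ge0 ?sqr_ge0.
apply: (le_trans (trapezoid_le1 _)).
rewrite ler_pdivlMr ?mul1r ?ltr_wpDr ?sqr_ge0// lerD2l.
rewrite -(real_normK (num_real x)) lerXn2r ?nnegrE ?divr_ge0// ?mulr_ge0 ?(ltW p0) ?(ltW s0)//.
by rewrite ler_pdivlMr// mulrC -{1}(gtr0_norm s0) -normrM ltW.
Qed.

Lemma continuous_affine_cos (c k : R) : continuous (fun x => cos (c + k * x)).
Proof.
move=> x; apply: continuous_comp; last exact: continuous_cos.
by apply: cvgD; [exact: cvg_cst|exact: mulrl_continuous].
Qed.

Lemma integral_lin_cos (al be c k u v : R) : u <= v -> k != 0 ->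
  \int[leb]_(x in `[u, v]) ((al * x + be) * cos (c + k * x)) =
  ((al * v + be) * sin (c + k * v) / k + al * cos (c + k * v) / k ^+ 2) -
  ((al * u + be) * sin (c + k * u) / k + al * cos (c + k * u) / k ^+ 2).
Proof.
move=> uv k0.
apply: (@is_derive_FTC R (fun x => (al * x + be) * sin (c + k * x) / k + al * cos (c + k * x) / k ^+ 2)
  (fun x => (al * x + be) * cos (c + k * x))) => //.
  move=> x.
  have d1 : is_derive x 1 (fun x => c + k * x) k.
    by apply: (der_eq (der_add (der_cst c x) (der_scale k (der_id x)))); rewrite add0r mulr1.
  have d2 : is_derive x 1 (fun x => al * x + be) al.
    by apply: (der_eq (der_add (der_scale al (der_id x)) (der_cst be x))); rewrite addr0 mulr1.
  apply: (der_eq (der_add (der_mul (der_mul d2 (der_sin d1)) (der_cst k^-1 x))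
     (der_mul (der_scale al (der_cos d1)) (der_cst (k ^+ 2)^-1 x)))).
  by field.
move=> x; apply: cvgM; last exact: continuous_affine_cos.
by apply: cvgD; [exact: mulrl_continuous|exact: cvg_cst].
Qed.

Lemma integral_lin (al be c u v : R) : u <= v ->
  \int[leb]_(x in `[u, v]) ((al * x + be) * c) =
  ((al * v ^+ 2 / 2 + be * v) * c) - ((al * u ^+ 2 / 2 + be * u) * c).
Proof.
move=> uv.
apply: (@is_derive_FTC R (fun x => (al * x ^+ 2 / 2 + be * x) * c)
  (fun x => (al * x + be) * c)) => //.
  move=> x.
  apply: (der_eq (der_mul (der_add (der_mul (der_scale al (der_sqr (der_id x))) (der_cst 2^-1 x)) (der_scale be (der_id x))) (der_cst c x))).
  by field.
move=> x; apply: cvgMl.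
by apply: cvgD; [exact: mulrl_continuous|exact: cvg_cst].
Qed.

(** The three affine pieces are integrated explicitly.  For m = 0 the
    area is 2 pi / s; for m <> 0 the boundary terms cancel because each outer
    corner and the inner corner on the opposite side are a full period apart. *)
Lemma trapezoid_fourier1 (s c : R) (m : int) : 0 < s ->
  \int[leb]_x (trapezoid (s * x) * cos (c + m%:~R * (s * x))) =
  if m == 0 then 2 * pi / s * cos c else 0.
Proof.
move=> s0; have p0 := @pi_gt0 R.
(* The corners of the rescaled trapezoid lie at p and 3 p, up to sign. *)
pose k : R := m%:~R * s; pose p := pi / (2 * s).
have pp : 0 < p by rewrite divr_gt0// mulr_gt0.
have ps : s * p = pi / 2 by rewrite /p; field; rewrite gt_eqF.
pose f x := trapezoid (s * x) * cos (c + k * x).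
have cf : continuous f.
  move=> x; apply: cvgM; last exact: continuous_affine_cos.
  by apply: continuous_comp; [exact: mulrl_continuous|exact: continuous_trapezoid].
have intf : leb.-integrable setT (EFin \o f).
  apply: (integrable_dom cf (C := 1 + (3 * pi / 2 / s) ^+ 2)) => x.
  rewrite normrM (ger0_norm (trapezoid_ge0 _)); apply: le_trans (trapezoid_dom s0 x).
  by rewrite ler_piMr ?trapezoid_ge0// cos_max.
have intfS (D : set (measurableTypeR R)) : measurable D -> leb.-integrable D (EFin \o f).
  by move=> mD; apply: integrableS intf.
have -> : \int[leb]_x (trapezoid (s * x) * cos (c + m%:~R * (s * x))) = \int[leb]_x f x.
  by apply: eq_Rintegral => x _; rewrite /f /k mulrA.
have f0 x : x \notin `[- (3 * p), 3 * p] -> f x = 0.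
  move=> xn; rewrite /f trapezoid_out ?mul0r//.
  rewrite normrM gtr0_norm// -(_ : s * (3 * p) = 3 * pi / 2); last by rewrite mulrCA ps; field.
  rewrite ler_pM2l// leNgt; apply: contra xn; rewrite in_itv/= -ler_norml => /ltW.
  by [].
have -> : \int[leb]_x f x = \int[leb]_(x in `[- (3 * p), 3 * p]) f x.
  rewrite [RHS]Rintegral_mkcond; apply: eq_Rintegral => x _; rewrite patchE.
  by case: ifPn => //; rewrite notin_setE /= => /negP xn; rewrite f0.
have -> : \int[leb]_(x in `[- (3 * p), 3 * p]) f x =
   \int[leb]_(x in `[- (3 * p), - p]) f x + \int[leb]_(x in `[- p, p]) f x + \int[leb]_(x in `[p, 3 * p]) f x.
  have E1 := @Rintegral_itvB R f (BLeft (- (3 * p))) (BRight (3 * p)) (- p) (intfS _ _).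
  have E2 := @Rintegral_itvB R f (BLeft (- p)) (BRight (3 * p)) p (intfS _ _).
  rewrite !Rintegral_itv_obnd_cbnd in E1 E2; [|exact: intfS..].
  have {}E1 : _ - _ = _ := E1 (measurable_itv _) ltac:(rewrite bnd_simp; lra) ltac:(rewrite bnd_simp; lra).
  have {}E2 : _ - _ = _ := E2 (measurable_itv _) ltac:(rewrite bnd_simp; lra) ltac:(rewrite bnd_simp; lra).
  by rewrite -addrA -E2 -E1; ring.
have fld (y : R) : 3 / 2 - s * y / pi = - (2 * p)^-1 * y + 3 / 2.
  by rewrite /p; move: p0; move: (pi : R) => q q0; field; rewrite !gt_eqF.
have e1 : \int[leb]_(x in `[- (3 * p), - p]) f x = \int[leb]_(x in `[- (3 * p), - p]) (((2 * p)^-1 * x + 3 / 2) * cos (c + k * x)).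
  apply: eq_Rintegral => x; rewrite inE/= in_itv/= => /andP[x1 x2].
  rewrite /f trapezoid_mid; last first.
    rewrite normrM gtr0_norm// ler0_norm; last lra.
    rewrite -ps (_ : 3 * pi / 2 = s * (3 * p)); last by rewrite mulrCA ps; field.
    by rewrite !ler_pM2l//; apply/andP; split; lra.
  congr (_ * _); rewrite normrM gtr0_norm// ler0_norm; last lra.
  by rewrite fld mulrNN.
have e2 : \int[leb]_(x in `[- p, p]) f x = \int[leb]_(x in `[- p, p]) ((0 * x + 1) * cos (c + k * x)).
  apply: eq_Rintegral => x; rewrite inE/= in_itv/= -ler_norml => xp.
  by rewrite /f trapezoid_in ?mul0r ?add0r// normrM gtr0_norm// -ps ler_pM2l.
have e3 : \int[leb]_(x in `[p, 3 * p]) f x = \int[leb]_(x in `[p, 3 * p]) ((- (2 * p)^-1 * x + 3 / 2) * cos (c + k * x)).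
  apply: eq_Rintegral => x; rewrite inE/= in_itv/= => /andP[x1 x2].
  rewrite /f trapezoid_mid; last first.
    rewrite normrM gtr0_norm// ger0_norm; last lra.
    rewrite -ps (_ : 3 * pi / 2 = s * (3 * p)); last by rewrite mulrCA ps; field.
    by rewrite !ler_pM2l//; apply/andP; split; lra.
  congr (_ * _); rewrite normrM gtr0_norm// ger0_norm; last lra.
  by rewrite fld.
rewrite e1 e2 e3.
have [m0|m0] := eqVneq m 0.
  have cE x : cos (c + k * x) = cos c by rewrite /k m0 mul0r mul0r addr0.
  under eq_Rintegral do rewrite cE.
  under [X in _ + X + _]eq_Rintegral do rewrite cE.
  under [X in _ + X]eq_Rintegral do rewrite cE.
  rewrite !integral_lin; [|lra..].
  by rewrite /p; move: p0; move: (pi : R) => q q0; field; rewrite !gt_eqF.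
have k0 : k != 0 by rewrite mulf_neq0 ?intr_eq0 ?(gt_eqF s0).
rewrite !integral_lin_cos//; [|lra..].
have per (x : R) : cos (x + m%:~R * (2 * pi)) = cos x.
  have P n y : cos (y + n%:R * (2 * pi)) = cos y :> R.
    by have := periodicn (@cosD2pi R) n y; rewrite -mulr_natl => <-; congr cos; ring.
  case: m {k k0 f cf intf intfS f0 e1 e2 e3 m0} => n; first exact: P.
  by rewrite NegzE mulrNz mulNr -(P n.+1 (x - _)) subrK.
(* The phases at 3 p and - p, and at - 3 p and p, differ by a multiple of
   2 pi. *)
have kp : k * (4 * p) = m%:~R * (2 * pi) by rewrite /k /p; move: p0; move: (pi : R) => q q0; field; rewrite gt_eqF.
have c1 : cos (c + k * (- (3 * p))) = cos (c + k * p).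
  by rewrite -(per (c + k * - (3 * p))) -kp; congr cos; ring.
have c2 : cos (c + k * (3 * p)) = cos (c + k * (- p)).
  by rewrite -(per (c + k * - p)) -kp; congr cos; ring.
rewrite c1 c2; field.
by rewrite k0 !gt_eqF.
Qed.

(** The amplitude A and the phase c are parameters of the induction: the
    coordinates that remain to be integrated contribute to both. *)
Lemma trapezoid_fourier d (A s c : R) (m : 'I_d -> int) : 0 < s ->
  iterint (fun t : 'cV[R]_d => A * (\prod_k trapezoid (s * t k 0)) *
       cos (c + \sum_k (m k)%:~R * (s * t k 0))) =
  if [forall k, m k == 0] then A * (2 * pi / s) ^+ d * cos c else 0.
Proof.
move=> s0; elim: d A c m => [|d IH] A c m.
  rewrite /= !big_ord0 addr0 expr0 ifT//; by apply/forallP => -[].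
rewrite [LHS]/=.
have E v : \int[leb]_x (A * \prod_k trapezoid (s * consv x v k 0) * cos (c + \sum_k (m k)%:~R * (s * consv x v k 0))) =
  (if m ord0 == 0 then A * (2 * pi / s) else 0) * (\prod_k trapezoid (s * v k 0)) *
  cos (c + \sum_k (m (lift ord0 k))%:~R * (s * v k 0)).
  set Pv := \prod_k trapezoid (s * v k 0); set Sv := \sum_k _ * (s * v k 0).
  transitivity (\int[leb]_x ((A * Pv) * (trapezoid (s * x) * cos ((c + Sv) + (m ord0)%:~R * (s * x))))).
    apply: eq_Rintegral => x _; rewrite !big_ord_recl consv0.
    under eq_bigr do rewrite consvS. under [X in cos (_ + (_ + X))]eq_bigr do rewrite consvS.
    rewrite -/Pv -/Sv (addrC _ Sv) addrA; ring.
  rewrite RintegralZl//; first by rewrite trapezoid_fourier1//; case: ifP => _; ring.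
  have cc : continuous (fun x => cos ((c + Sv) + (m ord0)%:~R * (s * x))).
    under eq_fun do rewrite (mulrA _ s); exact: continuous_affine_cos.
  apply: (@integrable_dom _ _ (1 + (3 * pi / 2 / s) ^+ 2)).
    move=> x; apply: cvgM; last exact: cc.
    by apply: continuous_comp; [exact: mulrl_continuous|exact: continuous_trapezoid].
  move=> x; rewrite normrM (ger0_norm (trapezoid_ge0 _)); apply: le_trans (trapezoid_dom s0 x).
  by rewrite ler_piMr ?trapezoid_ge0// cos_max.
rewrite (eq_iterint E) IH.
have -> : [forall k, m k == 0] = (m ord0 == 0) && [forall k, m (lift ord0 k) == 0].
  apply/forallP/andP => [h|[h0 /forallP h] k]; first by split => //; apply/forallP.
  by case: (unliftP ord0 k) => [j ->|->].
case: (m ord0 == 0); case: [forall k, _ == 0] => //=; rewrite ?mul0r//.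
by rewrite exprS !mulrA.
Qed.

End Fourier.

(** * The Gaussian transform in dimension d *)

Section GaussD.
Context {R : realType}.
Notation leb := (@lebesgue_measure R).

Lemma dotvDr d (x y z : 'cV[R]_d) : dotv x (y + z) = dotv x y + dotv x z.
Proof. by rewrite /dotv mulmxDr mxE. Qed.
Lemma dotvZl d a (x y : 'cV[R]_d) : dotv (a *: x) y = a * dotv x y.
Proof. by rewrite /dotv linearZ -scalemxAl mxE. Qed.
Lemma dotvZr d a (x y : 'cV[R]_d) : dotv x (a *: y) = a * dotv x y.
Proof. by rewrite /dotv -scalemxAr mxE. Qed.
Lemma dotvC d (x y : 'cV[R]_d) : dotv x y = dotv y x.
Proof.
by rewrite /dotv -[in RHS](trmxK (y^T *m x)) trmx_mul trmxK [in RHS]mxE.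
Qed.
Lemma dotvE d (x y : 'cV[R]_d) : dotv x y = \sum_k x k 0 * y k 0.
Proof. by rewrite /dotv mxE; apply: eq_bigr => k _; rewrite mxE. Qed.

(** A square matrix of size d + 1 seen through its first row and column. *)
Definition bordmx d (m : R) (b : 'cV[R]_d) (W : 'M[R]_d) : 'M[R]_d.+1 :=
  (block_mx (m%:M : 'M[R]_1) (b^T) b W : 'M[R]_(1 + d)).

Lemma bordmx_sym d (V : 'M[R]_d.+1) : V^T = V ->
  exists m b W, V = bordmx m b W /\ W^T = W.
Proof.
move=> VT; pose V' : 'M[R]_(1 + d) := V.
have VT' : V'^T = V' by [].
exists (V' (lshift d 0) (lshift d 0)), (dlsubmx V'), (drsubmx V'); split; last first.
  by rewrite trmx_drsub VT'.
rewrite /bordmx -[LHS](@submxK _ 1 d 1 d V'); congr (block_mx _ _ _ _ : 'M[R]_(1 + d)).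
  by apply/matrixP => i j; rewrite !ord1 !mxE eqxx mulr1n.
by rewrite trmx_dlsub VT'.
Qed.

Lemma quad_bordmx d m (b : 'cV[R]_d) W x v y w :
  dotv (consv x v) (bordmx m b W *m consv y w) =
  m * x * y + x * dotv b w + y * dotv b v + dotv v (W *m w).
Proof.
rewrite /dotv /consv /bordmx (@mul_block_col _ 1 d 1 d 1).
rewrite (@tr_col_mx _ 1 d 1) (@mul_row_col _ 1 1 d 1) !mulmxDr.
have e1 : (x%:M^T *m (m%:M *m y%:M)) (0 : 'I_1) (0 : 'I_1) = m * x * y.
  by rewrite tr_scalar_mx -!scalar_mxM mxE eqxx mulr1n; ring.
have e2 : (x%:M^T *m (b^T *m w)) (0 : 'I_1) (0 : 'I_1) = x * (b^T *m w) 0 0.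
  by rewrite tr_scalar_mx mul_scalar_mx mxE.
have e3 : (v^T *m (b *m y%:M)) (0 : 'I_1) (0 : 'I_1) = y * (b^T *m v) 0 0.
  by rewrite mul_mx_scalar -scalemxAr mxE; congr (_ * _); exact: dotvC.
rewrite mxE [X in X + _ = _]mxE [X in _ + X = _]mxE e1 e2 e3; ring.
Qed.

Definition schur d m (b : 'cV[R]_d) (W : 'M[R]_d) : 'M[R]_d := W - m^-1 *: (b *m b^T).

Lemma quad_schur d m (b : 'cV[R]_d) W v w :
  dotv v (schur m b W *m w) = dotv v (W *m w) - m^-1 * dotv b v * dotv b w.
Proof.
rewrite /schur mulmxBl dotvDr -scaleN1r dotvZr mulN1r -scalemxAl dotvZr -mulmxA.
have -> : dotv v (b *m (b^T *m w)) = dotv b v * dotv b w.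
  rewrite {1}/dotv mulmxA mxE big_ord1; congr (_ * _).
  exact: dotvC.
by rewrite mulrA.
Qed.

(** Block elimination of the first column. *)
Lemma det_bordmx d m (b : 'cV[R]_d) W : m != 0 ->
  \det (bordmx m b W) = m * \det (schur m b W).
Proof.
move=> m0.
have -> : bordmx m b W = (block_mx (1%:M : 'M[R]_1) 0 (m^-1 *: b) 1%:M : 'M[R]_(1 + d)) *m
   (block_mx (m%:M : 'M[R]_1) (b^T) 0 (schur m b W) : 'M[R]_(1 + d)).
  rewrite mulmx_block !mul1mx !mul0mx ?mulmx0 !addr0 /bordmx /schur.
  congr (block_mx _ _ _ _ : 'M[R]_(1 + d)).
    by rewrite mul_mx_scalar scalerA divff// scale1r.
  by rewrite -scalemxAl addrC subrK.
rewrite det_mulmx (@det_lblock _ 1 d) (@det_ublock _ 1 d) !det1 !mul1r.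
by rewrite det_scalar1.
Qed.

Lemma posdef_bordmx d m (b : 'cV[R]_d) W : W^T = W ->
  posdefmx (bordmx m b W) -> 0 < m /\ posdefmx (schur m b W).
Proof.
move=> WT [_ pd].
have m0 : 0 < m.
  have := pd (consv 1 0); rewrite quad_bordmx.
  rewrite !mulmx0 !dotvE !big1 ?mulr0 ?mulr1 ?addr0//; try by move=> i _; rewrite mxE ?mulr0 ?mul0r.
  apply; apply/eqP => /matrixP /(_ ord0 0); rewrite consv0 mxE; exact/eqP/oner_neq0.
split => //; split.
  by rewrite /schur linearB linearZ /= trmx_mul trmxK WT.
move=> v v0; have := pd (consv (- (m^-1 * dotv b v)) v); rewrite quad_bordmx quad_schur.
have -> : m * - (m^-1 * dotv b v) * - (m^-1 * dotv b v) + - (m^-1 * dotv b v) * dotv b v +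
  - (m^-1 * dotv b v) * dotv b v + dotv v (W *m v) =
  dotv v (W *m v) - m^-1 * dotv b v * dotv b v.
  by field; rewrite gt_eqF.
apply; apply: contra v0 => /eqP/matrixP h; apply/eqP/matrixP => i j.
by rewrite ord1 -(consvS (- (m^-1 * dotv b v)) v) h !mxE.
Qed.

Lemma posdef_det d (V : 'M[R]_d) : posdefmx V -> 0 < \det V.
Proof.
elim: d V => [|d IH] V pV; first by rewrite det_mx00.
have [m [b [W [VE WT]]]] := bordmx_sym pV.1.
rewrite VE in pV *; have [m0 pS] := posdef_bordmx WT pV.
by rewrite det_bordmx ?gt_eqF// mulr_gt0// IH.
Qed.

Lemma consv_split d (t : 'cV[R]_d.+1) : exists e w, t = consv e w.
Proof.
exists (t ord0 0), (\col_k t (lift ord0 k) 0); apply/matrixP => i j; rewrite ord1.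
by case: (unliftP ord0 i) => [k ->|->]; rewrite ?consvS ?consv0 ?mxE.
Qed.

(** The transform is written at the point V eta, which avoids inverting V.
    Completing the square in the first coordinate splits the quadratic form into
    a one-dimensional Gaussian and the form of the Schur complement, and the
    phase splits in the same way. *)
Lemma iterint_gauss d (V : 'M[R]_d) (eta : 'cV[R]_d) (A c : R) : posdefmx V ->
  iterint (fun t => A * expR (- (dotv t (V *m t) / 2)) * cos (c + dotv t (V *m eta))) =
  A * (Num.sqrt (2 * pi)) ^+ d / Num.sqrt (\det V) * expR (- (dotv eta (V *m eta) / 2)) * cos c.
Proof.
elim: d V eta A c => [|d IH] V eta A c pV.
  rewrite /= det_mx00 sqrtr1 expr0 divr1 !dotvE !big_ord0 mulr1 addr0.
  by [].
have [m [b [W [VE WT]]]] := bordmx_sym pV.1.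
rewrite {}VE in pV *; have [m0 pS] := posdef_bordmx WT pV.
have [e [w ->]] := consv_split eta.
rewrite [LHS]/=.
pose s := m * e + dotv b w.
have E v : \int[leb]_x (A * expR (- (dotv (consv x v) (bordmx m b W *m consv x v) / 2)) *
      cos (c + dotv (consv x v) (bordmx m b W *m consv e w))) =
  (A * (Num.sqrt (2 * pi / m) * expR (- s ^+ 2 / (2 * m)))) *
   expR (- (dotv v (schur m b W *m v) / 2)) * cos (c + dotv v (schur m b W *m w)).
  pose del := dotv b v / m.
  pose K := A * expR (- (dotv v (schur m b W *m v) / 2)).
  transitivity (\int[leb]_x (K * (gauss1 m del x * cos (c + dotv v (schur m b W *m w) + s * (x + del))))).
    apply: eq_Rintegral => x _; rewrite !quad_bordmx /K /gauss1 !quad_schur.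
    rewrite [RHS]mulrA -(mulrA A (expR _) (expR _)) -expRD; congr (_ * expR _ * cos _).
      by rewrite /del; field; rewrite gt_eqF.
    by rewrite /del /s; field; rewrite gt_eqF.
  rewrite RintegralZl//; first by rewrite gauss1_fourier// /K; ring.
  have [C C0 hC] := gauss1_le del m0.
  apply: (@integrable_dom _ _ C).
    move=> x; apply: cvgM; first exact: continuous_gauss1.
    apply: continuous_comp; last exact: continuous_cos.
    by apply: cvgD; [exact: cvg_cst|apply: cvgMr; apply: cvgD; [exact: cvg_id|exact: cvg_cst]].
  move=> x; rewrite normrM (ger0_norm (expR_ge0 _)); apply: le_trans (hC x).
  apply: (@le_trans _ _ (gauss1 m del x)).
    by rewrite ler_piMr ?expR_ge0// cos_max.
  by rewrite ler_peMl ?expR_ge0// lerDl.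
rewrite (eq_iterint E) IH// det_bordmx ?gt_eqF//.
have p0 := @pi_gt0 R.
have q0 : 0 <= 2 * pi :> R by rewrite mulr_ge0 ?ltW.
have -> : Num.sqrt (2 * pi / m) = Num.sqrt (2 * pi) / Num.sqrt m.
  by rewrite sqrtrM// sqrtrV ?ltW.
rewrite [Num.sqrt (m * _)]sqrtrM ?(ltW m0)// [(Num.sqrt m * _)^-1]invfM.
have -> : expR (- (dotv (consv e w) (bordmx m b W *m consv e w) / 2)) =
  expR (- s ^+ 2 / (2 * m)) * expR (- (dotv w (schur m b W *m w) / 2)).
  rewrite -expRD quad_bordmx quad_schur /s; congr expR.
  by field; rewrite gt_eqF.
by rewrite (exprS (Num.sqrt _) d); move: (Num.sqrt (2 * pi)) => q; ring.
Qed.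

End GaussD.

(** * Unimodular complex numbers and sequential continuity *)

Section Cplx.
Context {R : realType}.
Implicit Types (x y : R) (z w : R[i]).

Definition cis x : R[i] := Complex (cos x) (sin x).
Definition rc x : R[i] := Complex x 0.

Lemma cisD x y : cis (x + y) = cis x * cis y.
Proof. by apply/eqP; rewrite eq_complex /= cosD sinD eqxx/= addrC (mulrC (sin x)). Qed.

Lemma cis0 : cis 0 = 1.
Proof. by apply/eqP; rewrite eq_complex /= cos0 sin0 !eqxx. Qed.

Lemma cis_sum (I : Type) (r : seq I) (f : I -> R) :
  cis (\sum_(i <- r) f i) = \prod_(i <- r) cis (f i).
Proof. by apply: (big_morph cis cisD cis0). Qed.

Lemma rcM x y : rc (x * y) = rc x * rc y.
Proof. by apply/eqP; rewrite eq_complex /= !mulr0 !mul0r subr0 addr0 !eqxx. Qed.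
Lemma rcB x y : rc (x - y) = rc x - rc y.
Proof. by apply/eqP; rewrite eq_complex /= subr0 !eqxx. Qed.

Lemma rc_prod (I : Type) (r : seq I) (f : I -> R) :
  rc (\prod_(i <- r) f i) = \prod_(i <- r) rc (f i).
Proof. exact: (big_morph rc rcM). Qed.

Lemma ReD z w : complex.Re (z + w) = complex.Re z + complex.Re w.
Proof. by case: z w => [a b] [c d]. Qed.
Lemma ImD z w : complex.Im (z + w) = complex.Im z + complex.Im w.
Proof. by case: z w => [a b] [c d]. Qed.
Lemma ReM z w : complex.Re (z * w) = complex.Re z * complex.Re w - complex.Im z * complex.Im w.
Proof. by case: z w => [a b] [c d]. Qed.
Lemma ImM z w : complex.Im (z * w) = complex.Re z * complex.Im w + complex.Im z * complex.Re w.
Proof. by case: z w => [a b] [c d]. Qed.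

Lemma Re_sum (I : Type) (r : seq I) (f : I -> R[i]) :
  complex.Re (\sum_(i <- r) f i) = \sum_(i <- r) complex.Re (f i).
Proof. by apply: (big_morph _ ReD). Qed.
Lemma Im_sum (I : Type) (r : seq I) (f : I -> R[i]) :
  complex.Im (\sum_(i <- r) f i) = \sum_(i <- r) complex.Im (f i).
Proof. by apply: (big_morph _ ImD). Qed.

Lemma normcE z : normc z = Num.sqrt (complex.Re z ^+ 2 + complex.Im z ^+ 2).
Proof. by case: z. Qed.

Lemma normc_ge0 z : 0 <= normc z. Proof. by rewrite normcE sqrtr_ge0. Qed.

Lemma sqr_normcE z : normc z ^+ 2 = complex.Re z ^+ 2 + complex.Im z ^+ 2.
Proof. by rewrite normcE sqr_sqrtr// addr_ge0// sqr_ge0. Qed.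

Lemma normc_cis x : normc (cis x) = 1.
Proof. by rewrite normcE /= cos2Dsin2 sqrtr1. Qed.

Lemma normc_rc x : normc (rc x) = `|x|.
Proof. by rewrite normcE /= expr0n addr0 sqrtr_sqr. Qed.

Lemma normcD z w : normc (z + w) <= normc z + normc w.
Proof. exact: (@le_normcD R z w). Qed.

Lemma normcNE z : normc (- z) = normc z.
Proof. exact: (@normcN R z). Qed.

Lemma normcB z w : normc (z - w) = normc (w - z).
Proof. by rewrite -normcNE opprB. Qed.

Lemma normc_Re z : `|complex.Re z| <= normc z.
Proof.
by rewrite normcE -sqrtr_sqr ler_sqrt ?addr_ge0 ?sqr_ge0// lerDl sqr_ge0.
Qed.

Lemma normc_le z : normc z <= `|complex.Re z| + `|complex.Im z|.
Proof.
case: z => a b /=; rewrite -[leRHS]ger0_norm ?addr_ge0// -sqrtr_sqr ler_sqrt ?sqr_ge0//.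
have := mulr_ge0 (normr_ge0 a) (normr_ge0 b).
by rewrite -(real_normK (num_real a)) -(real_normK (num_real b)) sqrrD; lra.
Qed.

Lemma normc_prod (I : Type) (r : seq I) (f : I -> R[i]) :
  normc (\prod_(i <- r) f i) = \prod_(i <- r) normc (f i).
Proof.
elim: r => [|i r IH]; first by rewrite !big_nil normc1.
by rewrite !big_cons normcM IH.
Qed.

Lemma normc_sum (I : Type) (r : seq I) (f : I -> R[i]) :
  normc (\sum_(i <- r) f i) <= \sum_(i <- r) normc (f i).
Proof.
elim: r => [|i r IH]; first by rewrite !big_nil normc0.
by rewrite !big_cons (le_trans (normcD _ _))// lerD2l.
Qed.

(** Telescoping: factors of modulus at most 1 may be exchanged one at a
    time. *)
Lemma normc_prodB (I : Type) (r : seq I) (f g : I -> R[i]) :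
  (forall i, normc (f i) <= 1) -> (forall i, normc (g i) <= 1) ->
  normc (\prod_(i <- r) f i - \prod_(i <- r) g i) <= \sum_(i <- r) normc (f i - g i).
Proof.
move=> f1 g1; elim: r => [|i r IH]; first by rewrite !big_nil subrr normc0.
rewrite !big_cons.
have -> : f i * \prod_(j <- r) f j - g i * \prod_(j <- r) g j =
  (f i - g i) * \prod_(j <- r) f j + g i * (\prod_(j <- r) f j - \prod_(j <- r) g j).
  by ring.
rewrite (le_trans (normcD _ _))// !normcM; apply: lerD.
  rewrite ler_piMr ?normc_ge0// normc_prod; apply: prodr_ile1 => j _.
  by rewrite normc_ge0 f1.
by apply: le_trans IH; rewrite ler_piMl ?normc_ge0.
Qed.

Definition seqcontc d (u : 'cV[R]_d -> R[i]) :=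
  seqcont (fun t => complex.Re (u t)) /\ seqcont (fun t => complex.Im (u t)).

Lemma seqcont_cst d c : seqcont (fun _ : 'cV[R]_d => c).
Proof. by move=> ? ? _; exact: cvg_cst. Qed.
Lemma seqcontD d (u w : 'cV[R]_d -> R) : seqcont u -> seqcont w -> seqcont (fun t => u t + w t).
Proof. by move=> cu cw v_ v vv; apply: cvgD; [exact: cu|exact: cw]. Qed.
Lemma seqcontB d (u w : 'cV[R]_d -> R) : seqcont u -> seqcont w -> seqcont (fun t => u t - w t).
Proof. by move=> cu cw v_ v vv; apply: cvgB; [exact: cu|exact: cw]. Qed.
Lemma seqcontM d (u w : 'cV[R]_d -> R) : seqcont u -> seqcont w -> seqcont (fun t => u t * w t).
Proof. by move=> cu cw v_ v vv; apply: cvgM; [exact: cu|exact: cw]. Qed.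
Lemma seqcont_sum d (I : Type) (r : seq I) (u : I -> 'cV[R]_d -> R) :
  (forall i, seqcont (u i)) -> seqcont (fun t => \sum_(i <- r) u i t).
Proof.
move=> cu; elim: r => [|i r IH]; first by under eq_fun do rewrite big_nil; exact: seqcont_cst.
by under eq_fun do rewrite big_cons; exact: seqcontD.
Qed.
Lemma seqcont_prod d (I : Type) (r : seq I) (u : I -> 'cV[R]_d -> R) :
  (forall i, seqcont (u i)) -> seqcont (fun t => \prod_(i <- r) u i t).
Proof.
move=> cu; elim: r => [|i r IH]; first by under eq_fun do rewrite big_nil; exact: seqcont_cst.
by under eq_fun do rewrite big_cons; exact: seqcontM.
Qed.
Lemma seqcont_comp d (f : R -> R) (u : 'cV[R]_d -> R) : continuous f -> seqcont u ->
  seqcont (fun t => f (u t)).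
Proof. by move=> cf cu v_ v vv; apply: continuous_cvg; [exact: cf|exact: cu]. Qed.
Lemma seqcont_coord d k : seqcont (fun t : 'cV[R]_d => t k 0).
Proof. by move=> v_ v vv; exact: vv. Qed.
Lemma seqcont_dot d (y : 'cV[R]_d) : seqcont (fun t => dotv t y).
Proof.
under eq_fun do rewrite dotvE; apply: seqcont_sum => k.
by apply: seqcontM; [exact: seqcont_coord|exact: seqcont_cst].
Qed.

Lemma seqcontcM d (u w : 'cV[R]_d -> R[i]) : seqcontc u -> seqcontc w -> seqcontc (fun t => u t * w t).
Proof.
move=> [u1 u2] [w1 w2]; split.
  by under eq_fun do rewrite ReM; apply: seqcontB; exact: seqcontM.
by under eq_fun do rewrite ImM; apply: seqcontD; exact: seqcontM.
Qed.
Lemma seqcontcD d (u w : 'cV[R]_d -> R[i]) : seqcontc u -> seqcontc w -> seqcontc (fun t => u t + w t).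
Proof.
move=> [u1 u2] [w1 w2]; split.
  by under eq_fun do rewrite ReD; exact: seqcontD.
by under eq_fun do rewrite ImD; exact: seqcontD.
Qed.
Lemma seqcontc_cst d c : seqcontc (fun _ : 'cV[R]_d => c).
Proof. by split; exact: seqcont_cst. Qed.
Lemma seqcontc_sum d (I : Type) (r : seq I) (u : I -> 'cV[R]_d -> R[i]) :
  (forall i, seqcontc (u i)) -> seqcontc (fun t => \sum_(i <- r) u i t).
Proof.
move=> cu; elim: r => [|i r IH]; first by under eq_fun do rewrite big_nil; exact: seqcontc_cst.
by under eq_fun do rewrite big_cons; exact: seqcontcD.
Qed.
Lemma seqcontc_prod d (I : Type) (r : seq I) (u : I -> 'cV[R]_d -> R[i]) :
  (forall i, seqcontc (u i)) -> seqcontc (fun t => \prod_(i <- r) u i t).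
Proof.
move=> cu; elim: r => [|i r IH]; first by under eq_fun do rewrite big_nil; exact: seqcontc_cst.
by under eq_fun do rewrite big_cons; exact: seqcontcM.
Qed.
Lemma seqcontc_cis d (u : 'cV[R]_d -> R) : seqcont u -> seqcontc (fun t => cis (u t)).
Proof.
by move=> cu; split; apply: seqcont_comp => //; [exact: continuous_cos|exact: continuous_sin].
Qed.
Lemma seqcontc_rc d (u : 'cV[R]_d -> R) : seqcont u -> seqcontc (fun t => rc (u t)).
Proof. by move=> cu; split => //=; exact: seqcont_cst. Qed.

Lemma seqcont_normc d (u : 'cV[R]_d -> R[i]) : seqcontc u -> seqcont (fun t => normc (u t)).
Proof.
move=> [u1 u2]; under eq_fun do rewrite normcE.
apply: seqcont_comp; first exact: sqrt_continuous.
by under eq_fun do rewrite !expr2; apply: seqcontD; exact: seqcontM.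
Qed.

End Cplx.

(** * Fourier inversion for a truncated lattice law *)

Section TruncatedLaw.
Context {R : realType} {d : nat} (p : nat -> R) (y : nat -> 'cV[int]_d).
Hypothesis p_ge0 : forall k, 0 <= p k.
Hypothesis p_sum : forall K, \sum_(k < K) p k <= 1.

Lemma intvD (a b : 'cV[int]_d) : intv (a + b) = intv a + intv b :> 'cV[R]_d.
Proof. by apply/matrixP => i j; rewrite !mxE intrD. Qed.
Lemma intvN (a : 'cV[int]_d) : intv (- a) = - intv a :> 'cV[R]_d.
Proof. by apply/matrixP => i j; rewrite !mxE mulrNz. Qed.
Lemma intvB (a b : 'cV[int]_d) : intv (a - b) = intv a - intv b :> 'cV[R]_d.
Proof. by rewrite intvD intvN. Qed.
Lemma intv0 : intv (0 : 'cV[int]_d) = 0 :> 'cV[R]_d.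
Proof. by apply/matrixP => i j; rewrite !mxE. Qed.
Lemma intvMn (a : 'cV[int]_d) n : intv (a *+ n) = n%:R *: intv a :> 'cV[R]_d.
Proof. by apply/matrixP => i j; rewrite !mxE mulmxnE raddfMn /= mulr_natl. Qed.

Lemma dotv0r (t : 'cV[R]_d) : dotv t 0 = 0.
Proof. by rewrite dotvE big1// => k _; rewrite mxE mulr0. Qed.
Lemma dotvNr (t z : 'cV[R]_d) : dotv t (- z) = - dotv t z.
Proof. by rewrite -scaleN1r dotvZr mulN1r. Qed.
Lemma dotvBr (t w z : 'cV[R]_d) : dotv t (w - z) = dotv t w - dotv t z.
Proof. by rewrite dotvDr dotvNr. Qed.

Lemma dotv_intv_sum (I : Type) (r : seq I) (f : I -> 'cV[int]_d) (t : 'cV[R]_d) :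
  dotv t (intv (\sum_(i <- r) f i)) = \sum_(i <- r) dotv t (intv (f i)).
Proof.
elim: r => [|i r IH]; first by rewrite !big_nil intv0 dotv0r.
by rewrite !big_cons intvD dotvDr IH.
Qed.

Lemma dotv_delta (t : 'cV[R]_d) k : dotv t (intv (delta_mx k 0)) = t k 0.
Proof.
rewrite dotvE (bigD1 k)//= !mxE !eqxx mulr1 big1 ?addr0// => i ik.
by rewrite !mxE (negPf ik) mulr0.
Qed.

Definition phi K (t : 'cV[R]_d) : R[i] :=
  \sum_(k < K) rc (p k) * cis (dotv t (intv (y k))).

Lemma normc_phi K t : normc (phi K t) <= 1.
Proof.
apply: le_trans (p_sum K); apply: (le_trans (normc_sum _ _)); apply: ler_sum => k _.
by rewrite normcM normc_rc normc_cis mulr1 ger0_norm.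
Qed.

(** Expanding |phi|^2 as a double sum, 1 - |phi|^2 dominates the sum over
    all pairs of p_i p_j (1 - cos (t.(y_i - y_j))), all of whose terms are
    nonnegative; a single one is kept. *)
Lemma one_sub_phi K (a b : 'I_K) t :
  p a * p b * (1 - cos (dotv t (intv (y a - y b)))) <= 1 - normc (phi K t) ^+ 2.
Proof.
pose x k := dotv t (intv (y k)) : R.
have e1 : normc (phi K t) ^+ 2 = \sum_(i < K) \sum_(j < K) p i * p j * cos (x i - x j).
  rewrite sqr_normcE /phi Re_sum Im_sum !expr2 !big_distrlr /= -big_split /=.
  apply: eq_bigr => i _; rewrite -big_split /=; apply: eq_bigr => j _.
  by rewrite !mul0r subr0 addr0 cosB /x; ring.
have e2 : (\sum_(k < K) p k) ^+ 2 = \sum_(i < K) \sum_(j < K) p i * p j.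
  by rewrite expr2 big_distrlr.
have e3 : (\sum_(k < K) p k) ^+ 2 <= 1 by rewrite exprn_ile1// sumr_ge0.
apply: (@le_trans _ _ ((\sum_(k < K) p k) ^+ 2 - normc (phi K t) ^+ 2)); last by rewrite lerD2r.
rewrite e1 e2 -sumrB.
under eq_bigr do rewrite -sumrB.
have h i j : 0 <= p i * p j - p i * p j * cos (x i - x j).
  by rewrite -{1}(mulr1 (p i * p j)) -mulrBr mulr_ge0 ?mulr_ge0// subr_ge0 cos_le1.
rewrite (bigD1 a)//= (bigD1 b)//=.
have -> : dotv t (intv (y a - y b)) = x a - x b by rewrite intvB dotvBr.
rewrite mulrBr mulr1 -addrA lerDl addr_ge0// sumr_ge0// => i _.
by apply: sumr_ge0.
Qed.

Hypothesis gen : forall k : 'I_d, exists s : seq (nat * nat),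
  (forall ab, ab \in s -> 0 < p ab.1 /\ 0 < p ab.2) /\
  delta_mx k 0 = \sum_(ab <- s) (y ab.1 - y ab.2).

(** A unit vector is a finite sum of differences of atoms, so that
    1 - cos t_k is controlled by the corresponding terms 1 - cos (t.(y_a - y_b)).
    The truncation has to retain the atoms used, whence the threshold. *)
Lemma phi_coord (k : 'I_d) : exists CK : R * nat, 0 <= CK.1 /\
  forall K (t : 'cV[R]_d), (CK.2 <= K)%N -> 1 - cos (t k 0) <= CK.1 * (1 - normc (phi K t) ^+ 2).
Proof.
have [s [sp sE]] := gen k.
exists (2 ^+ size s * \sum_(ab <- s) (p ab.1 * p ab.2)^-1,
  (\max_(ab <- s) (maxn ab.1 ab.2).+1)%N); split => /=.
  by rewrite mulr_ge0 ?exprn_ge0// sumr_ge0// => ab _; rewrite invr_ge0 mulr_ge0.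
move=> K t sK.
rewrite -{1}(dotv_delta t k) sE dotv_intv_sum.
apply: (le_trans (subr_cos_sum _ _)); rewrite -mulrA ler_wpM2l ?exprn_ge0//.
rewrite mulr_suml big_seq [leRHS]big_seq; apply: ler_sum => ab abs.
have [pa pb] := sp _ abs.
have abK : ((maxn ab.1 ab.2).+1 <= K)%N.
  by apply: leq_trans sK; exact: (@leq_bigmax_seq _ _ xpredT (fun ab => (maxn ab.1 ab.2).+1) ab abs isT).
have aK : (ab.1 < K)%N by apply: leq_trans abK; rewrite ltnS leq_maxl.
have bK : (ab.2 < K)%N by apply: leq_trans abK; rewrite ltnS leq_maxr.
rewrite mulrC ler_pdivlMr ?mulr_gt0// mulrC.
exact: (one_sub_phi (Ordinal aK) (Ordinal bK)).
Qed.

(** From |phi|^2 <= 1 - S / (C + 1) and 1 + x <= exp x.  The constants are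
    uniform in the truncation level, which will depend on n. *)
Lemma phi_bound : exists (c : R) (K0 : nat), 0 < c /\ forall K (t : 'cV[R]_d), (K0 <= K)%N ->
  normc (phi K t) <= expR (- (c * \sum_k (1 - cos (t k 0)))).
Proof.
have /choice [CK hCK] := phi_coord.
pose C := \sum_k (CK k).1.
have C0 : 0 <= C by apply: sumr_ge0 => k _; have [] := hCK k.
(* The factor 2 takes the square root of the bound for |phi|^2; C + 1 avoids
   a division by 0 when d = 0. *)
exists (2 * (C + 1))^-1, (\max_k (CK k).2)%N; split; first by rewrite invr_gt0 mulr_gt0//; lra.
move=> K t hK.
set n2 := normc (phi K t) ^+ 2.
have n1 : 0 <= 1 - n2 by rewrite subr_ge0 exprn_ile1 ?normc_ge0 ?normc_phi.
set S := \sum_k _.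
have S1 : S <= C * (1 - n2).
  rewrite /S /C mulr_suml; apply: ler_sum => k _; apply: (hCK k).2.
  by apply: leq_trans hK; exact: (@leq_bigmax _ (fun k => (CK k).2) k).
have S2 : S / (C + 1) <= 1 - n2 by rewrite ler_pdivrMr; [nra|lra].
have : n2 <= expR (- ((2 * (C + 1))^-1 * S)) ^+ 2.
  rewrite -expRM_natl (_ : 2%:R * - ((2 * (C + 1))^-1 * S) = - (S / (C + 1))); last first.
    by field; apply/eqP; lra.
  by apply: le_trans (expR_ge1Dx _); lra.
by rewrite /n2 ler_pXn2r// nnegrE ?normc_ge0 ?expR_ge0.
Qed.

(** The characteristic function of the centred variable when m is the mean. *)
Definition psi K (m t : 'cV[R]_d) : R[i] := phi K t * cis (- dotv t m).

Lemma normc_psi K m t : normc (psi K m t) = normc (phi K t).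
Proof. by rewrite /psi normcM normc_cis mulr1. Qed.

Definition weight N (i : 'I_N) : R := (N - i)%:R.

(** The product runs over the N steps of the walk; the i-th one carries the
    weight N - i, as its step belongs to the partial sums i + 1, .., N. *)
Definition prodpsi K m N (s : R) (t : 'cV[R]_d) : R[i] :=
  \prod_(i < N) psi K m ((weight i * s) *: t).

Definition window (s : R) (t : 'cV[R]_d) : R := \prod_k trapezoid (s * t k 0).

Lemma window_ge0 s t : 0 <= window s t.
Proof. by apply: prodr_ge0 => k _; exact: trapezoid_ge0. Qed.
Lemma window_le1 s t : window s t <= 1.
Proof. by apply: prodr_ile1 => k _; rewrite trapezoid_ge0 trapezoid_le1. Qed.

Lemma sum_weight N (f : nat -> R) : \sum_(i < N) f (N - i)%N = \sum_(1 <= j < N.+1) f j.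
Proof.
rewrite big_add1 /= big_mkord (reindex_inj rev_ord_inj) /=.
by apply: eq_bigr => i _; rewrite subKn.
Qed.

(** The bound for |phi| turns the product over the steps into a product
    over the coordinates, to which the one-variable domination applies.  The
    angles s t_k only matter on the support of the window. *)
Lemma window_psi_dom : exists2 C : R, 0 <= C & exists K0 : nat, forall K m N s t,
  (K0 <= K)%N -> (0 < N)%N -> 0 <= s -> s ^+ 2 * N%:R ^+ 3 = 1 ->
  window s t * normc (prodpsi K m N s t) <= C * \prod_k cauchy (t k 0).
Proof.
have [c [K0 [c0 hK0]]] := phi_bound.
have [C C0 hC] := trapezoid_exp_le c0.
exists (C ^+ d); first exact: exprn_ge0.
exists K0 => K m N s t hK N0 s0 sN.
apply: (@le_trans _ _ (window s t * \prod_k expR (- (c * cos_deficit N (s * t k 0))))).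
  apply: ler_wpM2l; first exact: window_ge0.
  rewrite normc_prod.
  apply: (@le_trans _ _ (\prod_(i < N) expR (- (c * \sum_k (1 - cos ((weight i * s *: t) k 0)))))).
    by apply: ler_prod => i _; rewrite normc_ge0/= normc_psi hK0.
  rewrite -!expR_sum ler_expR !sumrN lerN2 -!mulr_sumr ler_wpM2l ?(ltW c0)//.
  rewrite [leRHS]exchange_big /=; apply: ler_sum => k _.
  rewrite /cos_deficit -(sum_weight N (fun j => 1 - cos (j%:R * (s * t k 0)))).
  by apply: ler_sum => i _; rewrite mxE mulrA.
rewrite /window -big_split /=.
apply: (@le_trans _ _ (\prod_(k < d) (C * cauchy (t k 0)))).
  apply: ler_prod => k _; rewrite mulr_ge0 ?trapezoid_ge0 ?expR_ge0//=.
  exact: hC.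
by rewrite prodrMl card_ord.
Qed.

Definition smoothed K m N (s : R) (t : 'cV[R]_d) : R[i] := rc (window s t) * prodpsi K m N s t.

Definition gauss_charf (V : 'M[R]_d) (t : 'cV[R]_d) : R := expR (- (dotv t (V *m t) / 2)).

Definition gap K m N s V (t : 'cV[R]_d) : R := normc (smoothed K m N s t - rc (gauss_charf V t)).

Lemma seqcont_dotl (z : 'cV[R]_d) (a : R) : seqcont (fun t => dotv (a *: t) z).
Proof. by under eq_fun do rewrite dotvZl; apply: seqcontM; [exact: seqcont_cst|exact: seqcont_dot]. Qed.

Lemma seqcontc_phi K a : seqcontc (fun t => phi K (a *: t)).
Proof.
apply: seqcontc_sum => k; apply: seqcontcM; first exact: seqcontc_cst.
by apply: seqcontc_cis; exact: seqcont_dotl.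
Qed.

Lemma seqcontc_psi K m a : seqcontc (fun t => psi K m (a *: t)).
Proof.
apply: seqcontcM; first exact: seqcontc_phi.
apply: seqcontc_cis => v_ v vv; apply: cvgN; exact: (@seqcont_dotl m a v_ v vv).
Qed.

Lemma seqcont_window s : seqcont (window s).
Proof.
apply: seqcont_prod => k; apply: seqcont_comp; first exact: continuous_trapezoid.
by apply: seqcontM; [exact: seqcont_cst|exact: seqcont_coord].
Qed.

Lemma seqcont_gauss_charf V : seqcont (gauss_charf V).
Proof.
rewrite /gauss_charf.
apply: (@seqcont_comp _ _ (fun x => expR (- (x / 2))) (fun t => dotv t (V *m t))).
  move=> x; apply: continuous_comp; last exact: continuous_expR.
  by apply: cvgN; apply: cvgMl; exact: cvg_id.
under eq_fun do rewrite dotvE.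
apply: seqcont_sum => k; apply: seqcontM; first exact: seqcont_coord.
under eq_fun do rewrite mxE; apply: seqcont_sum => j.
by apply: seqcontM; [exact: seqcont_cst|exact: seqcont_coord].
Qed.

Lemma seqcontc_smoothed K m N s : seqcontc (smoothed K m N s).
Proof.
apply: seqcontcM; first by apply: seqcontc_rc; exact: seqcont_window.
by apply: seqcontc_prod => i; exact: seqcontc_psi.
Qed.

Lemma seqcont_gap K m N s V : seqcont (gap K m N s V).
Proof.
apply: seqcont_normc; have -> : (fun t => smoothed K m N s t - rc (gauss_charf V t)) =
  (fun t => smoothed K m N s t + rc (0 - gauss_charf V t)).
  by apply/funext => t; rewrite rcB (_ : rc 0 = 0)// sub0r.
apply: seqcontcD; first exact: seqcontc_smoothed.
by apply: seqcontc_rc; apply: seqcontB; [exact: seqcont_cst|exact: seqcont_gauss_charf].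
Qed.

Section Limit.
Variables (K_ : nat -> nat) (s_ : nat -> R) (m : 'cV[R]_d) (V : 'M[R]_d).
Hypothesis s_ge0 : forall n, 0 <= s_ n.
Hypothesis sN : forall n, s_ n ^+ 2 * n.+1%:R ^+ 3 = 1.
Hypothesis K_large : forall K0 : nat, \forall n \near \oo, (K0 <= K_ n)%N.
Hypothesis prodpsi_cvg : forall t,
  normc (prodpsi (K_ n) m n.+1 (s_ n) t - rc (gauss_charf V t)) @[n --> \oo] --> 0.

Lemma scale_seq_le n : s_ n <= n.+1%:R^-1.
Proof.
have N1 : 1 <= n.+1%:R :> R by rewrite ler1n.
have N0 : 0 < n.+1%:R :> R by [].
rewrite -[leRHS]mul1r ler_pdivlMr// -(@expr_le1 _ 2)// ?mulr_ge0// exprMn.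
have := mulr_ge0 (mulr_ge0 (sqr_ge0 (s_ n)) (sqr_ge0 n.+1%:R)) (_ : 0 <= n.+1%:R - 1).
rewrite subr_ge0 => /(_ N1); have := sN n; rewrite exprS; move: (s_ n ^+ 2) (n.+1%:R) => a N.
by rewrite !expr2; lra.
Qed.

Lemma scale_seq_cvg0 : s_ n @[n --> \oo] --> 0.
Proof.
apply: (@squeeze_cvgr _ _ _ _ (cst 0) (fun n => n.+1%:R^-1)).
- by apply: nearW => n; rewrite s_ge0 scale_seq_le.
- exact: cvg_cst.
- exact: cvg_harmonic.
Qed.

Lemma window_cvg t : window (s_ n) t @[n --> \oo] --> (1 : R).
Proof.
have h k : trapezoid (s_ n * t k 0) @[n --> \oo] --> (1 : R).
  rewrite -[X in _ --> X](@trapezoid_in R 0) ?normr0 ?divr_ge0 ?pi_ge0//.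
  apply: continuous_cvg; first exact: continuous_trapezoid.
  by rewrite -[X in _ --> X](mul0r (t k 0)); apply: cvgMl; exact: scale_seq_cvg0.
rewrite (_ : 1 = \prod_(k < d) 1 :> R)//; last by rewrite big1.
rewrite /window; elim: (index_enum _) => [|k r IH].
  by under eq_fun do rewrite big_nil; rewrite big_nil; exact: cvg_cst.
by under eq_fun do rewrite big_cons; rewrite big_cons; apply: cvgM.
Qed.

Lemma gauss_charf_ge0 t : 0 <= gauss_charf V t. Proof. exact: expR_ge0. Qed.

(** As s_n tends to 0 the window tends to 1, so that it does not change
    the pointwise limit. *)
Lemma gap_cvg0 t : gap (K_ n) m n.+1 (s_ n) V t @[n --> \oo] --> 0.
Proof.
apply: (@squeeze_cvgr _ _ _ _ (cst 0) (fun n => normc (prodpsi (K_ n) m n.+1 (s_ n) t - rc (gauss_charf V t)) +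
   `|window (s_ n) t - 1| * gauss_charf V t)).
- apply: nearW => n; rewrite /gap normc_ge0/= /smoothed.
  set w := window _ _; set P := prodpsi _ _ _ _ _; set g := gauss_charf V t.
  have -> : rc w * P - rc g = rc w * (P - rc g) + rc (w - 1) * rc g.
    by rewrite rcB (_ : rc 1 = 1)//; ring.
  rewrite (le_trans (normcD _ _))// !normcM !normc_rc; apply: lerD.
    by rewrite ler_piMl ?normc_ge0// ger0_norm ?window_ge0 ?window_le1.
  by rewrite (ger0_norm (gauss_charf_ge0 t)).
- exact: cvg_cst.
- rewrite -[X in _ --> X]addr0; apply: cvgD; first exact: prodpsi_cvg.
  rewrite -[X in _ --> X](mul0r (gauss_charf V t)); apply: cvgMl.
  rewrite -[X in _ --> X](@normr0 _ R); apply: cvg_norm.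
  by rewrite -[X in _ --> X](subrr 1); apply: cvgB; [exact: window_cvg|exact: cvg_cst].
Qed.

(** Dominated convergence.  The Gaussian needs no estimate of its own: as
    the pointwise limit of dominated functions it satisfies the same bound. *)
Lemma iterint_gap_cvg : exists2 N0 : nat, (forall n, (N0 <= n)%N -> admissible (gap (K_ n) m n.+1 (s_ n) V)) &
  iterint (gap (K_ n) m n.+1 (s_ n) V) @[n --> \oo] --> 0.
Proof.
have [C C0 [K0 hC]] := window_psi_dom.
have [N0 _ hN0] := K_large K0.
have sd n t : (N0 <= n)%N -> normc (smoothed (K_ n) m n.+1 (s_ n) t) <= C * \prod_k cauchy (t k 0).
  move=> nN; rewrite /smoothed normcM normc_rc ger0_norm ?window_ge0//.
  by apply: hC => //; exact: hN0.
have gd t : gauss_charf V t <= C * \prod_k cauchy (t k 0).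
  apply/ler_addgt0Pr => e e0.
  have /cvgrPdist_lt /(_ _ e0) [N1 _ hN1] := gap_cvg0 t.
  (* The bound is transferred along an index that is large for both
     conditions. *)
  have := hN1 (maxn N0 N1) (leq_maxr _ _); rewrite sub0r normrN /= ger0_norm ?normc_ge0// => h.
  have := sd (maxn N0 N1) t (leq_maxl _ _).
  have : gauss_charf V t <= normc (smoothed (K_ (maxn N0 N1)) m (maxn N0 N1).+1 (s_ (maxn N0 N1)) t) +
     gap (K_ (maxn N0 N1)) m (maxn N0 N1).+1 (s_ (maxn N0 N1)) V t.
    rewrite -[leLHS](ger0_norm (gauss_charf_ge0 t)) -normc_rc /gap normcB.
    by rewrite -{1}(subrK (smoothed (K_ (maxn N0 N1)) m (maxn N0 N1).+1 (s_ (maxn N0 N1)) t) (rc _)) addrC normcD.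
  by move: h; lra.
have ud n : (N0 <= n)%N -> cauchy_dom (2 * C) (gap (K_ n) m n.+1 (s_ n) V).
  move=> nN t; rewrite ger0_norm ?normc_ge0// /gap (le_trans (normcD _ _))// normcNE.
  rewrite normc_rc (ger0_norm (gauss_charf_ge0 t)).
  by have := sd n t nN; have := gd t; lra.
exists N0 => [n nN|].
  by split; [exact: seqcont_gap|exists (2 * C); [rewrite mulr_ge0|exact: ud]].
rewrite -(cvg_shiftn N0).
suff : iterint (gap (K_ (n + N0)%N) m (n + N0).+1 (s_ (n + N0)%N) V) @[n --> \oo] --> iterint (fun _ : 'cV[R]_d => 0 : R).
  by rewrite iterint0.
apply: (@iterint_cvg _ _ _ _ (2 * C)).
- by rewrite mulr_ge0.
- by move=> n; exact: seqcont_gap.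
- by move=> n; apply: ud; exact: leq_addl.
- by move=> t; rewrite (cvg_shiftn N0 (fun n => gap (K_ n) m n.+1 (s_ n) V t)); exact: gap_cvg0.
Qed.

End Limit.

Section Inversion.
Variables (K N : nat) (s : R).
Hypothesis s0 : 0 < s.

(** The lattice point reached by the weighted walk whose i-th step is the
    atom of index f i. *)
Definition weighted_point (f : {ffun 'I_N -> 'I_K}) : 'cV[int]_d := \sum_i y (f i) *+ (N - i).

Definition truncated_pmf (z : 'cV[int]_d) : R := \sum_(f : {ffun 'I_N -> 'I_K} | weighted_point f == z) \prod_i p (f i).

Definition mode (f : {ffun 'I_N -> 'I_K}) (z : 'cV[int]_d) (t : 'cV[R]_d) : R :=
  window s t * cos (\sum_k ((weighted_point f - z) k 0)%:~R * (s * t k 0)).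

(** The integrand of the inversion formula: the real part of
    exp(- i s t.z) times the product of the characteristic functions, cut off by
    the window. *)
Definition fourier (z : 'cV[int]_d) (t : 'cV[R]_d) : R :=
  window s t * complex.Re (cis (- (s * dotv t (intv z))) * \prod_(i < N) phi K ((weight i * s) *: t)).

Lemma dotv_weighted_point (f : {ffun 'I_N -> 'I_K}) (t : 'cV[R]_d) : \sum_i dotv ((weight i * s) *: t) (intv (y (f i))) = s * dotv t (intv (weighted_point f)).
Proof.
rewrite /weighted_point dotv_intv_sum mulr_sumr; apply: eq_bigr => i _.
by rewrite intvMn dotvZl dotvZr /weight; ring.
Qed.

(** Expanding the product of sums over the trajectories f of the truncated
    walk turns the integrand into a finite combination of pure frequencies. *)
Lemma fourierE z t : fourier z t = \sum_(f : {ffun 'I_N -> 'I_K}) (\prod_i p (f i)) * mode f z t.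
Proof.
rewrite /fourier /phi bigA_distr_bigA /= mulr_sumr Re_sum mulr_sumr.
apply: eq_bigr => f _; rewrite big_split /= -rc_prod -cis_sum dotv_weighted_point mulrCA -cisD ReM /= mul0r subr0.
rewrite /mode mulrCA; congr (_ * (_ * cos _)).
rewrite addrC -mulrBr -dotvBr -intvB dotvE mulr_sumr; apply: eq_bigr => k _.
by rewrite !mxE; ring.
Qed.

Lemma admissible_mode f z : admissible (mode f z).
Proof.
split.
  apply: seqcontM; first exact: seqcont_window.
  apply: seqcont_comp; first exact: continuous_cos.
  apply: seqcont_sum => k; apply: seqcontM; first exact: seqcont_cst.
  by apply: seqcontM; [exact: seqcont_cst|exact: seqcont_coord].
pose C := 1 + (3 * pi / 2 / s) ^+ 2.
have C0 : 0 <= C by rewrite addr_ge0// sqr_ge0.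
exists (C ^+ d); first exact: exprn_ge0.
move=> t; rewrite /mode normrM (ger0_norm (window_ge0 _ _)).
apply: (@le_trans _ _ (window s t)); first by rewrite ler_piMr ?window_ge0// cos_max.
apply: (@le_trans _ _ (\prod_(k < d) (C * cauchy (t k 0)))); last by rewrite prodrMl card_ord.
by apply: ler_prod => k _; rewrite trapezoid_ge0/= trapezoid_dom.
Qed.

(** Only the frequency 0, that is the trajectories ending at z,
    contributes to the integral of the window. *)
Lemma fourier_inversion z : admissible (fourier z) /\
  iterint (fourier z) = truncated_pmf z * (2 * pi / s) ^+ d.
Proof.
have [h1 h2] := @iterint_sum R d _ (index_enum {ffun 'I_N -> 'I_K}) (fun f => \prod_i p (f i)) (fun f => mode f z)
  (fun f => admissible_mode f z).
have E : fourier z = (fun t => \sum_(f : {ffun 'I_N -> 'I_K}) (\prod_i p (f i)) * mode f z t).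
  by apply/funext => t; exact: fourierE.
rewrite E; split => //; rewrite h2 /truncated_pmf mulr_suml [RHS]big_mkcond /=; apply: eq_bigr => f _.
have -> : iterint (mode f z) =
    if [forall k, (weighted_point f - z) k 0 == 0] then (2 * pi / s) ^+ d else 0.
  have := @trapezoid_fourier R d 1 s 0 (fun k => (weighted_point f - z) k 0) s0.
  rewrite cos0 mulr1 mul1r => <-; apply: eq_iterint => t.
  by rewrite /mode mul1r add0r.
have -> : [forall k, (weighted_point f - z) k 0 == 0] = (weighted_point f == z).
  apply/forallP/eqP => [h|-> k]; last by rewrite subrr mxE.
  by apply/eqP; rewrite -subr_eq0; apply/eqP/matrixP => i j; rewrite ord1 [RHS]mxE; exact/eqP.
by case: ifP => _; rewrite ?mulr0.
Qed.

Variables (m : 'cV[R]_d) (V : 'M[R]_d) (eta : 'cV[R]_d) (z : 'cV[int]_d).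
Hypothesis V_pos : posdefmx V.
Hypothesis etaE : V *m eta = s *: (intv z - (\sum_(i < N) weight i) *: m).
Hypothesis admissible_gap : admissible (gap K m N s V).

(** Centring the steps changes the phase by the total weight times m,
    so that the phase attached to z becomes t.(V eta). *)
Lemma fourier_smoothed t :
  fourier z t = complex.Re (cis (- dotv t (V *m eta)) * smoothed K m N s t).
Proof.
rewrite /smoothed /prodpsi /psi big_split /= -cis_sum sumrN.
have -> : \sum_(i < N) dotv (weight i * s *: t) m = s * ((\sum_(i < N) weight i) * dotv t m).
  by rewrite mulr_suml mulr_sumr; apply: eq_bigr => i _; rewrite dotvZl; ring.
set W := \sum_i weight i; set P := \prod_i phi _ _.
have -> : cis (- dotv t (V *m eta)) * (rc (window s t) * (P * cis (- (s * (W * dotv t m))))) =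
  rc (window s t) * (cis (- (s * dotv t (intv z))) * P).
  rewrite [LHS](_ : _ = rc (window s t) * ((cis (- dotv t (V *m eta)) * cis (- (s * (W * dotv t m)))) * P)); last by ring.
  rewrite -cisD etaE dotvZr dotvBr dotvZr; congr (_ * (cis _ * _)); rewrite -/W; ring.
by rewrite [RHS]ReM /= mul0r subr0.
Qed.

(** Both terms are integrals of the real part of the same phase against
    the smoothed product and the Gaussian: the difference is at most the L1
    distance, which does not depend on z. *)
Lemma trunc_error :
  `|truncated_pmf z * (2 * pi / s) ^+ d -
    Num.sqrt (2 * pi) ^+ d / Num.sqrt (\det V) * expR (- (dotv eta (V *m eta) / 2))|
  <= iterint (gap K m N s V).
Proof.
have [af <-] := fourier_inversion z.
have := iterint_gauss eta 1 0 V_pos; rewrite cos0 mulr1 mul1r => <-.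
set w := fun t => _.
have wE t : `|fourier z t - w t| <= gap K m N s V t.
  rewrite fourier_smoothed /w mul1r add0r.
  have -> : expR (- (dotv t (V *m t) / 2)) * cos (dotv t (V *m eta)) =
    complex.Re (cis (- dotv t (V *m eta)) * rc (gauss_charf V t)).
    by rewrite ReM /= mulr0 subr0 cosN mulrC.
  rewrite /gap -[leRHS]mul1r -(normc_cis (- dotv t (V *m eta))) -normcM mulrBr.
  apply: le_trans (normc_Re _); rewrite ReD.
  by case: (_ * rc _) => a b.
apply: ler_dist_iterint => //.
split.
  apply: seqcontM.
    by apply: seqcontM; [exact: seqcont_cst|exact: seqcont_gauss_charf].
  apply: seqcont_comp; first exact: continuous_cos.
  by apply: seqcontD; [exact: seqcont_cst|exact: seqcont_dot].
case: af => _ [C C0 hC]; case: admissible_gap => _ [D D0 hD].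
exists (C + D) => [|t]; first exact: addr_ge0.
have -> : w t = fourier z t - (fourier z t - w t) by rewrite opprB addrC subrK.
rewrite (le_trans (ler_normB _ _))// mulrDl; apply: lerD; first exact: hC.
apply: le_trans (hD t); apply: (le_trans (wE t)); exact: ler_norm.
Qed.

End Inversion.

End TruncatedLaw.

(** * Second-order expansion and the pointwise limit *)

Section Moments.
Context {R : realType}.

Lemma MVT_from0 (f df : R -> R) (x : R) : (forall c : R, is_derive c 1 f (df c)) -> f 0 = 0 ->
  0 <= x -> exists2 c, 0 <= c <= x & f x = df c * x.
Proof.
move=> dF f0; rewrite le_eqVlt => /orP[/eqP<-|x0].
  by exists 0; rewrite ?lexx// mulr0.
have [c cx E] : exists2 c : R, c \in `]0, x[ & f x - f 0 = df c * (x - 0).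
  apply: MVT => //.
  by apply: continuous_subspaceT; exact: (der_continuous dF).
exists c; last by move: E; rewrite f0 !subr0.
by move: cx; rewrite in_itv/= => /andP[/ltW -> /ltW ->].
Qed.

Lemma ler_norm_sin (x : R) : `|sin x| <= `|x|.
Proof.
wlog x0 : x / 0 <= x.
  move=> W; have [x0|x0] := leP 0 x; first exact: W.
  by rewrite -normrN -sinN -(normrN x); apply: W; rewrite oppr_ge0 ltW.
have [c _ ->] := MVT_from0 (@is_derive_sin R) (@sin0 R) x0.
by rewrite normrM ler_piMl// cos_max.
Qed.

Lemma subr_cos_le (x : R) : 1 - cos x <= x ^+ 2 / 2.
Proof.
rewrite subr_cos -(real_normK (num_real x)) -(real_normK (num_real (sin _))).
have h : `|sin (x / 2)| <= `|x| / 2.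
  by rewrite (le_trans (ler_norm_sin _))// normrM [ `|2^-1|]ger0_norm.
have h0 := normr_ge0 (sin (x / 2)).
rewrite !expr2; nra.
Qed.

Lemma sin_sub_le (x : R) : `|sin x - x| <= `|x| ^+ 3 / 2.
Proof.
wlog x0 : x / 0 <= x.
  move=> W; have [x0|x0] := leP 0 x; first exact: W.
  have := W (- x); rewrite oppr_ge0 (ltW x0) => /(_ isT).
  by rewrite sinN -opprD normrN normrN.
have dF (c : R) : is_derive c 1 (fun x => sin x - x) (cos c - 1).
  exact: (is_deriveB (is_derive_sin c) (is_derive_id _ _)).
have [|c /andP[c0 cx] ->] := MVT_from0 dF _ x0; first by rewrite sin0 subrr.
rewrite normrM distrC (ger0_norm x0) ger0_norm ?subr_ge0 ?cos_le1//.
have := subr_cos_le c; have : c ^+ 2 <= x ^+ 2 by rewrite lerXn2r.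
move=> h1 h2; have : (1 - cos c) * x <= (x ^+ 2 / 2) * x by rewrite ler_wpM2r//; lra.
by rewrite (exprSr x 2); lra.
Qed.

(** Unlike the cubic bound, this one gives a dominating function that is
    integrable under a second moment assumption. *)
Lemma sin_sub_le2 (x : R) : `|sin x - x| <= x ^+ 2.
Proof.
rewrite -(real_normK (num_real x)); have a0 := normr_ge0 x.
have [h|h] := leP `|x| 2.
  apply: (le_trans (sin_sub_le x)); rewrite exprS.
  by have := sqr_ge0 `|x|; nra.
apply: (le_trans (ler_normB _ _)); have := ler_norm_sin x; rewrite expr2; nra.
Qed.

Lemma expRN_second (v : R) : 0 <= v -> `|expR (- v) - (1 - v)| <= v ^+ 2.
Proof.
move=> v0; rewrite ger0_norm; last by rewrite subr_ge0; exact: expR_ge1Dx.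
have := expRN_le v0; have v1 : 0 < 1 + v by lra.
have : (1 + v)^-1 <= 1 - v + v ^+ 2.
  by rewrite -[leLHS]mul1r ler_pdivrMr// expr2; have := mulr_ge0 v0 (mulr_ge0 v0 v0); lra.
lra.
Qed.

Context (dT : measure_display) (T : measurableType dT) (P : probability T R).
Variables (U : T -> R) (sg2 : R).
Hypothesis mU : measurable_fun setT U.
Hypothesis iU2 : P.-integrable setT (EFin \o (fun t => U t ^+ 2)).
Hypothesis EU : \int[P]_t U t = 0.
Hypothesis EU2 : \int[P]_t (U t ^+ 2) = sg2.

Definition charf (r : R) : R[i] := Complex (\int[P]_t cos (r * U t)) (\int[P]_t sin (r * U t)).

Lemma measurable_cosU r : measurable_fun setT (fun t => cos (r * U t)).
Proof.
apply: (measurableT_comp (f := cos)); first exact: (continuous_measurable_fun (@continuous_cos R)).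
exact: measurable_funM.
Qed.

Lemma measurable_sinU r : measurable_fun setT (fun t => sin (r * U t)).
Proof.
apply: (measurableT_comp (f := sin)); first exact: (continuous_measurable_fun (@continuous_sin R)).
exact: measurable_funM.
Qed.

Lemma integrable_bounded (f : T -> R) (C : R) : measurable_fun setT f -> (forall t, `|f t| <= C) ->
  P.-integrable setT (EFin \o f).
Proof.
move=> mf fC; apply: (@le_integrable _ _ _ _ _ measurableT _ (EFin \o cst C)).
- exact/measurable_EFinP.
- by move=> t _; rewrite /= lee_fin (le_trans (fC t))// ler_norm.
- exact: finite_measure_integrable_cst.
Qed.

Lemma integrable_U : P.-integrable setT (EFin \o U).
Proof.
apply: (@le_integrable _ _ _ _ _ measurableT _ (EFin \o (fun t => 1 + U t ^+ 2))).
- exact/measurable_EFinP.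
- move=> t _; rewrite /= lee_fin [leRHS]ger0_norm ?addr_ge0 ?sqr_ge0//.
  rewrite -(real_normK (num_real (U t))); have := sqr_ge0 (`|U t| - 1); rewrite expr2; nra.
- have := integrableD measurableT (integrable_bounded (C := 1) (f := cst 1) _ _) iU2.
  by apply => //= t; rewrite normr1.
Qed.

(** Only second moments are available, so the remainders
    (1 - cos (r U)) / r^2 and (sin (r U) - r U) / r^2 are handled by dominated
    convergence, with U^2 as a dominating function; their means tend to sg2 / 2
    and to 0. *)
Lemma charf_expansion (e : R) : 0 < e -> exists2 del : R, 0 < del & forall r, `|r| <= del ->
  normc (charf r - rc (expR (- (r ^+ 2 * sg2 / 2)))) <= e * r ^+ 2.
Proof.
move=> e0.
pose h1 (r : R) := \int[P]_t ((1 - cos (r * U t)) / r ^+ 2).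
pose h2 (r : R) := \int[P]_t ((sin (r * U t) - r * U t) / r ^+ 2).
have sg0 : 0 <= sg2 by rewrite -EU2; apply: Rintegral_ge0 => t _; exact: sqr_ge0.
have c1 : h1 r @[r --> 0^'] --> sg2 / 2.
  apply/cvgr_dnbhsP => r_ [r0 rc0].
  rewrite -EU2 -RintegralZr//.
  apply: (@Rintegral_dominated_cvg R _ _ P _ _ (fun t => U t ^+ 2)) => //.
  - move=> n; apply: measurable_funM => //; apply: measurable_funB => //.
    exact: measurable_cosU.
  - move=> t.
    have -> : (fun n => (1 - cos (r_ n * U t)) / r_ n ^+ 2) =
      (fun n => 2 * (sin (r_ n * (U t / 2)) / r_ n) ^+ 2).
      apply/funext => n; by rewrite subr_cos expr_div_n -!mulrA.
    rewrite (_ : U t ^+ 2 / 2 = 2 * (U t / 2) ^+ 2); last by field.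
    suff hs : sin (r_ n * (U t / 2)) / r_ n @[n --> \oo] --> U t / 2.
      by apply: cvgMr; rewrite expr2; under eq_fun do rewrite expr2; exact: cvgM.
    pose f (r : R) : R := sin (r * (U t / 2)).
    have [dd dv] : is_derive (0 : R) 1 f (U t / 2).
      apply: (der_eq (der_sin (der_mul (der_id 0) (der_cst (U t / 2) 0)))).
      by rewrite mul0r cos0 mul1r mul0r add0r mulr1.
    rewrite -[X in _ --> X]dv.
    have /cvgr_dnbhsP /(_ r_ (conj r0 rc0)) :
      h^-1 *: ((f \o shift (0 : R)) (h *: (1 : R)) - f 0) @[h --> 0^'] --> 'D_1 f 0 by exact: dd.
    apply: cvg_trans; apply: near_eq_cvg; apply: nearW => n.
    by rewrite /f /= addr0 mul0r sin0 subr0 /GRing.scale /= mulr1 mulrC.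
  - move=> n t; have rn : 0 < r_ n ^+ 2 by rewrite lt_neqAle sqr_ge0 eq_sym sqrf_eq0 r0.
    rewrite ger0_norm ?divr_ge0 ?sqr_ge0 ?subr_ge0 ?cos_le1// ler_pdivrMr//.
    by apply: (le_trans (subr_cos_le _)); rewrite exprMn; have := mulr_ge0 (sqr_ge0 (r_ n)) (sqr_ge0 (U t)); lra.
have c2 : h2 r @[r --> 0^'] --> 0.
  apply/cvgr_dnbhsP => r_ [r0 rc0].
  rewrite [X in _ --> X](_ : 0 = \int[P]_t (0 : R)); last by rewrite Rintegral_cst// mul0r.
  apply: (@Rintegral_dominated_cvg R _ _ P _ _ (fun t => U t ^+ 2)) => //.
  - move=> n; apply: measurable_funM => //; apply: measurable_funB; first exact: measurable_sinU.
    exact: measurable_funM.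
  - move=> t; apply: norm_cvg0.
    apply: (@squeeze_cvgr _ _ _ _ (cst 0) (fun n => `|r_ n| * (`|U t| ^+ 3 / 2))).
    + apply: nearW => n; rewrite normr_ge0/= normrM normfV [ `|_ ^+ 2|]ger0_norm ?sqr_ge0//.
      have rn : 0 < r_ n ^+ 2 by rewrite lt_neqAle sqr_ge0 eq_sym sqrf_eq0 r0.
      rewrite ler_pdivrMr//; apply: (le_trans (sin_sub_le _)).
      by rewrite normrM exprMn -[in leRHS](real_normK (num_real (r_ n))); lra.
    + exact: cvg_cst.
    + rewrite -[X in _ --> X](mul0r (`|U t| ^+ 3 / 2)); apply: cvgMl.
      by rewrite -[X in _ --> X](@normr0 _ R); exact: cvg_norm.
  - move=> n t; have rn : 0 < r_ n ^+ 2 by rewrite lt_neqAle sqr_ge0 eq_sym sqrf_eq0 r0.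
    rewrite normrM normfV [ `|_ ^+ 2|]ger0_norm ?sqr_ge0// ler_pdivrMr//.
    by apply: (le_trans (sin_sub_le2 _)); rewrite exprMn mulrC.
have icos r : P.-integrable setT (EFin \o (fun t => cos (r * U t))).
  by apply: (integrable_bounded (C := 1)) => [|t]; [exact: measurable_cosU|exact: cos_max].
have isin r : P.-integrable setT (EFin \o (fun t => sin (r * U t))).
  by apply: (integrable_bounded (C := 1)) => [|t]; [exact: measurable_sinU|exact: sin_max].
have i1 : P.-integrable setT (EFin \o (fun _ => 1 : R)).
  by apply: (integrable_bounded (C := 1)) => // t; rewrite normr1.
have irU r : P.-integrable setT (EFin \o (fun t => r * U t)).
  exact: (integrableZl measurableT r integrable_U).
have I1 : \int[P]_t (1 : R) = 1 by rewrite Rintegral_cst// mul1r; have /(congr1 fine) /= := probability_setT P.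
have h1E r : h1 r = (1 - \int[P]_t cos (r * U t)) / r ^+ 2.
  rewrite /h1 RintegralZr//; last exact: (integrableB measurableT i1 (icos r)).
  by rewrite RintegralB// I1.
have h2E r : h2 r = (\int[P]_t sin (r * U t)) / r ^+ 2.
  rewrite /h2 RintegralZr//; last exact: (integrableB measurableT (isin r) (irU r)).
  rewrite RintegralB// RintegralZl//; last exact: integrable_U.
  by rewrite EU mulr0 subr0.
have e3 : 0 < e / 3 by rewrite divr_gt0.
have /cvgrPdist_lt /(_ _ e3) N1 := c1.
have /cvgrPdist_lt /(_ _ e3) N2 := c2.
have [d1 /= d10 hd1] := N1; have [d2 /= d20 hd2] := N2.
(* This radius makes the fourth-order term (r^2 sg2 / 2)^2 of the exponential
   smaller than e r^2 / 3. *)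
pose d3 := e / 3 / (1 + sg2 ^+ 2).
have s1 : 0 < 1 + sg2 ^+ 2 by rewrite ltr_wpDr ?sqr_ge0.
have d30 : 0 < d3 by rewrite divr_gt0.
exists (Num.min (Num.min (d1 / 2) (d2 / 2)) (Num.min 1 d3)).
  by rewrite !lt_min d30 ltr01 !andbT; apply/andP; split; rewrite divr_gt0.
move=> r; rewrite !le_min => /andP[/andP[r1 r2] /andP[r3 r4]].
have [->|rn0] := eqVneq r 0.
  have C0 : \int[P]_t cos (0 * U t) = 1 by under eq_Rintegral do rewrite mul0r cos0.
  have S0 : \int[P]_t sin (0 * U t) = 0.
    by under eq_Rintegral do rewrite mul0r sin0; rewrite Rintegral_cst// mul0r.
  rewrite /charf C0 S0 !expr0n !mul0r oppr0 expR0.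
  by rewrite subrr addr0 expr0n /= addr0 sqrtr0 mulr0.
have rn : 0 < r ^+ 2 by rewrite lt_neqAle sqr_ge0 eq_sym sqrf_eq0 rn0.
have q1 : `|sg2 / 2 - h1 r| < e / 3.
  by apply: hd1 => //=; rewrite sub0r normrN; lra.
have q2 : `|0 - h2 r| < e / 3.
  by apply: hd2 => //=; rewrite sub0r normrN; lra.
apply: (le_trans (normc_le (charf r - rc (expR (- (r ^+ 2 * sg2 / 2)))))).
rewrite ReD ImD /= oppr0 addr0.
have g1 : \int[P]_t cos (r * U t) = 1 - r ^+ 2 * h1 r.
  by rewrite h1E mulrCA divff ?gt_eqF// mulr1 subKr.
have g2 : \int[P]_t sin (r * U t) = r ^+ 2 * h2 r.
  by rewrite h2E mulrCA divff ?gt_eqF// mulr1.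
rewrite g1 g2 normrM (ger0_norm (sqr_ge0 r)).
have v0 : 0 <= r ^+ 2 * sg2 / 2 by rewrite divr_ge0// mulr_ge0// sqr_ge0.
have := expRN_second v0; set E := expR _ => hE.
have hE2 : `|E - (1 - r ^+ 2 * sg2 / 2)| <= r ^+ 2 * (e / 3).
  apply: (le_trans hE).
  have rle : r ^+ 2 <= d3.
    rewrite -(real_normK (num_real r)) expr2; have := normr_ge0 r; nra.
  have : r ^+ 2 * (1 + sg2 ^+ 2) <= e / 3 by rewrite -ler_pdivlMr.
  move: rn (sqr_ge0 sg2); set x := r ^+ 2 => x0 sq h.
  have := ler_wpM2l (ltW x0) h; have := mulr_ge0 (sqr_ge0 x) sq; have := sqr_ge0 x.
  by rewrite expr2; lra.
have E1 : `|1 - r ^+ 2 * h1 r - E| <= r ^+ 2 * `|sg2 / 2 - h1 r| + r ^+ 2 * (e / 3).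
  have -> : 1 - r ^+ 2 * h1 r - E = r ^+ 2 * (sg2 / 2 - h1 r) - (E - (1 - r ^+ 2 * sg2 / 2)).
    by field.
  apply: (le_trans (ler_normB _ _)); apply: lerD => //.
  by rewrite normrM (ger0_norm (sqr_ge0 r)).
apply: (le_trans (lerD E1 (lexx _))).
rewrite sub0r normrN in q2.
have := ler_wpM2l (ltW rn) (ltW q1); have := ler_wpM2l (ltW rn) (ltW q2).
by lra.
Qed.

End Moments.

Section PointwiseLimit.
Context {R : realType} {d : nat} (p : nat -> R) (y : nat -> 'cV[int]_d).
Hypothesis p_ge0 : forall k, 0 <= p k.
Hypothesis p_sum : forall K, \sum_(k < K) p k <= 1.

Lemma sum_sqrE N : \sum_(1 <= j < N.+1) j%:R ^+ 2 = N%:R * (N%:R + 1) * (2 * N%:R + 1) / 6 :> R.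
Proof.
elim: N => [|N IH]; first by rewrite big_geq// !mul0r.
by rewrite big_nat_recr//= IH -natr1; field.
Qed.

Lemma sum_id N : \sum_(i < N) weight i = N%:R * (N%:R + 1) / 2 :> R.
Proof.
rewrite (sum_weight N (fun j => j%:R)).
elim: N => [|N IH]; first by rewrite big_geq// !mul0r.
by rewrite big_nat_recr//= IH -natr1; field.
Qed.

Variables (K_ : nat -> nat) (s_ : nat -> R) (m : 'cV[R]_d) (V : 'M[R]_d) (t : 'cV[R]_d).
Hypothesis s_ge0 : forall n, 0 <= s_ n.
Hypothesis sN : forall n, s_ n ^+ 2 * n.+1%:R ^+ 3 = 1.
Variables (chi : R -> R[i]) (eps : nat -> R).
Hypothesis psi_chi : forall n r, normc (psi p y (K_ n) m (r *: t) - chi r) <= eps n.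
Hypothesis eps_cvg : n.+1%:R * eps n @[n --> \oo] --> 0.
Hypothesis V_ge0 : 0 <= dotv t (V *m t).
Hypothesis chi_expansion : forall e : R, 0 < e -> exists2 del : R, 0 < del & forall r, `|r| <= del ->
  normc (chi r - rc (expR (- (r ^+ 2 * (3 * dotv t (V *m t)) / 2)))) <= e * r ^+ 2.

(** The factors are compared one by one with
    exp(- (w_i s)^2 3 v / 2), where v = t.V t: the errors add up to
    N eps + e s^2 sum_i w_i^2, and s^2 sum_i w_i^2 tends to 1/3.  The error eps
    accounts for the truncation, which is why it has to be o(1/N). *)
Lemma prodpsi_cvg_gauss :
  normc (prodpsi p y (K_ n) m n.+1 (s_ n) t - rc (gauss_charf V t)) @[n --> \oo] --> 0.
Proof.
have V0 := V_ge0; have hex := chi_expansion; set v := dotv t (V *m t) in V0 hex.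
pose G n (i : 'I_n.+1) : R := expR (- ((weight i * s_ n) ^+ 2 * (3 * v) / 2)).
pose W n : R := \sum_(i < n.+1) (weight i * s_ n) ^+ 2.
have s2E n : s_ n ^+ 2 = (n.+1%:R ^+ 3)^-1.
  have N0 : n.+1%:R ^+ 3 != 0 :> R by rewrite expf_neq0.
  by apply: (mulIf N0); rewrite sN mulVf.
have WE n : W n = (1 + n.+1%:R^-1) * (2 + n.+1%:R^-1) / 6.
  have -> : W n = s_ n ^+ 2 * \sum_(i < n.+1) weight i ^+ 2.
    by rewrite /W mulr_sumr; apply: eq_bigr => i _; rewrite exprMn mulrC.
  rewrite (sum_weight n.+1 (fun j => j%:R ^+ 2)) sum_sqrE.
  by rewrite s2E; field.
have inv0 : n.+1%:R^-1 @[n --> \oo] --> (0 : R) by exact: cvg_harmonic.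
have Wc : W n @[n --> \oo] --> (3^-1 : R).
  under eq_fun do rewrite WE.
  rewrite (_ : 3^-1 = (1 + 0) * (2 + 0) / 6 :> R); last by field.
  by apply: cvgMl; apply: cvgM; apply: cvgD => //; exact: cvg_cst.
have W1 n : W n <= 1.
  rewrite WE; have : n.+1%:R^-1 <= 1 :> R by rewrite invf_le1// ler1n.
  have : 0 <= n.+1%:R^-1 :> R by rewrite invr_ge0.
  by move: (n.+1%:R^-1) => x; nra.
have Gc : \prod_(i < n.+1) G n i @[n --> \oo] --> gauss_charf V t.
  have -> : (fun n => \prod_(i < n.+1) G n i) = (fun n => expR (- (W n * (3 * v) / 2))).
    apply/funext => n; rewrite -expR_sum; congr expR.
    by rewrite sumrN -mulr_suml -mulr_suml.
  rewrite /gauss_charf -/v (_ : v / 2 = 3^-1 * (3 * v) / 2); last by field.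
  apply: continuous_cvg; first exact: continuous_expR.
  by apply: cvgN; apply: cvgMl; apply: cvgMl.
apply/cvgrPdist_le => e e0.
have e3 : 0 < e / 3 by rewrite divr_gt0.
have [del del0 hdel] := hex _ e3.
near=> n.
rewrite sub0r normrN ger0_norm ?normc_ge0//.
have h1 : n.+1%:R * eps n <= e / 3.
  apply: le_trans (ler_norm _) _.
  by near: n; have /cvgr0_norm_le := eps_cvg; apply.
have h2 : `|\prod_(i < n.+1) G n i - gauss_charf V t| <= e / 3.
  by rewrite distrC; near: n; have /cvgrPdist_le := Gc; apply.
have h3 : n.+1%:R^-1 <= del ^+ 2.
  apply: le_trans (ler_norm _) _.
  by near: n; have /cvgr0_norm_le := inv0; apply; rewrite exprn_gt0.
have small (i : 'I_n.+1) : `|weight i * s_ n| <= del.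
  rewrite ger0_norm ?mulr_ge0//.
  have : n.+1%:R * s_ n <= del.
    rewrite -(@ler_pXn2r _ 2)// ?nnegrE ?mulr_ge0// ?(ltW del0)//.
    rewrite exprMn; apply: le_trans h3.
    by rewrite s2E le_eqVlt; apply/orP; left; apply/eqP; field.
  apply: le_trans; apply: ler_wpM2r => //.
  by rewrite /weight ler_nat leq_subr.
have h4 : normc (prodpsi p y (K_ n) m n.+1 (s_ n) t - \prod_(i < n.+1) rc (G n i)) <= 2 * (e / 3).
  apply: (le_trans (normc_prodB _ _ _)).
  - by move=> i; rewrite normc_psi normc_phi.
  - move=> i; rewrite normc_rc ger0_norm ?expR_ge0// -[leRHS]expR0 ler_expR oppr_le0.
    by rewrite divr_ge0// mulr_ge0 ?sqr_ge0// mulr_ge0.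
  apply: (@le_trans _ _ (\sum_(i < n.+1) (eps n + e / 3 * (weight i * s_ n) ^+ 2))).
    apply: ler_sum => i _.
    rewrite -(subrK (chi (weight i * s_ n)) (psi _ _ _ _ _)) -addrA.
    by apply: (le_trans (normcD _ _)); apply: lerD; [exact: psi_chi|exact: hdel].
  rewrite big_split /= sumr_const card_ord -mulr_natl -mulr_sumr -/(W n).
  by have := ler_wpM2l (ltW e3) (W1 n); lra.
rewrite -(subrK (\prod_(i < n.+1) rc (G n i)) (prodpsi _ _ _ _ _ _ _)) -addrA.
apply: (le_trans (normcD _ _)).
have : normc (\prod_(i < n.+1) rc (G n i) - rc (gauss_charf V t)) <= e / 3.
  by rewrite -rc_prod -rcB normc_rc.
by move: h4; lra.
Unshelve. all: by end_near. Qed.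

End PointwiseLimit.

(** * The weighted walk on the lattice *)

Section BorelMx.
Context {R : realType} {d : nat}.

Lemma measurable_closed_cv (A : set 'cV[R]_d) : closed A -> measurable A.
Proof.
move=> cA; rewrite -(setCK A); apply: measurableC.
by apply: sub_sigma_algebra; exact: closed_openC.
Qed.

Lemma measurable_set1_cv (x : 'cV[R]_d) : measurable [set x].
Proof.
apply: measurable_closed_cv; apply: accessible_closed_set1.
by apply: hausdorff_accessible; exact: norm_hausdorff.
Qed.

Lemma measurable_coord (dT : measure_display) (T : measurableType dT) (Y : {mfun T >-> 'cV[R]_d}) k :
  measurable_fun setT (fun t => Y t k 0).
Proof.
apply: (measurability _ (RGenOpens.measurableE R)) => //.
move=> _ [_ [a [b ->] <-]].
have := @measurable_funPTI _ _ _ _ Y ((fun v : 'cV[R]_d => v k 0) @^-1` `]a, b[%classic).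
rewrite setTI; apply; apply: sub_sigma_algebra.
apply: open_comp; last exact: interval_open.
by move=> v _; exact: coord_continuous.
Qed.

End BorelMx.

Section Probability.
Context {dT : measure_display} {T : measurableType dT} {R : realType}.
Context (P : probability T R).

Lemma prob_fin_union (I : finType) (Q : pred I) (F : I -> set T) :
  (forall i, measurable (F i)) -> trivIset setT F ->
  P (\bigcup_(i in [set i | Q i]) F i) = (\sum_(i | Q i) P (F i))%E.
Proof.
move=> mF tF.
have -> : [set i | Q i] = [set` enum Q].
  by apply/seteqP; split => i /=; rewrite mem_enum.
rewrite measure_fin_bigcup//.
- by rewrite -fsbig_seq ?enum_uniq// big_enum.
- by move=> i j _ _; exact: tF.
Qed.

Context {d : nat} (X : nat -> {RV P >-> 'cV[R]_d}) (X_iid : iid P X).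
Context (H : 'M[R]_d) (b : 'cV[R]_d).
Hypothesis H_unit : H \in unitmx.
Hypothesis X_supp : supported_on P (X 0%N) (translate b (lattice H)).

(** Singletons indexed by an enumeration of Z^d; an index that encodes no
    vector gives the empty set. *)
Definition atom (k : nat) : set 'cV[R]_d :=
  [set x : 'cV[R]_d | exists z : 'cV[int]_d, choice.pickle z = k /\ x = b + H *m intv z].

Definition point (k : nat) : 'cV[int]_d := odflt 0 (choice.unpickle k).

Lemma atomE k x : atom k x -> x = b + H *m intv (point k).
Proof. by case=> z [<- ->]; rewrite /point choice.pickleK. Qed.

Lemma lattice_inj : injective (fun z : 'cV[int]_d => b + H *m intv z).
Proof.
move=> z w /addrI /(congr1 (mulmx (invmx H))); rewrite !mulKmx//.
move/matrixP => h; apply/matrixP => i j; have := h i j; rewrite !mxE.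
exact: intr_inj.
Qed.

Lemma atom_inj k l x : atom k x -> atom l x -> k = l.
Proof. by case=> z [<- ->] [w [<- /lattice_inj ->]]. Qed.

Lemma measurable_atom k : measurable (atom k).
Proof.
have [[x kx]|nx] := pselect (exists x, atom k x).
  rewrite (_ : atom k = [set b + H *m intv (point k)]); first exact: measurable_set1_cv.
  by apply/seteqP; split => y /= => [/atomE//|->]; rewrite -(atomE kx).
rewrite (_ : atom k = set0)//.
by apply/seteqP; split => y // ky; apply: nx; exists y.
Qed.

Definition hit (i k : nat) : set T := X i @^-1` atom k.

Lemma measurable_hit i k : measurable (hit i k).
Proof. by apply: measurable_funPTI; exact: measurable_atom. Qed.

Definition mass (k : nat) : R := fine (P (hit 0 k)).

Lemma massE i k : P (hit i k) = (mass k)%:E.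
Proof.
rewrite /mass fineK ?fin_num_measure//; last exact: measurable_hit.
by apply: X_iid.1; exact: measurable_atom.
Qed.

Lemma mass_ge0 k : 0 <= mass k. Proof. by rewrite fine_ge0. Qed.

Lemma trivIset_hit i D : trivIset D (hit i).
Proof. by move=> k l _ _ [t [/atom_inj h /h]]. Qed.

Definition hits (i K : nat) : set T := \bigcup_(k in [set k : 'I_K | true]) hit i k.

Lemma measurable_hits i K : measurable (hits i K).
Proof. by apply: fin_bigcup_measurable => // k _; exact: measurable_hit. Qed.

Lemma prob_hits i K : P (hits i K) = (\sum_(k < K) mass k)%:E.
Proof.
rewrite /hits (@prob_fin_union 'I_K xpredT (fun k => hit i k)).
- by rewrite -sumEFin; apply: eq_bigr => k _; exact: massE.
- by move=> k; exact: measurable_hit.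
- by move=> k l _ _ kl; apply/val_inj; exact: (@trivIset_hit i setT).
Qed.

Lemma mass_sum_le1 K : \sum_(k < K) mass k <= 1.
Proof. by rewrite -lee_fin -(prob_hits 0) probability_le1//; exact: measurable_hits. Qed.

(** Continuity from below: the first K atoms exhaust the support. *)
Lemma mass_sum_cvg : \sum_(k < K) mass k @[K --> \oo] --> (1 : R).
Proof.
have h : P (hits 0 K) @[K --> \oo] --> P (\bigcup_K hits 0 K).
  apply: nondecreasing_cvg_mu.
  - by move=> K; exact: measurable_hits.
  - by apply: bigcup_measurable => K _; exact: measurable_hits.
  - move=> K L KL; apply/subsetPset => t [k _ hk].
    by exists (widen_ord KL k).
have E : \bigcup_K hits 0 K = X 0%N @^-1` (translate b (lattice H)).
  apply/seteqP; split => t.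
    by move=> [K _ [k _ [z [_ E]]]]; exists (H *m intv z); [exists z|].
  move=> [_ [z _ <-] E]; exists (choice.pickle z).+1 => //.
  by exists ord_max => //; exists z.
rewrite E X_supp in h.
have : EFin \o (fun K => \sum_(k < K) mass k) @ \oo --> (1%:E : \bar R).
  by apply: cvg_trans h; apply: near_eq_cvg; apply: nearW => K /=; rewrite prob_hits.
by move/fine_cvgP => [].
Qed.

Section Walk.
Variables (n K : nat).
Let N := n.+1.

Definition traj (f : {ffun 'I_N -> 'I_K}) : set T := \bigcap_(i in [set i : 'I_N | true]) hit i.+1 (f i).

Lemma measurable_traj f : measurable (traj f).
Proof. by apply: fin_bigcap_measurable => // i _; exact: measurable_hit. Qed.

(** Independence, once the trajectory is rewritten as an intersection over
    the index set 1, .., N of the steps. *)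
Lemma prob_traj f : P (traj f) = (\prod_(i < N) mass (f i))%:E.
Proof.
pose J := seq_fset tt (iota 1 N).
pose A j := atom (f (inord j.-1)).
have JE : perm_eq J (iota 1 N).
  by apply: (perm_trans (seq_fset_perm _ _)); rewrite undup_id ?iota_uniq.
have -> : traj f = \bigcap_(j in [set` J]) (X j @^-1` A j).
  apply/seteqP; split => t h.
    move=> j /=; rewrite (perm_mem JE) mem_iota => /andP[j1 jN].
    have jN' : (j.-1 < N)%N by move: jN; rewrite add1n ltnS -ltnS prednK.
    have := h (Ordinal jN') isT; rewrite /hit /= prednK// /A.
    by rewrite (_ : inord j.-1 = Ordinal jN')//; apply/val_inj; rewrite /= inordK.
  move=> i _; have := h i.+1; rewrite /A /= inord_val; apply.
  by rewrite (perm_mem JE) mem_iota /= add1n ltnS ltn_ord.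
rewrite X_iid.2; last by move=> j _; exact: measurable_atom.
rewrite (perm_big _ JE) (_ : iota 1 N = index_iota 1 N.+1); last by rewrite /index_iota subn1.
rewrite big_add1 /= big_mkord -prodEFin; apply: eq_bigr => i _.
by rewrite /A /= inord_val; exact: massE.
Qed.

Lemma traj_inj (f g : {ffun 'I_N -> 'I_K}) t : traj f t -> traj g t -> f = g.
Proof.
move=> ft gt; apply/ffunP => i; apply/val_inj.
exact: (atom_inj (ft i isT) (gt i isT)).
Qed.

Definition inrange : set T := \bigcap_(i in [set i : 'I_N | true]) hits i.+1 K.

Lemma measurable_inrange : measurable inrange.
Proof. by apply: fin_bigcap_measurable => // i _; exact: measurable_hits. Qed.

Lemma inrange_traj t : inrange t -> exists f, traj f t.
Proof.
move=> gt.
have /choice [f hf] : forall i : 'I_N, exists k : 'I_K, hit i.+1 k t.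
  by move=> i; have [k _ hk] := gt i isT; exists k.
by exists (finfun f) => i _; rewrite ffunE.
Qed.

Lemma traj_inrange f t : traj f t -> inrange t.
Proof. by move=> ft i _; exists (f i) => //; exact: ft. Qed.

Definition weighted_walk (t : T) : 'cV[R]_d := \sum_(i < N) (weight i : R) *: X i.+1 t.

Lemma weighted_walk_traj f t : traj f t ->
  weighted_walk t = (\sum_(i < N) (weight i : R)) *: b + H *m intv (weighted_point point f).
Proof.
move=> ft; rewrite /weighted_walk /weighted_point scaler_suml.
have -> : intv (\sum_(i < N) point (f i) *+ (N - i)) = \sum_(i < N) (weight i : R) *: (intv (point (f i)) : 'cV[R]_d).
  elim: (index_enum _) => [|i r IH]; first by rewrite !big_nil intv0.
  by rewrite !big_cons intvD IH intvMn.
rewrite mulmx_sumr -big_split /=; apply: eq_bigr => i _.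
by rewrite (atomE (ft i isT)) scalerDr scalemxAr.
Qed.

Definition event (z : 'cV[int]_d) : set T :=
  [set t | weighted_walk t = (\sum_(i < N) (weight i : R)) *: b + H *m intv z].

Lemma measurable_event z : measurable (event z).
Proof.
pose v := (\sum_(i < N) (weight i : R)) *: b + H *m intv z.
have -> : event z = \bigcap_(k in [set k : 'I_d | true]) ((fun t => weighted_walk t k 0) @^-1` [set v k 0]).
  apply/seteqP; split => t /=; first by move=> et k _; exact: (congr1 (fun M : 'cV[R]_d => M k 0) et).
  by move=> h; apply/matrixP => k j; rewrite ord1; exact: (h k isT).
apply: fin_bigcap_measurable => // k _.
rewrite -[X in measurable X]setTI.
have : measurable_fun setT (fun t => weighted_walk t k 0).
  under eq_fun do rewrite /weighted_walk summxE.
  apply: measurable_sum => i; under eq_fun do rewrite mxE.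
  by apply: measurable_funM => //; exact: measurable_coord.
by apply.
Qed.

Lemma event_traj z f t : traj f t -> event z t <-> weighted_point point f = z.
Proof.
move=> ft; rewrite /event /= (weighted_walk_traj ft); split; last by move=> ->.
move=> /addrI h; apply: lattice_inj; congr (_ + _); exact: h.
Qed.

(** On this event the walk follows exactly one trajectory, and its end
    point is determined by it. *)
Lemma prob_event_inrange z : P (event z `&` inrange) = (truncated_pmf mass point K N z)%:E.
Proof.
have -> : event z `&` inrange = \bigcup_(f in [set f : {ffun 'I_N -> 'I_K} | weighted_point point f == z]) traj f.
  apply/seteqP; split => t.
    by move=> [et /inrange_traj[f ft]]; exists f => //=; apply/eqP/(event_traj z ft).
  by move=> [f /= /eqP fz ft]; split; [exact/(event_traj z ft)|exact: traj_inrange ft].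
rewrite (@prob_fin_union _ (fun f => weighted_point point f == z) traj).
- by rewrite /truncated_pmf -sumEFin; apply: eq_bigr => f _; exact: prob_traj.
- exact: measurable_traj.
- by move=> f g _ _ [t [ft gt]]; exact: traj_inj ft gt.
Qed.

Lemma prob_not_inrange : (P (~` inrange) <= (N%:R * (1 - \sum_(k < K) mass k))%:E)%E.
Proof.
have -> : ~` inrange = \big[setU/set0]_(i < N) (~` hits i.+1 K).
  rewrite -(bigcup_mkord N (fun i => ~` hits i.+1 K)).
  apply/seteqP; split => t.
    move=> ng; apply: contrapT => nb; apply: ng => i _; apply: contrapT => hi.
    by apply: nb; exists i => //=.
  by move=> [i /= iN hi] /(_ (Ordinal iN) isT).
apply: (le_trans (@Boole_inequality _ _ _ P (fun i => ~` hits i.+1 K) N _)).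
  by move=> i _; apply: measurableC; exact: measurable_hits.
rewrite (eq_bigr (fun _ => (1 - \sum_(k < K) mass k)%:E)).
  by rewrite sumEFin sumr_const card_ord mulr_natl.
move=> i _; transitivity (1 - P (hits i.+1 K))%E; last by rewrite prob_hits.
by apply: probability_setC; exact: measurable_hits.
Qed.

(** Truncating the law costs at most the probability that one of the
    N steps leaves the first K atoms. *)
Lemma prob_event_approx z :
  `|fine (P (event z)) - truncated_pmf mass point K N z| <= N%:R * (1 - \sum_(k < K) mass k).
Proof.
have mE := measurable_event z; have mG := measurable_inrange.
have fE := fin_num_measure P _ mE.
have : P (event z) = (P (event z `&` inrange) + P (event z `\` inrange))%E.
  by rewrite -measureU ?setDE -?setIUr ?setUv ?setIT//; [exact: measurableI|
    apply: measurableI => //; exact: measurableC|rewrite setIACA setICr setI0].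
have mD : measurable (event z `\` inrange) by apply: measurableD.
have fD := fin_num_measure P _ mD.
rewrite prob_event_inrange => ->; rewrite fineD//= [X in X - _]addrC addrK ger0_norm ?fine_ge0//.
rewrite -lee_fin fineK//; apply: le_trans prob_not_inrange.
by apply: le_measure => [||t [] //]; rewrite inE //; exact: measurableC.
Qed.

End Walk.
End Probability.

(** * Moments and characteristic function of a summand *)

Section SummandMoments.
Context {dT : measure_display} {T : measurableType dT} {R : realType}.
Context (P : probability T R).

Lemma Rintegral_sum (I : Type) (r : seq I) (f : I -> T -> R) :
  (forall i, P.-integrable setT (EFin \o f i)) ->
  P.-integrable setT (EFin \o (fun t => \sum_(i <- r) f i t)) /\
  \int[P]_t (\sum_(i <- r) f i t) = \sum_(i <- r) \int[P]_t f i t.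
Proof.
move=> fi; elim: r => [|i r [IH1 IH2]].
  rewrite big_nil; under eq_Rintegral do rewrite big_nil; rewrite Rintegral_cst// mul0r; split=> //.
  by under eq_fun do rewrite big_nil; exact: finite_measure_integrable_cst.
have E : (fun t => \sum_(j <- i :: r) f j t) = (fun t => f i t + \sum_(j <- r) f j t).
  by apply/funext => t; rewrite big_cons.
rewrite E big_cons -IH2; split; last by rewrite RintegralD.
exact: (integrableD measurableT (fi i) IH1).
Qed.

Lemma integrableZ_EFin (a : R) (f : T -> R) : P.-integrable setT (EFin \o f) ->
  P.-integrable setT (EFin \o (fun t => a * f t)).
Proof. exact: (integrableZl measurableT). Qed.

Context {d : nat} (X : nat -> {RV P >-> 'cV[R]_d}) (X_iid : iid P X).
Context (H : 'M[R]_d) (b : 'cV[R]_d).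
Hypothesis H_unit : H \in unitmx.
Hypothesis X_supp : supported_on P (X 0%N) (translate b (lattice H)).

Notation hit := (hit X H b).
Notation mass := (mass X H b).

(** A function bounded by 1 that depends on the step only through its
    atom has its mean approximated by the sum over the first K atoms. *)
Lemma mass_approx (K : nat) (f : T -> R) (a : nat -> R) : measurable_fun setT f ->
  (forall t, `|f t| <= 1) -> (forall k t, hit 0 k t -> f t = a k) ->
  `|\int[P]_t f t - \sum_(k < K) mass k * a k| <= 1 - \sum_(k < K) mass k.
Proof.
move=> mf f1 fa.
pose ind (k : 'I_K) (t : T) : R := \1_(hit 0 k) t.
have iind k : P.-integrable setT (EFin \o ind k).
  by apply: integrable_indic; exact: measurable_hit.
have Iind k : \int[P]_t ind k t = mass k.
  rewrite /Rintegral /ind integral_indic// ?setIT//; exact: measurable_hit.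
have if_ : P.-integrable setT (EFin \o f) by exact: (integrable_bounded P mf f1).
have [i1 e1] := Rintegral_sum (index_enum 'I_K) (fun k => integrableZ_EFin (a k) (iind k)).
have [i2 e2] := Rintegral_sum (index_enum 'I_K) iind.
have E1 : \sum_(k < K) mass k * a k = \int[P]_t (\sum_(k < K) a k * ind k t).
  by rewrite e1; apply: eq_bigr => k _; rewrite RintegralZl// Iind mulrC.
have E2 : \sum_(k < K) mass k = \int[P]_t (\sum_(k < K) ind k t).
  by rewrite e2; apply: eq_bigr => k _; rewrite Iind.
have E3 : 1 = \int[P]_t (1 : R).
  by rewrite Rintegral_cst// mul1r; have /(congr1 fine) /= := probability_setT P.
have i3 : P.-integrable setT (EFin \o (fun _ : T => 1 : R)) by exact: finite_measure_integrable_cst.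
rewrite E1 E2 [X in _ <= X - _]E3 -!RintegralB//.
have i4 := integrableB measurableT if_ i1.
apply: (le_trans (le_normr_Rintegral _ _)) => //.
apply: le_Rintegral => //.
- by have := integrable_abse i4.
- exact: (integrableB measurableT i3 i2).
- move=> t _.
  have [[k hk]|nk] := pselect (exists k : 'I_K, hit 0 k t).
    have ik (j : 'I_K) : j != k -> ind j t = 0.
      move=> jk; rewrite /ind indicE memNset// => hj.
      by move/eqP: jk; apply; apply/val_inj; exact: (atom_inj H_unit hj hk).
    have ik1 : ind k t = 1 by rewrite /ind indicE mem_set.
    rewrite (bigD1 k)//= [X in _ <= _ - X](bigD1 k)//= ik1 !big1 ?addr0 ?mulr1.
    - by rewrite (fa k t hk) subrr normr0 subrr.
    - by move=> j jk; rewrite ik.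
    - by move=> j jk; rewrite ik// mulr0.
  have ik j : ind j t = 0 by rewrite /ind indicE memNset// => hj; apply: nk; exists j.
  by rewrite !big1 ?subr0 ?f1// => j _; rewrite ik ?mulr0.
Qed.

Variables (mu : 'cV[R]_d) (M : 'M[R]_d).
Hypothesis X_moment : ('E_P[fun t => (enorm (X 0%N t) ^+ 2)%R] < +oo)%E.
Hypothesis muE : mu = expectation_mx P (X 0%N).
Hypothesis ME : M = covariance_mx P (X 0%N).

Lemma enorm_sqr (x : 'cV[R]_d) : enorm x ^+ 2 = \sum_k x k 0 ^+ 2.
Proof.
rewrite /enorm dotvE sqr_sqrtr; last by apply: sumr_ge0 => k _; rewrite -expr2 sqr_ge0.
by apply: eq_bigr => k _; rewrite expr2.
Qed.

Lemma integrable_coord_sqr k : P.-integrable setT (EFin \o (fun t => X 0%N t k 0 ^+ 2)).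
Proof.
have mc j : measurable_fun setT (fun t => X 0%N t j 0) by exact: measurable_coord.
have mn : measurable_fun setT (fun t => enorm (X 0%N t) ^+ 2).
  under eq_fun do rewrite enorm_sqr; apply: measurable_sum => j.
  by under eq_fun do rewrite expr2; exact: measurable_funM.
have ine : P.-integrable setT (EFin \o (fun t => enorm (X 0%N t) ^+ 2)).
  apply/integrableP; split; first exact/measurable_EFinP.
  have := X_moment; rewrite unlock; congr (_ < _)%E.
  by apply: eq_integral => x _; rewrite /= ger0_norm ?sqr_ge0.
apply: le_integrable ine => //.
- by apply/measurable_EFinP; under eq_fun do rewrite expr2; exact: measurable_funM.
- move=> t _; rewrite /= lee_fin !ger0_norm ?sqr_ge0// enorm_sqr (bigD1 k)//= lerDl.
  by apply: sumr_ge0 => j _; exact: sqr_ge0.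
Qed.

Lemma integrable_coord k : P.-integrable setT (EFin \o (fun t => X 0%N t k 0)).
Proof. by apply: integrable_U; [exact: measurable_coord|exact: integrable_coord_sqr]. Qed.

Lemma mean_coord k : mu k 0 = \int[P]_t X 0%N t k 0.
Proof. by rewrite muE mxE unlock. Qed.

Definition centred (k : 'I_d) (t : T) : R := X 0%N t k 0 - mu k 0.

Lemma integrable_centred k : P.-integrable setT (EFin \o centred k).
Proof.
have ic : P.-integrable setT (EFin \o (fun _ : T => mu k 0)) by exact: finite_measure_integrable_cst.
exact: (integrableB measurableT (integrable_coord k) ic).
Qed.

Lemma measurable_centred k : measurable_fun setT (centred k).
Proof. by apply: measurable_funB => //; exact: measurable_coord. Qed.

Lemma integral_centred k : \int[P]_t centred k t = 0.
Proof.
have ic : P.-integrable setT (EFin \o (fun _ : T => mu k 0)) by exact: finite_measure_integrable_cst.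
rewrite /centred RintegralB//; last exact: integrable_coord.
rewrite -mean_coord Rintegral_cst//.
by have /(congr1 fine) /= -> := probability_setT P; rewrite mulr1 subrr.
Qed.

Lemma integrable_centred_sqr k : P.-integrable setT (EFin \o (fun t => centred k t ^+ 2)).
Proof.
have ic : P.-integrable setT (EFin \o (fun _ : T => 2 * mu k 0 ^+ 2)) by exact: finite_measure_integrable_cst.
have := integrableD measurableT (integrableZ_EFin 2 (integrable_coord_sqr k)) ic.
apply: le_integrable => //.
  by apply/measurable_EFinP; under eq_fun do rewrite expr2; apply: measurable_funM; exact: measurable_centred.
move=> t _; rewrite /= lee_fin !ger0_norm ?sqr_ge0//; last first.
  by rewrite addr_ge0// mulr_ge0// sqr_ge0.
by rewrite /centred; have := sqr_ge0 (X 0%N t k 0 + mu k 0); rewrite !expr2; lra.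
Qed.

Lemma integrable_centredM i j : P.-integrable setT (EFin \o (fun t => centred i t * centred j t)).
Proof.
have := integrableD measurableT (integrable_centred_sqr i) (integrable_centred_sqr j).
apply: le_integrable => //.
  by apply/measurable_EFinP; apply: measurable_funM; exact: measurable_centred.
move=> t _; rewrite /= lee_fin [leRHS]ger0_norm ?addr_ge0 ?sqr_ge0//.
rewrite normrM -(real_normK (num_real (centred i t))) -(real_normK (num_real (centred j t))).
have := sqr_ge0 (`|centred i t| - `|centred j t|); have := mulr_ge0 (normr_ge0 (centred i t)) (normr_ge0 (centred j t)).
by rewrite !expr2; lra.
Qed.

Lemma cov_coord i j : M i j = \int[P]_t (centred i t * centred j t).
Proof.
rewrite ME /covariance_mx -muE mxE unlock /Rintegral; congr fine; apply: eq_integral => t _.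
by rewrite !mxE big_ord1 !mxE.
Qed.

Variable theta : 'cV[R]_d.

(** The coordinate of the centred step along theta in the basis given by H;
    dual is the same linear form in the original coordinates. *)
Definition proj (t : T) : R := dotv theta (invmx H *m (X 0%N t - mu)).
Definition dual : 'cV[R]_d := (invmx H)^T *m theta.

Lemma projE t : proj t = \sum_k dual k 0 * centred k t.
Proof.
rewrite /proj /dotv mulmxA -[theta^T *m _](_ : dual^T = _); last by rewrite /dual trmx_mul trmxK.
by rewrite -/(dotv dual _) dotvE; apply: eq_bigr => k _; rewrite /centred !mxE.
Qed.

Lemma measurable_proj : measurable_fun setT proj.
Proof.
rewrite (_ : proj = fun t => \sum_k dual k 0 * centred k t); last by apply/funext => t; exact: projE.
apply: measurable_sum => k.
by apply: measurable_funM => //; exact: measurable_centred.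
Qed.

Lemma integral_proj : \int[P]_t proj t = 0.
Proof.
under eq_Rintegral do rewrite projE.
have [_ ->] := Rintegral_sum (index_enum 'I_d) (fun k => integrableZ_EFin (dual k 0) (integrable_centred k)).
by rewrite big1// => k _; rewrite RintegralZl ?integral_centred ?mulr0//; exact: integrable_centred.
Qed.

Lemma proj_sqr : P.-integrable setT (EFin \o (fun t => proj t ^+ 2)) /\
  \int[P]_t (proj t ^+ 2) = dotv dual (M *m dual).
Proof.
have E : (fun t => proj t ^+ 2) = (fun t => \sum_i \sum_j (dual i 0 * dual j 0) * (centred i t * centred j t)).
  apply/funext => t; rewrite projE expr2 big_distrlr /=.
  by apply: eq_bigr => i _; apply: eq_bigr => j _; ring.
have h i := Rintegral_sum (index_enum 'I_d) (fun j => integrableZ_EFin (dual i 0 * dual j 0) (integrable_centredM i j)).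
have [h1 h2] := Rintegral_sum (index_enum 'I_d) (fun i => (h i).1).
rewrite E; split => //; rewrite h2 dotvE; apply: eq_bigr => i _.
rewrite (h i).2 [(M *m dual) i 0]mxE mulr_sumr; apply: eq_bigr => j _.
by rewrite RintegralZl ?cov_coord//; [ring|exact: integrable_centredM].
Qed.

(** Truncation error of the characteristic function; it is uniform in r. *)
Lemma psi_charf K r : normc (psi mass (@point d) K (invmx H *m (mu - b)) (r *: theta) - charf P proj r)
  <= 2 * (1 - \sum_(k < K) mass k).
Proof.
set m := invmx H *m (mu - b).
pose a k := r * dotv theta (intv (point k) - m).
have psiE : psi mass (@point d) K m (r *: theta) = \sum_(k < K) rc (mass k) * cis (a k).
  rewrite /psi /phi mulr_suml; apply: eq_bigr => k _.
  by rewrite -mulrA -cisD !dotvZl /a dotvBr mulrBr.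
have hit_proj k t : hit 0 k t -> r * proj t = a k.
  move=> /atomE E; rewrite /proj E /a; congr (_ * dotv _ _).
  by rewrite /m -[b + _ - mu]addrA addrCA mulmxDr mulKmx// -[b - mu]opprB mulmxN.
have mp := measurable_proj.
rewrite psiE normcB; apply: (le_trans (normc_le _)).
rewrite ReD ImD.
have -> : complex.Re (charf P proj r) + complex.Re (- \sum_(k < K) rc (mass k) * cis (a k)) =
  \int[P]_t cos (r * proj t) - \sum_(k < K) mass k * cos (a k).
  have -> : forall z : R[i], complex.Re (- z) = - complex.Re z by case.
  by rewrite Re_sum; congr (_ - _); apply: eq_bigr => k _; rewrite ReM /= mul0r subr0.
have -> : complex.Im (charf P proj r) + complex.Im (- \sum_(k < K) rc (mass k) * cis (a k)) =
  \int[P]_t sin (r * proj t) - \sum_(k < K) mass k * sin (a k).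
  have -> : forall z : R[i], complex.Im (- z) = - complex.Im z by case.
  by rewrite Im_sum; congr (_ - _); apply: eq_bigr => k _; rewrite ImM /= mul0r addr0.
rewrite mulr2n mulrDl mul1r; apply: lerD; [apply: (@mass_approx K (fun t => cos (r * proj t)) (fun k => cos (a k)))|
  apply: (@mass_approx K (fun t => sin (r * proj t)) (fun k => sin (a k)))].
- exact: measurable_cosU.
- by move=> t; exact: cos_max.
- by move=> k t /hit_proj ->.
- exact: measurable_sinU.
- by move=> t; exact: sin_max.
- by move=> k t /hit_proj ->.
Qed.

End SummandMoments.

(** * Minimality of the lattice *)

Section Lattice.
Context {R : realType} {d : nat} (H : 'M[R]_d).
Hypothesis H_unit : H \in unitmx.

Lemma coord_le_norm (u : 'cV[R]_d) k : `|u k 0| <= `|u|.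
Proof.
by rewrite [leRHS]mx_normrE; exact: (le_bigmax _ (fun ij => `|u ij.1 ij.2|) (k, 0)).
Qed.

Lemma lattice_discrete : exists2 del : R, 0 < del &
  forall z w : 'cV[int]_d, `|H *m intv z - H *m intv w| < del -> z = w.
Proof.
pose C := \sum_i \sum_j `|invmx H i j|.
have C0 : 0 <= C by apply: sumr_ge0 => i _; apply: sumr_ge0.
have C1 : 0 < C + 1 by rewrite ltr_wpDl.
exists (C + 1)^-1; first by rewrite invr_gt0.
move=> z w; set u := _ - _ => hu; apply/matrixP => i j; rewrite ord1 {j}.
have E : invmx H *m u = intv (z - w) by rewrite /u -mulmxBr mulKmx// intvB.
have h1 : `|(intv (z - w) : 'cV[R]_d) i 0| <= C * `|u|.
  rewrite -E mxE; apply: (le_trans (ler_norm_sum _ _ _)).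
  apply: (@le_trans _ _ (\sum_j `|invmx H i j| * `|u|)).
    by apply: ler_sum => j _; rewrite normrM ler_wpM2l// coord_le_norm.
  rewrite -mulr_suml ler_wpM2r// /C [leRHS](bigD1 i)//= lerDl.
  by apply: sumr_ge0 => k _; apply: sumr_ge0.
have h2 : C * `|u| < 1.
  apply: (@le_lt_trans _ _ ((C + 1) * `|u|)); first by rewrite ler_wpM2r// lerDl.
  by rewrite mulrC -ltr_pdivlMr// div1r.
have : `|((z - w) i 0)%:~R : R| < 1 by move: h1; rewrite mxE => h1; exact: le_lt_trans h1 h2.
rewrite -intr_norm -[X in _ < X](mulr1z 1) ltr_int => h.
apply/eqP; rewrite -subr_eq0 -normr_eq0; move: h; rewrite !mxE; move: (z i 0 - w i 0) => v.
by case: v => [[|n]|n].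
Qed.

(** A subset of a translate of a lattice is closed, because distinct
    lattice points are uniformly separated. *)
Lemma subcoset_closed (x0 : 'cV[R]_d) (A : set 'cV[R]_d) :
  (forall a, A a -> exists z, a = x0 + H *m intv z) -> closed A.
Proof.
move=> AL x clx; have [del del0 hdel] := lattice_discrete.
have near_pt (e : R) : 0 < e -> exists2 a, A a & `|x - a| < e.
  move=> e0; have [a [Aa xa]] := clx (ball x e) (nbhsx_ballx x e e0).
  by exists a => //; move: xa; rewrite -ball_normE.
have d20 : 0 < del / 2 by rewrite divr_gt0.
have [a Aa xa] := near_pt _ d20.
have [->//|xna] := eqVneq x a.
have e0 : 0 < Num.min (del / 2) `|x - a| by rewrite lt_min d20 normr_gt0 subr_eq0.
have [a' Aa'] := near_pt _ e0; rewrite lt_min => /andP[xa' xaa].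
have [z za] := AL _ Aa; have [z' za'] := AL _ Aa'.
have zz : z = z'.
  apply: hdel; rewrite (_ : _ - _ = (x - a') - (x - a)).
    by rewrite (le_lt_trans (ler_normB _ _))//; move: xa xa'; lra.
  rewrite (_ : (x - a') - (x - a) = a - a'); last by rewrite opprB addrC addrA subrK.
  by rewrite za za' opprD addrACA subrr add0r.
by move: xaa; rewrite za' -zz -za ltxx.
Qed.

End Lattice.

Section Generation.
Context {dT : measure_display} {T : measurableType dT} {R : realType}.
Context (P : probability T R) {d : nat} (X : nat -> {RV P >-> 'cV[R]_d}) (X_iid : iid P X).
Context (H : 'M[R]_d) (b : 'cV[R]_d).
Hypothesis H_unit : H \in unitmx.
Hypothesis X_supp : supported_on P (X 0%N) (translate b (lattice H)).
Hypothesis X_minimal : minimal_subgroup P (X 0%N) (lattice H).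

Notation mass := (mass X H b).

(** Membership in the subgroup of Z^d generated by the differences of
    atoms; swapping the entries of a pair accounts for signs. *)
Definition difference_sum (z : 'cV[int]_d) : Prop := exists s : seq (nat * nat),
  (forall ab, ab \in s -> 0 < mass ab.1 /\ 0 < mass ab.2) /\
  z = \sum_(ab <- s) (point ab.1 - point ab.2).

Lemma difference_sumB z w : difference_sum z -> difference_sum w -> difference_sum (z - w).
Proof.
move=> [s [sp ->]] [s' [sp' ->]]; exists (s ++ [seq (ab.2, ab.1) | ab <- s']); split.
  move=> ab; rewrite mem_cat => /orP[/sp//|/mapP[ab' /sp' [h1 h2] ->]].
  by split.
rewrite big_cat big_map /= -sumrN; congr (_ + _); apply: eq_bigr => ab _.
by rewrite opprB.
Qed.

(** The image under H of the subgroup generated by the differences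
    of atoms is closed, and X lies almost surely in its translate by any atom
    of positive mass.  Minimality forces it to contain H Z^d. *)
Lemma difference_sum_generate z : difference_sum z.
Proof.
pose L' : set 'cV[R]_d := [set H *m intv w | w in [set w | difference_sum w]].
have L'sub : L' `<=` lattice H by move=> _ [w _ <-]; exists w.
have cL' : closed_subgroup L'.
  split.
    by apply: (subcoset_closed H_unit (x0 := 0)) => _ [w _ <-]; exists w; rewrite add0r.
    by exists 0; [exists [::]; rewrite big_nil|rewrite intv0 mulmx0].
  move=> _ _ [u Lu <-] [w Lw <-]; exists (u - w); last by rewrite intvB mulmxBr.
  exact: difference_sumB.
have [k0 k00] : exists k, 0 < mass k.
  apply: contrapT => nk.
  have z0 k : mass k = 0.
    apply/eqP; rewrite eq_le mass_ge0 andbT leNgt; apply/negP => h; apply: nk; by exists k.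
  have := mass_sum_cvg X_iid H_unit X_supp; under eq_fun do rewrite big1//.
  by move=> /cvg_lim -/(_ (@Rhausdorff R)); rewrite lim_cst// => /eqP; rewrite eq_sym oner_eq0.
pose x0 := b + H *m intv (point k0).
have supp : supported_on P (X 0%N) (translate x0 L').
  have mS : measurable (X 0%N @^-1` translate x0 L').
    apply: measurable_funPTI; apply: measurable_closed_cv.
    apply: (subcoset_closed H_unit (x0 := b)) => _ [_ [w _ <-] <-].
    by exists (point k0 + w); rewrite /x0 intvD mulmxDr addrA.
  have h K : \sum_(k < K) mass k <= fine (P (X 0%N @^-1` translate x0 L')).
    rewrite -lee_fin fineK ?fin_num_measure//.
    have -> : \sum_(k < K) mass k = \sum_(k < K | 0 < mass k) mass k.
      rewrite [RHS]big_mkcond; apply: eq_bigr => k _.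
      by case: ifPn => //; rewrite -leNgt => hk; apply/eqP; rewrite eq_le hk mass_ge0.
    have -> : (\sum_(k < K | 0 < mass k) mass k)%:E =
        P (\bigcup_(k in [set k : 'I_K | 0 < mass k]) hit X H b 0 k).
      rewrite (@prob_fin_union _ _ _ P _ (fun k : 'I_K => 0 < mass k) (fun k => hit X H b 0 k)).
      - by rewrite -sumEFin; apply: eq_bigr => k _; rewrite massE.
      - by move=> k; exact: measurable_hit.
      - by move=> k l _ _ kl; apply/val_inj; exact: (@trivIset_hit _ _ _ _ _ X H b H_unit 0%N setT).
    apply: le_measure; rewrite ?inE//.
      by apply: fin_bigcup_measurable => // k _; exact: measurable_hit.
    move=> t [k /= mk /atomE E]; rewrite /= E; exists (H *m intv (point k - point k0)).
      exists (point k - point k0) => //; exists [:: (k : nat, k0)]; split.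
        by move=> ab; rewrite inE => /eqP ->.
      by rewrite big_seq1.
    by rewrite /x0 intvB mulmxBr -addrA; congr (_ + _); rewrite addrC subrK.
  apply/eqP; rewrite eq_le probability_le1//= -(@fineK _ (P _)) ?fin_num_measure// lee_fin.
  have mc := mass_sum_cvg X_iid H_unit X_supp.
  have <- := cvg_lim (@Rhausdorff R) mc.
  by apply: limr_le; [apply/cvg_ex; exists 1|exact: nearW].
have [_ _ min] := X_minimal.
have /min : supported_on P (X 0%N) (translate x0 L') by [].
move=> /(_ cL') /(_ (H *m intv z)) [|w Lw E]; first by exists z.
have -> : z = w; last by [].
by apply: (@lattice_inj _ _ H b H_unit); rewrite E.
Qed.

End Generation.

(** * Change of coordinates and scaling *)

Section Change.
Context {R : realType} {d : nat} (H M : 'M[R]_d).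
Hypothesis H_unit : H \in unitmx.
Hypothesis M_pos : posdefmx M.

(** The limit covariance in the coordinates in which the lattice is Z^d; the
    factor 1/3 is the limit of N^-3 (1 + 4 + .. + N^2). *)
Definition reduced_cov : 'M[R]_d := 3^-1 *: (invmx H *m M *m (invmx H)^T).

Lemma reduced_cov_quad x : dotv x (reduced_cov *m x) = 3^-1 * dotv ((invmx H)^T *m x) (M *m ((invmx H)^T *m x)).
Proof.
rewrite /reduced_cov -scalemxAl dotvZr; congr (_ * _).
by rewrite /dotv trmx_mul trmxK !mulmxA.
Qed.

Lemma reduced_cov_pos : posdefmx reduced_cov.
Proof.
split; first by rewrite /reduced_cov linearZ /= !trmx_mul trmxK M_pos.1 mulmxA.
move=> x x0; rewrite reduced_cov_quad mulr_gt0//; apply: M_pos.2.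
apply: contra x0 => /eqP/(congr1 (mulmx H^T)).
by rewrite mulmx0 mulmxA -trmx_mul mulVmx// trmx1 mul1mx => ->.
Qed.

Lemma M_unit : M \in unitmx.
Proof. by rewrite unitmxE unitfE gt_eqF// posdef_det. Qed.

Definition reduced_cov_inv (xi : 'cV[R]_d) : 'cV[R]_d := 3 *: (H^T *m (invmx M *m (H *m xi))).

Lemma reduced_cov_invK xi : reduced_cov *m reduced_cov_inv xi = xi.
Proof.
rewrite /reduced_cov /reduced_cov_inv -scalemxAl -scalemxAr scalerA mulVf// scale1r.
rewrite -!mulmxA (mulmxA (invmx H)^T) -trmx_mul mulmxV// trmx1 mul1mx.
by rewrite (mulmxA M) mulmxV ?M_unit// mul1mx mulKmx.
Qed.

(** The density in lattice coordinates, in the form produced by the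
    Gaussian transform. *)
Lemma com_density_change xi :
  `|\det H| * com_density M (H *m xi) =
  (2 * pi) ^- d * (Num.sqrt (2 * pi) ^+ d / Num.sqrt (\det reduced_cov) *
   expR (- (dotv (reduced_cov_inv xi) (reduced_cov *m reduced_cov_inv xi) / 2))).
Proof.
have p0 : 0 < 2 * pi :> R by rewrite mulr_gt0// pi_gt0.
rewrite /com_density reduced_cov_invK.
have dH : 0 < `|\det H| by rewrite normr_gt0 -unitfE -unitmxE.
have -> : - (dotv (reduced_cov_inv xi) xi / 2) = - (3 / 2) * dotv (H *m xi) (invmx M *m (H *m xi)).
  rewrite /reduced_cov_inv dotvZl mulrAC -mulNr; congr (_ * _); rewrite dotvC /dotv trmx_mul mulmxA.
  by [].
have -> : \det (3^-1 *: M) = (\det H) ^+ 2 * \det reduced_cov.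
  rewrite /reduced_cov !detZ !det_mulmx det_tr det_inv.
  by field; rewrite -unitfE -unitmxE.
rewrite sqrtrM ?sqr_ge0// sqrtr_sqr.
have -> : (2 * pi) `^ (d%:R / 2) = Num.sqrt (2 * pi) ^+ d :> R.
  by rewrite [d%:R / 2]mulrC powRrM powR12_sqrt ?(ltW p0)// powR_mulrn ?sqrtr_ge0.
have q0 : 0 < Num.sqrt (2 * pi) :> R by rewrite sqrtr_gt0.
have r0 : 0 < Num.sqrt (\det reduced_cov) by rewrite sqrtr_gt0 posdef_det//; exact: reduced_cov_pos.
have -> : (2 * pi) ^+ d = Num.sqrt (2 * pi) ^+ d * Num.sqrt (2 * pi) ^+ d :> R.
  by rewrite -exprMn -expr2 sqr_sqrtr// ltW.
have qd : Num.sqrt (2 * pi) ^+ d != 0 :> R by rewrite expf_neq0// gt_eqF.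
move: (Num.sqrt (2 * pi) ^+ d) qd (Num.sqrt (\det reduced_cov)) r0 `|\det H| dH (expR _) => q qd r r0 D D0 E.
by field; rewrite qd !gt_eqF.
Qed.

End Change.

Section Scale.
Context {R : realType}.
Variable n : nat.
Let N : R := n.+1%:R.
Definition scale : R := N `^ (- (3 / 2)).

Lemma scale_gt0 : 0 < scale. Proof. by rewrite powR_gt0. Qed.

Lemma scaleN3 : scale ^+ 2 * N ^+ 3 = 1.
Proof.
rewrite /scale -powR_mulrn ?powR_ge0// -powRrM.
rewrite (_ : - (3 / 2) * 2%:R = - 3%:R); last by field.
by rewrite powRN powR_mulrn ?ler0n// mulVf// expf_neq0// pnatr_eq0.
Qed.

Lemma scale_pow d : N `^ ((3 * d)%:R / 2) = scale^-1 ^+ d.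
Proof.
rewrite /scale powRN invrK natrM mulrAC powRrM powR_mulrn//.
exact: powR_ge0.
Qed.

(** A crude integral power in place of N^(3/2). *)
Lemma scale_inv_le : scale^-1 <= N ^+ 2.
Proof.
have N1 : 1 <= N by rewrite ler1n.
have s0 := scale_gt0.
rewrite -[leLHS]mul1r ler_pdivrMr//.
rewrite -(@ler_pXn2r _ 2)// ?nnegrE ?mulr_ge0 ?(ltW s0)//.
rewrite expr1n exprMn mulrC; have := scaleN3.
have : N ^+ 3 <= N ^+ 2 ^+ 2 by rewrite -exprM; apply: ler_weXn2l.
by move=> h E; rewrite -[leLHS]E ler_wpM2l// sqr_ge0.
Qed.

Lemma scale_half : N `^ (- 2^-1) = N * scale.
Proof.
by rewrite /scale -[X in X * _](powRr1 (ler0n _ _)) -powRD; [congr (_ `^ _); field|apply/implyP => _; rewrite /N pnatr_eq0].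
Qed.

Lemma scale_mu : (N + 1) / (2 * N `^ 2^-1) = scale * (N * (N + 1) / 2).
Proof.
have h : (N `^ 2^-1)^-1 = N * scale by rewrite -powRN scale_half.
by rewrite invfM h; field.
Qed.

End Scale.

Section WalkSum.
Context {R : realType} {d : nat} {T : Type} (Y : nat -> T -> 'cV[R]_d).

(** The step i + 1 belongs to N - i of the first N partial sums. *)
Lemma sum_walk N t : \sum_(1 <= i < N.+1) walk Y i t = \sum_(i < N) (weight i : R) *: Y i.+1 t.
Proof.
elim: N => [|N IH]; first by rewrite big_geq// big_ord0.
rewrite big_nat_recr//= IH big_ord_recr /= /weight subSnn scale1r.
have -> : walk Y N.+1 t = \sum_(i < N) Y i.+1 t + Y N.+1 t.
  by rewrite /walk big_add1 /= big_mkord big_ord_recr.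
rewrite addrA -big_split /=; congr (_ + _); apply: eq_bigr => i _.
by rewrite subSn ?(ltnW (ltn_ord i))// -natr1 scalerDl scale1r.
Qed.

End WalkSum.

(** * The local limit theorem *)

Theorem theorem7p2p1 (R : realType) (dT : measure_display)
    (T : measurableType dT) (P : probability T R) (d : nat) (d_ge1 : (1 <= d)%N)
    (X : nat -> {RV P >-> 'cV[R]_d}) (X_iid : iid P X)
    (H : 'M[R]_d) (h : R) (hE : h = `|\det H|) (h_gt0 : 0 < h)
    (X_nondegenerate : non_degenerate P (X 0%N))
    (X_lattice : lattice_distribution P (X 0%N))
    (X_minimal : minimal_subgroup P (X 0%N) (lattice H))
    (b : 'cV[R]_d) (X_supp : supported_on P (X 0%N) (translate b (lattice H)))
    (X_moment : ('E_P[fun t => (enorm (X 0%N t) ^+ 2)%R] < +oo)%E)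
    (mu : 'cV[R]_d) (muE : mu = expectation_mx P (X 0%N))
    (M : 'M[R]_d) (ME : M = covariance_mx P (X 0%N)) (M_posdef : posdefmx M) :
  ereal_sup
    [set (`| n%:R `^ ((3 * d)%:R / 2) / h * com_pmf P X n x
             - com_density M (x - ((n%:R + 1) / (2 * n%:R `^ 2^-1)) *: mu) |)%:E
    | x in com_lattice b H n] @[n --> \oo] --> 0%E.
Proof.
have detH : 0 < `|\det H| by rewrite -hE.
have H_unit : H \in unitmx by rewrite unitmxE unitfE -normr_gt0.
have p0 : 0 < 2 * pi :> R by rewrite mulr_gt0// pi_gt0.
pose mass := mass X H b; pose V := reduced_cov H M.
pose m := invmx H *m (mu - b).
pose tail K : R := 1 - \sum_(k < K) mass k.
have tail_cvg : tail K @[K --> \oo] --> 0.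
  rewrite -[X in _ --> X](subrr (1 : R)); apply: cvgB; first exact: cvg_cst.
  exact: (mass_sum_cvg X_iid H_unit X_supp).
have tail_ge0 K : 0 <= tail K by rewrite subr_ge0 mass_sum_le1.
(* The truncation level is chosen so that the tail, multiplied by the number
   n + 1 of steps and by the crude bound (n + 1)^(2 d) for (n + 1)^(3 d / 2), is
   at most 1 / (n + 1).  In what follows n stands for the number of steps minus
   one. *)
have /choice [K_ hK] n : exists K, (n <= K)%N /\ tail K <= (n.+1%:R ^+ (2 * d + 2))^-1.
  have e0 : 0 < (n.+1%:R ^+ (2 * d + 2))^-1 :> R by rewrite invr_gt0 exprn_gt0.
  have /cvgrPdist_le /(_ _ e0) [K0 _ hK0] := tail_cvg.
  exists (maxn n K0); split; first exact: leq_maxl.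
  by have := hK0 (maxn n K0) (leq_maxr _ _); rewrite sub0r normrN /= ger0_norm.
have K_large K0 : \forall n \near \oo, (K0 <= K_ n)%N.
  by exists K0 => // n /= hn; apply: leq_trans hn _; exact: (hK n).1.
pose s_ n := scale (R := R) n.
have s_gt0 n : 0 < s_ n by exact: scale_gt0.
have V_pos : posdefmx V by exact: reduced_cov_pos.
have tail_small n : (n.+1%:R ^+ 2) ^+ d * (n.+1%:R * tail (K_ n)) <= n.+1%:R^-1 :> R.
  have N0 : 0 < n.+1%:R :> R by [].
  have -> : n.+1%:R^-1 = (n.+1%:R ^+ 2) ^+ d * (n.+1%:R * (n.+1%:R ^+ (2 * d + 2))^-1) :> R.
    have x0 : n.+1%:R != 0 :> R by rewrite pnatr_eq0.
    have y0 := expf_neq0 (2 * d) x0.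
    by rewrite -exprM exprD (invfM (_ ^+ (2 * d))) expr2 invfM (mulrCA _ n.+1%:R) !mulrA mulfK // mulfV // mul1r.
  by rewrite ler_wpM2l ?exprn_ge0// ler_wpM2l//; exact: (hK n).2.
have tail_smaller n : n.+1%:R * tail (K_ n) <= n.+1%:R^-1 :> R.
  apply: le_trans (tail_small n); rewrite ler_peMl ?mulr_ge0//.
  by rewrite !exprn_ege1// ler1n.
have lim_psi t : normc (prodpsi mass (@point d) (K_ n) m n.+1 (s_ n) t - rc (gauss_charf V t)) @[n --> \oo] --> 0.
  have quad : 3 * dotv t (V *m t) = dotv (dual H t) (M *m dual H t).
    by rewrite reduced_cov_quad mulrA divff// mul1r.
  apply: (@prodpsi_cvg_gauss R d mass (@point d) _ _ K_ s_ m V t _ _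
     (charf P (proj X H mu t)) (fun n => 2 * tail (K_ n))).
  - exact: mass_ge0.
  - exact: mass_sum_le1.
  - by move=> n; exact: ltW.
  - by move=> n; exact: scaleN3.
  - by move=> n r; exact: psi_charf.
  - apply: (@squeeze_cvgr _ _ _ _ (cst 0) (fun n => 2 * n.+1%:R^-1)).
    + apply: nearW => n; rewrite mulrCA mulr_ge0// ?mulr_ge0//=.
      by rewrite ler_wpM2l// tail_smaller.
    + exact: cvg_cst.
    + rewrite -[X in _ --> X](mulr0 2); apply: cvgMr; exact: cvg_harmonic.
  - have [->|t0] := eqVneq t 0; first by rewrite mulmx0 dotv0r.
    by apply: ltW; exact: V_pos.2.
  - move=> e e0; rewrite quad.
    have [i2 E2] := proj_sqr H X_moment muE ME t.
    apply: (charf_expansion (measurable_proj X H mu t) i2 _ E2 e0).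
    exact: integral_proj.
have gen k : exists s : seq (nat * nat),
    (forall ab, ab \in s -> 0 < mass ab.1 /\ 0 < mass ab.2) /\
    delta_mx k 0 = \sum_(ab <- s) (point ab.1 - point ab.2) :> 'cV[int]_d.
  exact: (difference_sum_generate X_iid H_unit X_supp X_minimal (delta_mx k 0)).
have [n0 hadm hItg] := @iterint_gap_cvg R d mass (@point d) (mass_ge0 X H b) (mass_sum_le1 X_iid b H_unit)
  gen K_ s_ m V (fun n => ltW (s_gt0 n)) (fun n => @scaleN3 R n) K_large lim_psi.
pose I_ n := iterint (gap mass (@point d) (K_ n) m n.+1 (s_ n) V).
(* The two terms are the truncation error and the L1 distance of the
   integrands; neither depends on the lattice point. *)
pose bnd n : R := h^-1 * (n.+1%:R^-1 + (2 * pi) ^- d * I_ n).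
have bnd_cvg : bnd n @[n --> \oo] --> 0.
  rewrite -[X in _ --> X](mulr0 h^-1); apply: cvgMr.
  rewrite -[X in _ --> X](addr0 0); apply: cvgD; first exact: cvg_harmonic.
  by rewrite -[X in _ --> X](mulr0 ((2 * pi) ^- d)); apply: cvgMr.
pose site n z : 'cV[R]_d :=
  n.+1%:R `^ (- (3 / 2)) *: ((2^-1 * n.+1%:R * (n.+1%:R + 1)) *: b + H *m intv z).
have key n z : (n0 <= n)%N ->
    `| n.+1%:R `^ ((3 * d)%:R / 2) / h * com_pmf P X n.+1 (site n z)
       - com_density M (site n z - ((n.+1%:R + 1) / (2 * n.+1%:R `^ 2^-1)) *: mu) | <= bnd n.
  set x := site n z => nN0; pose W : R := \sum_(i < n.+1) weight i.
  have WE : W = 2^-1 * n.+1%:R * (n.+1%:R + 1) by rewrite /W sum_id; field.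
  (* The argument of the density in lattice coordinates: z minus its mean,
     rescaled. *)
  pose xi : 'cV[R]_d := s_ n *: (intv z - W *: m).
  have Hm : H *m m = mu - b by rewrite /m mulKVmx.
  have xiE : x - ((n.+1%:R + 1) / (2 * n.+1%:R `^ 2^-1)) *: mu = H *m xi.
    rewrite scale_mu /x /site -WE (_ : n.+1%:R * (n.+1%:R + 1) / 2 = W); last by rewrite WE; field.
    rewrite -scalerA -scalerBr /xi -scalemxAr mulmxBr -scalemxAr Hm (scalerBr W) opprB.
    by congr (_ *: _); rewrite [W *: b + _]addrC -addrA.
  have pmfE : com_pmf P X n.+1 x = fine (P (event X H b n z)).
    rewrite /com_pmf; congr (fine (P _)); apply/seteqP; split => t /=.
      rewrite /centre_of_mass sum_walk scalerA scale_half mulrAC divff ?pnatr_eq0// mul1r.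
      rewrite /x /site -WE => /scalerI; apply; exact: lt0r_neq0 (s_gt0 n).
    move=> E; rewrite /centre_of_mass sum_walk scalerA scale_half mulrAC divff ?pnatr_eq0// mul1r.
    by rewrite /x /site -WE; congr (_ *: _); exact: E.
  rewrite pmfE xiE scale_pow.
  set pn := fine _; set sd := (scale n)^-1 ^+ d.
  pose q := truncated_pmf mass (@point d) (K_ n) n.+1 z.
  have e1 : `|pn - q| <= n.+1%:R * tail (K_ n) by exact: prob_event_approx.
  have e2 := trunc_error (s_gt0 n) V_pos (reduced_cov_invK H_unit M_posdef xi) (hadm n nN0).
  have e3 := com_density_change H_unit M_posdef xi.
  rewrite -hE in e3; rewrite -/q -/(I_ n) in e2.
  move: e2 e3; set G := Num.sqrt (2 * pi) ^+ d / _ * _ => e2 e3.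
  have h0 : 0 < h^-1 by rewrite invr_gt0.
  have sd0 : 0 <= sd by rewrite exprn_ge0// invr_ge0 ltW.
  have sdle : sd <= (n.+1%:R ^+ 2) ^+ d.
    rewrite lerXn2r ?nnegrE ?exprn_ge0//; first by rewrite invr_ge0 ltW.
    exact: scale_inv_le.
  have c0 : 0 <= (2 * pi) ^- d :> R by rewrite invr_ge0 exprn_ge0 ?ltW.
  have -> : sd / h * pn - com_density M (H *m xi) = h^-1 * (sd * (pn - q) + (2 * pi) ^- d * (q * (2 * pi / s_ n) ^+ d - G)).
    have -> : com_density M (H *m xi) = h^-1 * ((2 * pi) ^- d * G).
      by rewrite -e3 mulKf// gt_eqF.
    have -> : (2 * pi / s_ n) ^+ d = (2 * pi) ^+ d * sd.
      by rewrite exprMn.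
    have cc : (2 * pi) ^- d * (2 * pi) ^+ d = 1 :> R by rewrite mulVf// expf_neq0// gt_eqF.
    move: ((2 * pi) ^+ d) cc => v vv.
    have -> : v^-1 * (q * (v * sd) - G) = (v^-1 * v) * q * sd - v^-1 * G by ring.
    rewrite vv; ring.
  rewrite normrM gtr0_norm// /bnd ler_pM2l//.
  apply: (le_trans (ler_normD _ _)); rewrite !normrM (ger0_norm sd0) (ger0_norm c0).
  apply: lerD; last exact: ler_wpM2l.
  apply: le_trans (tail_small n).
  by apply: ler_pM => //.
have bnd_cvgE : (bnd n)%:E @[n --> \oo] --> 0%E by apply: cvg_EFin => //; exact: nearW.
rewrite -cvg_shiftS; apply: squeeze_cvge (cvg_cst 0%E) bnd_cvgE.
exists n0 => // n nn0; apply/andP; split.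
  apply: ereal_sup_ge; eexists.
    by exists (site n 0); [exists 0|reflexivity].
  by rewrite lee_fin.
apply: ub_ereal_sup => _ [_ [z _ <-] <-]; rewrite lee_fin; exact: key.
Qed.
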